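(* Let $s\ge 1$ and let $C_1,C_2\in M_s(\mathbb C)$ be matrices of (operator) norm $1$. Let $\mathfrak P$ be the free spectrahedron associated to $(C_1,C_2)$ (defined in the context). If (i) $C_1$ and $C_2$ are invertible; and (ii) the $C^*$-algebra generated by $\{C_1^*C_1,\,C_2^*C_2\}$ and the $C^*$-algebra generated by $\{C_1C_1^*,\,C_2C_2^*\}$ are both equal to $M_s(\mathbb C)$, then every automorphism $\varphi$ of $\mathfrak P$ is trivial; that is, there exist $\gamma_1,\gamma_2\in\mathbb C$ with $|\gamma_1|=|\gamma_2|=1$ such that either $\varphi(x)=(\gamma_1x_1,\gamma_2x_2)$ or $\varphi(x)=(\gamma_2x_2,\gamma_1x_1)$.
   Context: $M_n(\mathbb C)^2$ is the set of pairs $X=(X_1,X_2)$ of $n\times n$ complex matrices, and $M(\mathbb C)$, $M(\mathbb C)^2$ denote the sequences $(M_n(\mathbb C))_n$, $(M_n(\mathbb C)^2)_n$. For $X\in M_n(\mathbb C)^2$ put $$\mathscr L(X)=\begin{pmatrix} I_s\otimes I_n & C_1\otimes X_1 & C_2\otimes X_2 & 0\\ (C_1\otimes X_1)^* & I_s\otimes I_n & 0 & C_2\otimes X_2\\ (C_2\otimes X_2)^* & 0 & I_s\otimes I_n & C_1\otimes X_1\\ 0 & (C_2\otimes X_2)^* & (C_1\otimes X_1)^* & I_s\otimes I_n\end{pmatrix}.$$ Here $\otimes$ is the Kronecker product and $*$ the conjugate transpose. $\mathfrak P[n]$ is the set of $X\in M_n(\mathbb C)^2$ for which $\mathscr L(X)$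 is positive definite, and $\mathfrak P=(\mathfrak P[n])_{n\ge1}$. For $X\in M_n(\mathbb C)^2$, $Y\in M_m(\mathbb C)^2$ and a unitary $U\in M_n(\mathbb C)$, $X\oplus Y=(X_1\oplus Y_1,X_2\oplus Y_2)$ (block diagonal) and $U^*XU=(U^*X_1U,U^*X_2U)$. A free analytic function $f:\mathfrak P\to M(\mathbb C)$ is a sequence $(f[n])_n$ of analytic functions $f[n]:\mathfrak P[n]\to M_n(\mathbb C)$ (with $f[n]$ written $f$) such that $f(X\oplus Y)=f(X)\oplus f(Y)$ and $f(U^*XU)=U^*f(X)U$ for all $X\in\mathfrak P[n]$, $Y\in\mathfrak P[m]$ and all unitary $U\in M_n(\mathbb C)$. A free analytic mapping $\varphi=(\varphi_1,\varphi_2):\mathfrak P\to\mathfrak P$ is a pair of free analytic functions $\varphi_j:\mathfrak P\to M(\mathbb C)$ such that $\varphi(X)=(\varphi_1(X),\varphi_2(X))\in\mathfrak P$ for all $X\in\mathfrak P$. An automorphism of $\mathfrak P$ is a free analytic mapping $\varphi:\mathfrak P\to\mathfrak P$ for which there is a free analytic mapping $\psi:\mathfrak P\to\mathfrak P$ with $\psi(\varphi(X))=X=\varphi(\psi(X))$ for all $X\in\mathfrak P$. *)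

(* Defs.v *)
From HB Require Import structures.
From mathcomp Require Import all_boot all_order all_algebra.
From mathcomp Require Import finmap complex mxtens.
From mathcomp Require Import all_classical all_reals all_analysis.

Set Implicit Arguments.
Unset Strict Implicit.
Unset Printing Implicit Defensive.

Import Order.TTheory GRing.Theory Num.Theory.
Import numFieldNormedType.Exports.

Local Open Scope classical_set_scope.
Local Open Scope sesquilinear_scope.
Local Open Scope ring_scope.

(* Naming R[i] at type numClosedFieldType is what lets the generic topological
   instances on the sort of a numFieldType, and on matrices, be inferred. *)
Definition cplx (R : realType) : numClosedFieldType := R[i].

Notation mxpair R n := ('M[cplx R]_n * 'M[cplx R]_n)%type.

Section Matrices.
Variable R : realType.
Local Notation C := (cplx R).

Definition vnorm n (v : 'cV[C]_n) : R :=
  Num.sqrt (\sum_i complex.Re `|v i 0| ^+ 2).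

Definition opnorm m n (A : 'M[C]_(m, n)) : R :=
  sup [set vnorm (A *m v) | v in [set v : 'cV[C]_n | vnorm v <= 1]].

Definition posdefmx n (A : 'M[C]_n) : Prop :=
  A ^t* = A /\ forall v : 'cV[C]_n, v != 0 -> 0 < (v ^t* *m A *m v) 0 0.

(* C*-subalgebras are not required to be unital. *)
Definition cstar_subalgebra s (S : set 'M[C]_s) : Prop :=
  [/\ S 0,
      forall A B, S A -> S B -> S (A + B),
      forall (a : C) A, S A -> S (a *: A),
      forall A B, S A -> S B -> S (A *m B) &
      (forall A, S A -> S (A ^t*)) /\ closed S].

Definition cstar_generated s (G : set 'M[C]_s) : set 'M[C]_s :=
  \bigcap_(S in [set S | cstar_subalgebra S /\ G `<=` S]) S.

Definition dsum_mx n m (A : 'M[C]_n) (B : 'M[C]_m) : 'M[C]_(n + m) :=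
  block_mx A 0 0 B.

Definition dsum_pair n m (X : mxpair R n) (Y : mxpair R m) : mxpair R (n + m) :=
  (dsum_mx X.1 Y.1, dsum_mx X.2 Y.2).

Definition uconj_mx n (U A : 'M[C]_n) : 'M[C]_n := U ^t* *m A *m U.

Definition uconj_pair n (U : 'M[C]_n) (X : mxpair R n) : mxpair R n :=
  (uconj_mx U X.1, uconj_mx U X.2).

(* The 4 x 4 block matrix L(X), as a 2 x 2 block matrix of 2 x 2 blocks. *)
Definition pencil s (C1 C2 : 'M[C]_s) n (X : mxpair R n) :
    'M[C]_((s * n + s * n) + (s * n + s * n)) :=
  let I := (1%:M : 'M[C]_s) *t (1%:M : 'M[C]_n) in
  let A1 := C1 *t X.1 in
  let A2 := C2 *t X.2 in
  block_mx
    (block_mx I          A1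
              (A1 ^t*)   I)         (block_mx A2         0
                                              0          A2)
    (block_mx (A2 ^t*)   0
              0          (A2 ^t*))  (block_mx I          A1
                                              (A1 ^t*)   I).

Definition spectrahedron s (C1 C2 : 'M[C]_s) n : set (mxpair R n) :=
  [set X | posdefmx (pencil C1 C2 X)].

End Matrices.

Section Analyticity.

(* The net of finite subsets: its limits are sums of unconditionally
   (equivalently here, absolutely) convergent multiple series. *)
Definition finite_sets (I : choiceType) : set_system {fset I} :=
  filter_from [set: {fset I}] (fun A => [set B : {fset I} | (A `<=` B)%fset]).

Variable R : realType.
Local Notation C := (cplx R).

Definition has_sum (I : choiceType) n (x : I -> 'M[C]_n) (l : 'M[C]_n) : Prop :=
  (fun A : {fset I} => \sum_(i <- A) x i) @ @finite_sets I --> l.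

(* A multi-index is a pair of matrices of exponents, one exponent per entry. *)
Definition monomial n (a : 'M[nat]_n * 'M[nat]_n) (H : mxpair R n) : C :=
  \prod_(i < n) \prod_(j < n) (H.1 i j ^+ a.1 i j * H.2 i j ^+ a.2 i j).

Definition polydisc n (r : C) : set (mxpair R n) :=
  [set H : mxpair R n | forall i j, `|H.1 i j| < r /\ `|H.2 i j| < r].

(* Every point of D is the center of a polydisc contained in D on which f is the
   sum of a power series in the 2 n^2 matrix entries. *)
Definition analytic_on n (D : set (mxpair R n)) (f : mxpair R n -> 'M[C]_n) : Prop :=
  forall X, D X -> exists r : C, 0 < r /\
    exists c : 'M[nat]_n * 'M[nat]_n -> 'M[C]_n,
      forall H, polydisc r H ->
        D (X + H) /\ has_sum (fun a => monomial a H *: c a) (f (X + H)).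

End Analyticity.

Section FreeMaps.
Variables (R : realType) (P : forall n, set (mxpair R n)).
Local Notation C := (cplx R).
Local Open Scope nat_scope.

(* Functions are total, but only their restrictions to the P n with n >= 1 are
   meaningful: nothing is said of values at other points, nor at n = 0. *)
Definition free_analytic_fun (f : forall n, mxpair R n -> 'M[C]_n) : Prop :=
  [/\ forall n, 0 < n -> analytic_on (@P n) (f n),
      forall n m (X : mxpair R n) (Y : mxpair R m), 0 < n -> 0 < m ->
        P X -> P Y -> f (n + m) (dsum_pair X Y) = dsum_mx (f n X) (f m Y) &
      forall n (X : mxpair R n) (U : 'M[C]_n), 0 < n ->
        P X -> U \is unitarymx -> f n (uconj_pair U X) = uconj_mx U (f n X)].

Definition free_analytic_map (phi : forall n, mxpair R n -> mxpair R n) : Prop :=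
  [/\ free_analytic_fun (fun n X => (phi n X).1),
      free_analytic_fun (fun n X => (phi n X).2) &
      forall n (X : mxpair R n), 0 < n -> P X -> P (phi n X)].

Definition free_automorphism (phi : forall n, mxpair R n -> mxpair R n) : Prop :=
  free_analytic_map phi /\
  exists psi : forall n, mxpair R n -> mxpair R n,
    free_analytic_map psi /\
    forall n (X : mxpair R n), 0 < n -> P X ->
      psi n (phi n X) = X /\ phi n (psi n X) = X.

End FreeMaps.

(* Main.v *)
(** Matrices upper triangular over a scalar point b, with blocks [[b, h], [0, b]], reduce the
    theorem to linear algebra: a free analytic map sends them to [[phi(b), l h], [0, phi(b)]]
    where l is the 2 x 2 complex derivative, so an automorphism taking 0 to b carries the unit
    ball of the pencil at 0 linearly onto that of the pencil at b.  The pencil at 0 is the sum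
    of a row and a column pencil, each irreducible by hypothesis; comparing the pairings of
    pencils that attain their norm shows that one of them is a direct summand of the pencil at
    b, and the resulting identities force b = 0, or l to have a zero on the diagonal.
    Applied to the maps phi (u psi(X)), |u| = 1, whose derivatives tend to 1 as u tends to 1,
    this gives phi(0) = 0.  Cartan's uniqueness theorem then makes phi linear, the same
    identities at b = 0 make its matrix l monomial, and the norms of C1 and C2 make the
    nonzero entries of l unimodular. *)
From HB Require Import structures.
Require Import Defs.
From mathcomp Require Import all_boot all_order all_algebra.
From mathcomp Require Import finmap complex mxtens.
From mathcomp Require Import all_classical all_reals all_analysis.
From mathcomp Require Import ring lra.
Set Implicit Arguments.
Unset Strict Implicit.
Unset Printing Implicit Defensive.
Import Order.TTheory GRing.Theory Num.Theory.
Import numFieldNormedType.Exports.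
Local Open Scope classical_set_scope.
Local Open Scope sesquilinear_scope.
Local Open Scope ring_scope.

(** * Complex numbers *)

(** The unit balls at 0 and at b are compared for corners h of every shape p x q. This makes them
    matrix-valued norms, and the coefficients of one pencil can serve as directions for the other:
    pencils are paired with each other and with themselves. The Cauchy-Schwarz inequality for such
    pairings has an equality case that produces isometries intertwining the coefficients. Of the two
    pieces of the pencil at 0 only one of largest norm is detected; passing to adjoints and
    reversing the blocks exchanges the pieces, so the row may be assumed to dominate. A point b
    different from 0 is not excluded outright: the identities obtained there are C1 C2 + C2 C1 = 0
    and a zero on the diagonal of l. A derivative close to 1 has no such zero, which is why a family
    of automorphisms tending to the identity is used. For s = 1 the matrices C1 C1^* and C2 C2^*
    commute. Anticommutation still excludes b different from 0, but at b = 0 the shape of l has to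
    come from elsewhere: the first level of the domain is then a weighted l1 ball. *)

Section ComplexNumbers.
Variable R : realType.
Local Notation C := (cplx R).
Implicit Types x y z : C.

Definition re (x : C) : R := complex.Re x.
Definition im (x : C) : R := complex.Im x.
(** The norm of [cplx R] takes its values in [cplx R] itself; a modulus in [R] gives estimates in a
    real ordered field, within reach of [lra] and [nra]. *)
Definition cabs (x : C) : R := Normc.normc x.
Definition rc (t : R) : C := t%:C%C.

Lemma reD x y : re (x + y) = re x + re y. Proof. by case: x; case: y. Qed.
Lemma reN x : re (- x) = - re x. Proof. by case: x. Qed.
Lemma re_is_zmod_morphism : zmod_morphism re.
Proof. by move=> x y; rewrite reD reN. Qed.
HB.instance Definition _ := GRing.isZmodMorphism.Build C R re re_is_zmod_morphism.

Lemma imD x y : im (x + y) = im x + im y. Proof. by case: x; case: y. Qed.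
Lemma imN x : im (- x) = - im x. Proof. by case: x. Qed.
Lemma im_is_zmod_morphism : zmod_morphism im.
Proof. by move=> x y; rewrite imD imN. Qed.
HB.instance Definition _ := GRing.isZmodMorphism.Build C R im im_is_zmod_morphism.
Lemma reB x y : re (x - y) = re x - re y. Proof. exact: raddfB. Qed.
Lemma imB x y : im (x - y) = im x - im y. Proof. exact: raddfB. Qed.
Lemma reM x y : re (x * y) = re x * re y - im x * im y.
Proof. by case: x; case: y. Qed.
Lemma imM x y : im (x * y) = re x * im y + im x * re y.
Proof. by case: x => a b; case: y => c d /=; rewrite /im /re /= addrC [b * c]mulrC. Qed.
Lemma re_conj x : re (x^*) = re x. Proof. by case: x. Qed.
Lemma im_conj x : im (x^*) = - im x. Proof. by case: x. Qed.
Lemma rc_is_zmod_morphism : zmod_morphism rc.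
Proof. by move=> x y; rewrite /rc rmorphB. Qed.
Lemma rc_is_monoid_morphism : monoid_morphism rc.
Proof. by split=> [//|x y]; rewrite /rc rmorphM. Qed.
HB.instance Definition _ := GRing.isZmodMorphism.Build R C rc rc_is_zmod_morphism.
HB.instance Definition _ := GRing.isMonoidMorphism.Build R C rc rc_is_monoid_morphism.
Lemma re_rc t : re (rc t) = t. Proof. by []. Qed.
Lemma im_rc t : im (rc t) = 0. Proof. by []. Qed.
Lemma conj_rc t : (rc t)^* = rc t. Proof. exact: conjc_real. Qed.
Lemma re_rcM t x : re (rc t * x) = t * re x.
Proof. by rewrite reM re_rc im_rc mul0r subr0. Qed.
Lemma complex_eq x y : re x = re y -> im x = im y -> x = y.
Proof. by case: x; case: y => a b c d; rewrite /re /im /= => -> ->. Qed.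
Lemma complex_rect x : x = rc (re x) + 'i * rc (im x).
Proof. by case: x => a b; rewrite [LHS]complexE. Qed.

Lemma rc_real x : x^* = x -> x = rc (re x).
Proof.
move=> e; apply: complex_eq; rewrite ?re_rc ?im_rc //.
by have := im_conj x; rewrite e; lra.
Qed.

Lemma cabs_sqr x : cabs x ^+ 2 = re x ^+ 2 + im x ^+ 2.
Proof.
by case: x => a b; rewrite /cabs /= sqr_sqrtr // addr_ge0 ?sqr_ge0.
Qed.
Lemma cabs_ge0 x : 0 <= cabs x.
Proof. by case: x => a b; rewrite /cabs /= sqrtr_ge0. Qed.
Lemma cabs_sqr_conj x : cabs x ^+ 2 = re (x * x^*).
Proof. rewrite cabs_sqr reM re_conj im_conj; ring. Qed.
Lemma norm_cabs x : `|x| = rc (cabs x). Proof. by []. Qed.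
Lemma cabs0 : cabs 0 = 0. Proof. exact: Normc.normc0. Qed.
Lemma cabs1 : cabs 1 = 1. Proof. exact: Normc.normc1. Qed.
Lemma cabsM x y : cabs (x * y) = cabs x * cabs y. Proof. exact: Normc.normcM. Qed.
Lemma cabsV x : cabs x^-1 = (cabs x)^-1. Proof. exact: Normc.normcV. Qed.
Lemma cabsN x : cabs (- x) = cabs x. Proof. exact: normcN. Qed.
Lemma cabsD x y : cabs (x + y) <= cabs x + cabs y. Proof. exact: le_normcD. Qed.
Lemma cabsB x y : cabs (x - y) = cabs (y - x).
Proof. by rewrite -cabsN opprB. Qed.
Lemma cabs_eq0 x : (cabs x == 0) = (x == 0).
Proof. by apply/eqP/eqP => [/Normc.eq0_normc//|->]; rewrite cabs0. Qed.
Lemma cabs_gt0 x : (0 < cabs x) = (x != 0).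
Proof. by rewrite lt_neqAle cabs_ge0 andbT eq_sym cabs_eq0. Qed.
Lemma cabs_conj x : cabs (x^*) = cabs x.
Proof. by case: x => a b; rewrite /cabs /= sqrrN. Qed.
Lemma cabsX x n : cabs (x ^+ n) = cabs x ^+ n.
Proof. by elim: n => [|n ih]; rewrite ?cabs1 // !exprS cabsM ih. Qed.
Lemma cabs_rc t : cabs (rc t) = `|t|.
Proof. by rewrite /cabs /= expr0n /= addr0 sqrtr_sqr. Qed.
Lemma cabsBD z x y : cabs (x - y) <= cabs (x - z) + cabs (z - y).
Proof. by have := cabsD (x - z) (z - y); rewrite addrA subrK. Qed.
Lemma cabs_sum (I : Type) (r : seq I) (P : pred I) (F : I -> C) :
  cabs (\sum_(i <- r | P i) F i) <= \sum_(i <- r | P i) cabs (F i).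
Proof.
elim/big_rec2: _ => [|i y1 y2 _ h]; first by rewrite cabs0.
exact: le_trans (cabsD _ _) (lerD _ h).
Qed.
Lemma re_le_cabs x : re x <= cabs x.
Proof.
rewrite leNgt; apply/negP => h.
have := cabs_sqr x; have := cabs_ge0 x; have := sqr_ge0 (im x); nra.
Qed.
Lemma cabs_re x : `|re x| <= cabs x.
Proof.
by rewrite ler_norml re_le_cabs andbT lerNl -reN -[leRHS]cabsN re_le_cabs.
Qed.
Lemma cabs_im x : `|im x| <= cabs x.
Proof.
have := cabs_sqr x; have := cabs_ge0 x; have := sqr_ge0 (re x).
rewrite -(real_normK (num_real (im x))).
have := normr_ge0 (im x); move: (`|im x|) => a a0 b0 c0 e.
rewrite leNgt; apply/negP; nra.
Qed.
Lemma cabs_le_reim x : cabs x <= `|re x| + `|im x|.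
Proof.
rewrite [x in leLHS]complex_rect; apply: le_trans (cabsD _ _) _.
rewrite cabsM !cabs_rc lerD // -[leRHS]mul1r ler_wpM2r //.
by rewrite /cabs /= expr0n /= add0r expr1n sqrtr1.
Qed.

End ComplexNumbers.

(** * Jets, the maximum principle and the Schwarz lemma *)

Section Jets.
Variable R : realType.
Local Notation C := (cplx R).
Local Notation cabs := (@cabs R).
Local Notation rc := (@rc R).
Implicit Types (g h : C -> C) (p q : {poly C}) (z w c : C).

(* Taylor expansions of every order, with Peano remainders.  Unlike convergent
   power series they are visibly stable under products and compositions, and
   they are all that the maximum principle needs. *)
Definition jet g (z0 : C) := forall N, exists p, exists K r : R,
  [/\ 0 < r, 0 <= K & forall w, cabs w < r ->
      cabs (g (z0 + w) - p.[w]) <= K * cabs w ^+ N].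

Lemma poly_bounded p : exists2 B : R, 0 <= B &
  forall w, cabs w <= 1 -> cabs p.[w] <= B.
Proof.
elim/poly_ind: p => [|p c [B B0 hB]].
  by exists 0 => // w _; rewrite horner0 cabs0.
exists (B + cabs c) => [|w hw]; first by rewrite addr_ge0 ?cabs_ge0.
rewrite hornerMXaddC; apply: le_trans (cabsD _ _) _; rewrite lerD2r cabsM.
have := hB w hw; have := cabs_ge0 w; have := cabs_ge0 p.[w]; nra.
Qed.

Lemma poly_split p : exists q, exists c, forall w, p.[w] = c + w * q.[w].
Proof.
elim/poly_ind: p => [|p c _].
  by exists 0, 0 => w; rewrite !horner0 mulr0 addr0.
by exists p, c => w; rewrite hornerMXaddC mulrC addrC.
Qed.

Lemma eq_jet g h (z0 : C) : (forall w, g (z0 + w) = h (z0 + w)) -> jet g z0 -> jet h z0.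
Proof.
move=> e hg N; have [p [K [r [r0 K0 hp]]]] := hg N.
by exists p, K, r; split=> // w hw; rewrite -e; apply: hp.
Qed.

Lemma jet_cst c (z0 : C) : jet (fun=> c) z0.
Proof.
by move=> N; exists c%:P, 0, 1; split=> // w _; rewrite hornerC subrr cabs0 mul0r.
Qed.

Lemma jet_id (z0 : C) : jet id z0.
Proof.
move=> N; exists ('X + z0%:P), 0, 1; split=> // w _.
by rewrite /= hornerD hornerX hornerC [w + z0]addrC subrr cabs0 mul0r.
Qed.

Lemma jetD g h (z0 : C) : jet g z0 -> jet h z0 -> jet (fun z => g z + h z) z0.
Proof.
move=> hg hh N; have [p [K [r [r0 K0 hp]]]] := hg N.
have [q [L [s [s0 L0 hq]]]] := hh N.
exists (p + q), (K + L), (Num.min r s); split; rewrite ?lt_min ?r0 ?addr_ge0//.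
move=> w; rewrite lt_min => /andP[wr ws]; rewrite hornerD opprD addrACA mulrDl.
by apply: le_trans (cabsD _ _) _; apply: lerD; [apply: hp|apply: hq].
Qed.

Lemma jetM g h (z0 : C) : jet g z0 -> jet h z0 -> jet (fun z => g z * h z) z0.
Proof.
move=> hg hh N; have [p [K [r [r0 K0 hp]]]] := hg N.
have [q [L [s [s0 L0 hq]]]] := hh N.
have [B B0 hB] := poly_bounded p; have [D D0 hD] := poly_bounded q.
exists (p * q), (K * L + K * D + B * L), (Num.min (Num.min r s) 1); split.
- by rewrite !lt_min r0 s0 ltr01.
- by rewrite !addr_ge0 // mulr_ge0.
move=> w; rewrite !lt_min => /andP[/andP[wr ws] /ltW w1].
have {hp} hp := hp w wr; have {hq} hq := hq w ws.
have {hB} hB := hB w w1; have {hD} hD := hD w w1.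
rewrite hornerM.
have -> : g (z0 + w) * h (z0 + w) - p.[w] * q.[w] =
  (g (z0 + w) - p.[w]) * (h (z0 + w) - q.[w]) + (g (z0 + w) - p.[w]) * q.[w]
   + p.[w] * (h (z0 + w) - q.[w]) by ring.
have n1 : cabs w ^+ N <= 1 by apply: exprn_ile1; rewrite ?cabs_ge0.
have n0 : 0 <= cabs w ^+ N by apply: exprn_ge0; rewrite cabs_ge0.
apply: le_trans (cabsD _ _) _; apply: le_trans (lerD (cabsD _ _) (lexx _)) _.
rewrite !cabsM !mulrDl; apply: lerD; first apply: lerD.
- have : K * cabs w ^+ N * (L * cabs w ^+ N) <= K * L * cabs w ^+ N.
    have -> : K * cabs w ^+ N * (L * cabs w ^+ N)
       = K * L * cabs w ^+ N * cabs w ^+ N by ring.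
    by rewrite ler_piMr // !mulr_ge0.
  by apply: le_trans; apply: ler_pM; rewrite ?cabs_ge0.
- rewrite mulrAC; apply: ler_pM; rewrite ?cabs_ge0 //.
- rewrite -mulrA; apply: ler_pM; rewrite ?cabs_ge0 //.
Qed.

Lemma jetZ c g (z0 : C) : jet g z0 -> jet (fun z => c * g z) z0.
Proof. by move=> hg; apply: jetM => //; apply: jet_cst. Qed.

Lemma jetB g h (z0 : C) : jet g z0 -> jet h z0 -> jet (fun z => g z - h z) z0.
Proof.
move=> hg hh; apply: (@eq_jet (fun z => g z + (-1) * h z)) => [w|].
  by rewrite mulN1r.
by apply: jetD => //; apply: jetZ.
Qed.

Lemma jet_sum (I : Type) (s : seq I) (P : pred I) (F : I -> C -> C) (z0 : C) :
  (forall i, P i -> jet (F i) z0) -> jet (fun z => \sum_(i <- s | P i) F i z) z0.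
Proof.
move=> hF; elim: s => [|i s ih].
  by apply: eq_jet (jet_cst 0 z0) => w; rewrite big_nil.
case Pi: (P i); last by apply: eq_jet ih => w; rewrite big_cons Pi.
by apply: eq_jet (jetD (hF i Pi) ih) => w; rewrite big_cons Pi.
Qed.

Lemma jet_prod (I : Type) (s : seq I) (P : pred I) (F : I -> C -> C) (z0 : C) :
  (forall i, P i -> jet (F i) z0) -> jet (fun z => \prod_(i <- s | P i) F i z) z0.
Proof.
move=> hF; elim: s => [|i s ih].
  by apply: eq_jet (jet_cst 1 z0) => w; rewrite big_nil.
case Pi: (P i); last by apply: eq_jet ih => w; rewrite big_cons Pi.
by apply: eq_jet (jetM (hF i Pi) ih) => w; rewrite big_cons Pi.
Qed.

Lemma jetX g n (z0 : C) : jet g z0 -> jet (fun z => g z ^+ n) z0.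
Proof.
move=> hg; elim: n => [|n ih]; first exact: jet_cst.
by apply: eq_jet (jetM hg ih) => w; rewrite exprS.
Qed.

(** From 1 / (z0 + w) = z0^-1 (1 - w / (z0 + w)), an approximation p of order N to the inverse gives
    the approximation z0^-1 (1 - X p) of order N + 1. *)
Lemma jetV (z0 : C) : z0 != 0 -> jet (fun z => z^-1) z0.
Proof.
move=> z0n N; have z0p : 0 < cabs z0 by rewrite cabs_gt0.
have small w : cabs w < cabs z0 / 2 -> cabs (z0 + w)^-1 <= 2 / cabs z0.
  move=> hw; have h : cabs z0 / 2 <= cabs (z0 + w).
    have := cabsD (z0 + w) (- w); rewrite addrK cabsN; lra.
  rewrite cabsV -[2 / _]invf_div lef_pV2 // posrE; lra.
elim: N => [|N [p [K [r [r0 K0 hp]]]]].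
  exists 0, (2 / cabs z0), (cabs z0 / 2); split; try by rewrite divr_gt0.
    by rewrite divr_ge0 // ltW.
  by move=> w hw; rewrite horner0 subr0 mulr1; apply: small.
exists (z0^-1%:P * (1 - 'X * p)), (K / cabs z0), (Num.min r (cabs z0 / 2)); split.
- by rewrite lt_min r0 divr_gt0.
- by rewrite divr_ge0 // ltW.
move=> w; rewrite lt_min => /andP[wr ws].
have zw : z0 + w != 0.
  apply/eqP => e; have := small w ws.
  have : cabs z0 = cabs w by rewrite -[w]opprK cabsN -(addKr z0 w) e addr0 opprK.
  by move: ws => /[swap] <-; lra.
have -> : (z0 + w)^-1 - (z0^-1%:P * (1 - 'X * p)).[w]
   = - z0^-1 * w * ((z0 + w)^-1 - p.[w]).
  by rewrite !(hornerE, hornerM); field; rewrite z0n zw.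
rewrite !cabsM cabsN cabsV exprS.
have := hp w wr; have := cabs_ge0 w => w0 h.
have -> : K / cabs z0 * (cabs w * cabs w ^+ N)
  = (cabs z0)^-1 * cabs w * (K * cabs w ^+ N) by ring.
by apply: ler_wpM2l => //; rewrite mulr_ge0 // invr_ge0 ltW.
Qed.

Lemma jet0E g (z0 : C) : jet g z0 -> forall N, (0 < N)%N -> exists p, exists K r : R,
  [/\ 0 < r, 0 <= K, p.[0] = g z0 & forall w, cabs w < r ->
      cabs (g (z0 + w) - p.[w]) <= K * cabs w ^+ N].
Proof.
move=> hg N N0; have [p [K [r [r0 K0 hp]]]] := hg N.
exists p, K, r; split=> //.
have := hp 0; rewrite cabs0 addr0 expr0n eqn0Ngt N0 mulr0 => /(_ r0) h.
have /eqP : cabs (g z0 - p.[0]) = 0.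
  by apply/eqP; rewrite eq_le h // cabs_ge0.
by rewrite cabs_eq0 subr_eq0 => /eqP.
Qed.

Lemma jet_lipschitz g (z0 : C) : jet g z0 -> exists K r : R,
  [/\ 0 < r, 0 <= K & forall w, cabs w < r ->
      cabs (g (z0 + w) - g z0) <= K * cabs w].
Proof.
move=> hg; have [p [K [r [r0 K0 p0 hp]]]] := jet0E hg (ltnSn 0).
have [q [c pE]] := poly_split p; have [B B0 hB] := poly_bounded q.
exists (K + B), (Num.min r 1); split; rewrite ?lt_min ?r0 ?addr_ge0 ?ltr01 //.
move=> w; rewrite lt_min => /andP[wr /ltW w1].
rewrite -p0 mulrDl; apply: le_trans (cabsBD p.[w] _ _) _; apply: lerD.
  by have := hp w wr; rewrite expr1.
rewrite !pE mul0r addr0 addrC addKr cabsM mulrC ler_wpM2r ?cabs_ge0 //.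
exact: hB.
Qed.
End Jets.

(** * The maximum principle on the closed unit disc *)

Section MaximumPrinciple.
Variable R : realType.
Local Notation C := (cplx R).
Local Notation cabs := (@cabs R).
Local Notation rc := (@rc R).
Implicit Types (g h : C -> C) (p q : {poly C}) (z w c : C).

(** Compactness and the extreme value theorem are used on the real plane, whose points are carried
    to C by [emb]. *)
Definition emb (x : R * R) : C := rc x.1 + 'i * rc x.2.

Lemma re_emb x : re (emb x) = x.1.
Proof. by rewrite !(reD, reM) !(re_rc, im_rc) /re /im /=; ring. Qed.
Lemma im_emb x : im (emb x) = x.2.
Proof. by rewrite !(imD, imM) !(re_rc, im_rc) /re /im /=; ring. Qed.
Lemma emb_rect z : z = emb (re z, im z).
Proof. by rewrite /emb -complex_rect. Qed.

Lemma emb_dist (x y : R * R) : cabs (emb y - emb x) <= `|y.1 - x.1| + `|y.2 - x.2|.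
Proof.
by apply: le_trans (cabs_le_reim _) _; rewrite reB imB !re_emb !im_emb.
Qed.

Lemma continuous_emb g (x : R * R) : jet g (emb x) ->
  {for x, continuous (fun y => cabs (g (emb y)))}.
Proof.
move=> /jet_lipschitz[K [r [r0 K0 hK]]].
apply/cvgrPdist_le => /= e e0.
pose d := Num.min (r / 2) (e / (2 * (K + 1))).
have K1 : 0 < K + 1 by lra.
have d0 : 0 < d by rewrite lt_min !divr_gt0 ?mulr_gt0.
near=> y.
have y1 : `|x.1 - y.1| < d by near: y; exists (ball x.1 d, ball x.2 d);
  [split; exact: nbhsx_ballx|move=> /= y [] ? ?].
have y2 : `|x.2 - y.2| < d by near: y; exists (ball x.1 d, ball x.2 d);
  [split; exact: nbhsx_ballx|move=> /= y [] ? ?].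
have hd : cabs (emb y - emb x) < 2 * d.
  apply: le_lt_trans (emb_dist _ _) _.
  rewrite [X in X + _]distrC [X in _ + X]distrC; lra.
have dr : d <= r / 2 by rewrite /d ge_min lexx.
have de : d <= e / (2 * (K + 1)) by rewrite /d ge_min lexx orbT.
have /hK : cabs (emb y - emb x) < r by lra.
rewrite subrKC => h.
have h2 : cabs (g (emb y) - g (emb x)) <= e.
  apply: le_trans h _; move: de; rewrite ler_pdivlMr ?mulr_gt0 // => de.
  have := cabs_ge0 (emb y - emb x); nra.
have := cabsD (g (emb y)) (g (emb x) - g (emb y)).
have := cabsD (g (emb x)) (g (emb y) - g (emb x)).
rewrite !subrKC (cabsB (g (emb x))) ler_norml => a b; apply/andP; split; lra.
Unshelve. all: by end_near. Qed.

Definition disc : set (R * R) := [set x | x.1 ^+ 2 + x.2 ^+ 2 <= 1].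

Lemma discE x : disc x <-> cabs (emb x) <= 1.
Proof.
have e : x.1 ^+ 2 + x.2 ^+ 2 = cabs (emb x) ^+ 2 by rewrite cabs_sqr re_emb im_emb.
by rewrite /disc /= e expr_le1 ?cabs_ge0.
Qed.

Lemma disc_compact : compact disc.
Proof.
have cf : continuous (fun x : R * R => x.1 ^+ 2 + x.2 ^+ 2).
  move=> x; apply: cvgD; (apply: cvgM; [|]); solve [exact: cvg_fst | exact: cvg_snd].
have cK : compact (`[(-1 : R), 1]%classic `*` `[(-1 : R), 1]%classic).
  by apply: compact_setX; exact: segment_compact.
apply: (subclosed_compact _ cK).
- have -> : disc = (fun x : R * R => x.1 ^+ 2 + x.2 ^+ 2) @^-1` [set t | t <= 1] by [].
  by apply: closed_comp => [x _|]; [exact: cf|exact: closed_le].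
- move=> x /=; rewrite /disc /= => hx.
  rewrite !in_itv /=; have := sqr_ge0 x.1; have := sqr_ge0 x.2 => a b.
  split; apply/andP; split; nra.
Qed.

Lemma jet_quadratic g z0 : jet g z0 -> exists c1 c2, exists B r : R,
  [/\ 0 < r, 0 <= B & forall w, cabs w < r -> exists2 a : R,
     a = cabs (g z0 + c1 * w + c2 * w ^+ 2) &
     a ^+ 2 - B * cabs w ^+ 3 <= cabs (g (z0 + w)) ^+ 2].
Proof.
move=> hg; have [p [K [r [r0 K0 p0 hp]]]] := jet0E hg (ltn0Sn 2).
have [q [c0 pE]] := poly_split p; have [q1 [c1 qE]] := poly_split q.
have [q2 [c2 q1E]] := poly_split q1; have [D D0 hD] := poly_bounded q2.
have e0 : c0 = g z0 by rewrite -p0 pE mul0r addr0.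
pose A := cabs (g z0) + cabs c1 + cabs c2.
have A0 : 0 <= A by rewrite !addr_ge0 ?cabs_ge0.
exists c1, c2, (2 * A * (K + D)), (Num.min r 1).
have KD := addr_ge0 K0 D0.
split; first (by rewrite lt_min r0 ltr01); first by rewrite !mulr_ge0.
move=> w; rewrite lt_min => /andP[wr /ltW w1].
eexists; first by [].
set a := g z0 + _ + _.
have w0 := cabs_ge0 w.
have ha : cabs a <= A.
  rewrite /a; apply: le_trans (cabsD _ _) _.
  apply: le_trans (lerD (cabsD _ _) (lexx _)) _; rewrite [cabs (c2 * _)]cabsM cabsX cabsM /A.
  have := cabs_ge0 c1; have := cabs_ge0 c2 => k1 k2.
  have w2 : cabs w ^+ 2 <= 1 by rewrite exprn_ile1.
  apply: lerD; first apply: lerD => //; nra.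
have he : cabs (g (z0 + w) - a) <= (K + D) * cabs w ^+ 3.
  apply: le_trans (cabsBD p.[w] _ _) _; rewrite mulrDl; apply: lerD; first exact: hp.
  have -> : p.[w] - a = w ^+ 3 * q2.[w] by rewrite /a pE qE q1E e0; ring.
  by rewrite [cabs (_ * q2.[w])]cabsM cabsX mulrC ler_wpM2r ?exprn_ge0 // hD.
have h := cabsD (g (z0 + w)) (a - g (z0 + w)); rewrite subrKC cabsB in h.
set e := cabs (_ - a) in he h; set G := cabs (g _) in h *.
have e1 : 0 <= e by exact: cabs_ge0.
have a1 : 0 <= cabs a by exact: cabs_ge0.
have G1 : 0 <= G by exact: cabs_ge0.
have : cabs a ^+ 2 - 2 * cabs a * e <= G ^+ 2.
  have [/ltW|] := ltP (cabs a) e; first nra.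
  move=> ea; have : (cabs a - e) ^+ 2 <= G ^+ 2 by rewrite lerXn2r ?nnegrE; lra.
  nra.
apply: le_trans; rewrite lerD2l lerN2 -mulrA.
have -> : 2 * A * (K + D) * cabs w ^+ 3 = 2 * (A * ((K + D) * cabs w ^+ 3)) by ring.
by rewrite ler_wpM2l // ler_pM.
Qed.

(** The powers 0, 1 and 2 are orthogonal on the fourth roots of unity; this is a discrete mean value
    inequality, which replaces an integral over the circle. *)
Lemma four_points c0 c1 c2 (t : R) :
  let F w := cabs (c0 + c1 * w + c2 * w ^+ 2) ^+ 2 in
  4 * cabs c0 ^+ 2 <= F (rc t) + F (- rc t) + F ('i * rc t) + F (- ('i * rc t)).
Proof.
rewrite /= !expr2 -![cabs _ * cabs _]expr2 !cabs_sqr.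
rewrite !(reD, imD, reM, imM, reN, imN) !(re_rc, im_rc) /re /im /=.
set a0 := complex.Re c0; set b0 := complex.Im c0.
set a1 := complex.Re c1; set b1 := complex.Im c1.
set a2 := complex.Re c2; set b2 := complex.Im c2.
match goal with |- is_true (_ <= ?S) => have -> : S = 4 * (a0 ^+ 2 + b0 ^+ 2) +
  (4 * t ^+ 2 * (a1 ^+ 2 + b1 ^+ 2) + 4 * t ^+ 4 * (a2 ^+ 2 + b2 ^+ 2)) by ring end.
have p4 n (x y z : R) : 0 <= 4 * x ^+ n.*2 * (y ^+ 2 + z ^+ 2).
  apply: mulr_ge0; last by rewrite addr_ge0 ?sqr_ge0.
  by apply: mulr_ge0 => //; rewrite -muln2 exprM sqr_ge0.
by rewrite lerDl addr_ge0 //; [exact: (p4 1)|exact: (p4 2)].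
Qed.

Lemma max_principle g (M : R) : (forall z, cabs z <= 1 -> jet g z) ->
  (forall z, cabs z = 1 -> cabs (g z) <= M) ->
  forall z, cabs z <= 1 -> cabs (g z) <= M.
Proof.
move=> hg hM z hz.
have M0 : 0 <= M by apply: le_trans (hM 1 _); rewrite ?cabs1 ?cabs_ge0.
suff key (eps : R) : 0 < eps -> cabs (g z) ^+ 2 <= M ^+ 2 + eps.
  rewrite -(ler_pXn2r (ltn0Sn 1)) ?nnegrE ?cabs_ge0 //.
  by apply/ler_addgt0Pr => e /key.
move=> eps0.
(* The term eps |x|^2 makes the function strictly subharmonic, so that its maximum over the disc is
   not interior. *)
pose u (x : R * R) := cabs (g (emb x)) ^+ 2 + eps * (x.1 ^+ 2 + x.2 ^+ 2).
have cu : {within disc, continuous u}.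
  apply: continuous_in_subspaceT => x /set_mem /discE hx.
  have := continuous_emb (hg _ hx) => cx.
  apply: cvgD; first exact: cvgM.
  apply: cvgM; first exact: cvg_cst.
  apply: cvgD; (apply: cvgM; [|]); solve [exact: cvg_fst | exact: cvg_snd].
have d0 : disc !=set0 by exists (0, 0); rewrite /disc /= expr0n /= addr0.
have [x /set_mem /discE xd xmax] := compact_EVT_max d0 disc_compact cu.
have uE w : cabs w <= 1 -> cabs (g w) ^+ 2 + eps * cabs w ^+ 2 <= u x.
  move=> hw; have := xmax (re w, im w).
  rewrite /u -emb_rect /= -cabs_sqr => -> //.
  by apply/mem_set/discE; rewrite -emb_rect.
have uxE : u x = cabs (g (emb x)) ^+ 2 + eps * cabs (emb x) ^+ 2.
  by rewrite /u [cabs (emb x) ^+ 2]cabs_sqr re_emb im_emb.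
have [x1|x1] : cabs (emb x) = 1 \/ cabs (emb x) < 1.
  by move: xd; rewrite le_eqVlt => /orP[/eqP|]; [left|right].
  apply: le_trans (_ : u x <= _).
    by apply: le_trans (uE _ hz); rewrite lerDl mulr_ge0 ?sqr_ge0 // ltW.
  rewrite uxE x1 expr1n mulr1 lerD2r.
  by rewrite lerXn2r ?nnegrE ?cabs_ge0 // hM.
exfalso; have [c1 [c2 [B [r [r0 B0 hB]]]]] := jet_quadratic (hg _ xd).
(* The bounds keep the four points within the range of the expansion and inside the disc, and make B
   t < eps: averaging over the points then gains eps t^2 and loses only B t^3. *)
pose t := Num.min (Num.min (r / 2) ((1 - cabs (emb x)) / 2)) (eps / (2 * (B + 1))).
have B1 : 0 < B + 1 by lra.
have t0 : 0 < t by rewrite !lt_min !divr_gt0 ?mulr_gt0 // subr_gt0.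
have tr : t <= r / 2 by rewrite /t !ge_min lexx.
have tx : t <= (1 - cabs (emb x)) / 2 by rewrite /t !ge_min lexx orbT.
have tB : t <= eps / (2 * (B + 1)) by rewrite /t !ge_min lexx !orbT.
rewrite ler_pdivlMr ?mulr_gt0 // in tB.
have ci : cabs 'i = 1 by rewrite /cabs /= expr0n /= add0r expr1n sqrtr1.
have each w : cabs w = t ->
   cabs (g (emb x) + c1 * w + c2 * w ^+ 2) ^+ 2 - B * t ^+ 3
     + eps * cabs (emb x + w) ^+ 2 <= u x.
  move=> wt; have [|a -> ha] := hB w; first by rewrite wt; lra.
  apply: le_trans (uE (emb x + w) _); first by rewrite lerD2r -wt.
  by apply: le_trans (cabsD _ _) _; rewrite wt; lra.
have S2 := four_points (g (emb x)) c1 c2 t; cbv beta zeta in S2.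
have E1 := each (rc t); rewrite cabs_rc gtr0_norm // in E1.
have E2 := each (- rc t); rewrite cabsN cabs_rc gtr0_norm // in E2.
have E3 := each ('i * rc t); rewrite cabsM ci mul1r cabs_rc gtr0_norm // in E3.
have E4 := each (- ('i * rc t)).
rewrite [cabs (- _)]cabsN cabsM ci mul1r cabs_rc gtr0_norm // in E4.
have S4 : cabs (emb x + rc t) ^+ 2 + cabs (emb x - rc t) ^+ 2
   + cabs (emb x + 'i * rc t) ^+ 2 + cabs (emb x - 'i * rc t) ^+ 2
   = 4 * cabs (emb x) ^+ 2 + 4 * t ^+ 2.
  rewrite !cabs_sqr !(reD, imD, reM, imM, reN, imN).
  rewrite !(re_rc, im_rc) /re /im /=; ring.
have {}E1 := E1 erefl; have {}E2 := E2 erefl.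
have {}E3 := E3 erefl; have {}E4 := E4 erefl.
have : eps * t ^+ 2 <= B * t ^+ 3.
  move: (cabs (emb x + _) ^+ 2) (cabs (emb x - _) ^+ 2)
    (cabs (emb x + _ * _) ^+ 2) (cabs (emb x - _ * _) ^+ 2) S4 E1 E2 E3 E4.
  rewrite uxE => a1 a2 a3 a4 /(congr1 (fun y => eps * y)).
  rewrite !mulrDr => S4 E1 E2 E3 E4; lra.
have -> : B * t ^+ 3 = (B * t) * t ^+ 2 by ring.
rewrite ler_pM2r ?exprn_gt0 //; nra.
Qed.
End MaximumPrinciple.

(** * The Schwarz lemma *)

Section Schwarz.
Variable R : realType.
Local Notation C := (cplx R).
Local Notation cabs := (@cabs R).
Local Notation rc := (@rc R).
Implicit Types (g h : C -> C) (p q : {poly C}) (z w c : C).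

Lemma le0_small (x K r : R) : 0 < r -> (forall t, 0 < t -> t < r -> x <= K * t) -> x <= 0.
Proof.
move=> r0 h; rewrite leNgt; apply/negP => x0.
pose t := Num.min (r / 2) (x / (2 * (`|K| + 1))).
have K1 : 0 < `|K| + 1 by have := normr_ge0 K; lra.
have t0 : 0 < t by rewrite lt_min !divr_gt0 // mulr_gt0.
have tr : t <= r / 2 by rewrite ge_min lexx.
have : t <= x / (2 * (`|K| + 1)) by rewrite ge_min lexx orbT.
rewrite ler_pdivlMr ?mulr_gt0 // => tx.
have /(h _ t0) : t < r by lra.
have := ler_norm K; nra.
Qed.

Lemma near_jet g h z0 r : 0 < r ->
  (forall w, cabs w < r -> g (z0 + w) = h (z0 + w)) -> jet g z0 -> jet h z0.
Proof.
move=> r0 e hg N; have [p [K [s [s0 K0 hp]]]] := hg N.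
exists p, K, (Num.min r s); split=> //; first by rewrite lt_min r0.
by move=> w; rewrite lt_min => /andP[wr ws]; rewrite -e //; apply: hp.
Qed.

Lemma poly_eq0_at0 p (K r : R) : 0 < r ->
  (forall w, w != 0 -> cabs w < r -> cabs p.[w] <= K * cabs w) -> p.[0] = 0.
Proof.
move=> r0 h; have [q [c pE]] := poly_split p; have [B B0 hB] := poly_bounded q.
apply/eqP; rewrite -cabs_eq0 eq_le cabs_ge0 andbT.
apply: (@le0_small _ (K + B) (Num.min r 1)); first by rewrite lt_min r0 ltr01.
move=> t t0; rewrite lt_min => /andP[tr t1].
have tE : cabs (rc t) = t by rewrite cabs_rc gtr0_norm.
have t00 : rc t != 0 by rewrite -cabs_eq0 tE gt_eqF.
have := h (rc t) t00; rewrite tE => /(_ tr) => h1.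
have := hB (rc t); rewrite tE => /(_ (ltW t1)) => h2.
rewrite !pE in h1 *; rewrite mul0r addr0.
have -> : c = (c + rc t * q.[rc t]) - rc t * q.[rc t] by rewrite addrK.
apply: le_trans (cabsD _ _) _; rewrite cabsN cabsM tE mulrDl; nra.
Qed.

(** Removable singularity: an expansion of g to order N + 2 gives one of g / z to order N, so having
    expansions of all orders survives the division. *)
Lemma jet_div g : jet g 0 -> g 0 = 0 -> exists2 h, jet h 0 &
  forall z, g z = z * h z /\ (z != 0 -> h z = g z * z^-1).
Proof.
move=> hg g0.
have [p [K [r [r0 K0 p0 hp]]]] := jet0E hg (ltn0Sn 1).
have [q [c pE]] := poly_split p.
have c0 : c = 0 by move: p0; rewrite pE mul0r addr0 g0.
pose h z := if z == 0 then q.[0] else g z * z^-1.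
exists h; last first.
  move=> z; rewrite /h; have [->|z0] := eqVneq z 0; first by rewrite mul0r.
  by split=> //; rewrite mulrCA divff // mulr1.
move=> N; have [p' [K' [s [s0 K'0 p'0 hp']]]] := jet0E hg (ltn0Sn N.+1).
have [q' [c' p'E]] := poly_split p'.
have c'0 : c' = 0 by move: p'0; rewrite p'E mul0r addr0 g0.
have ineq (P Q : {poly C}) (L : R) k w : w != 0 ->
    (forall w, P.[w] = 0 + w * Q.[w]) ->
    cabs (g (0 + w) - P.[w]) <= L * cabs w ^+ k.+1 ->
    cabs (g w * w^-1 - Q.[w]) <= L * cabs w ^+ k.
  move=> w0 PE; rewrite add0r PE add0r exprS mulrCA.
  have -> : g w - w * Q.[w] = w * (g w * w^-1 - Q.[w]) by field.
  by rewrite cabsM ler_pM2l // cabs_gt0.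
(* The value given to h at 0 must not depend on the order of the expansion: q and q' both
   approximate g / w near 0. *)
have e : q'.[0] = q.[0].
  apply/eqP; rewrite -subr_eq0; apply/eqP; rewrite -hornerN -hornerD.
  apply: (@poly_eq0_at0 _ (K + K') (Num.min (Num.min r s) 1)) => [|w w0].
    by rewrite !lt_min r0 s0 ltr01.
  rewrite !lt_min => /andP[/andP[wr ws] /ltW w1]; rewrite hornerD hornerN.
  rewrite c0 in pE; rewrite c'0 in p'E.
  have h1 := ineq p q K _ w w0 pE (hp w wr).
  have h2 := ineq p' q' K' _ w w0 p'E (hp' w ws).
  rewrite addrC -[- q.[w]]opprK opprK -cabsN opprD opprK.
  apply: le_trans (cabsBD (g w * w^-1) _ _) _; rewrite mulrDl.
  rewrite (cabsB q.[w]) expr1 in h1 *; apply: lerD => //.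
  apply: le_trans h2 _; rewrite ler_wpM2l // exprS ler_piMr ?cabs_ge0 //.
  by rewrite exprn_ile1 ?cabs_ge0.
exists q', K', (Num.min s 1); split=> //; first by rewrite lt_min s0 ltr01.
move=> w; rewrite lt_min => /andP[ws /ltW w1]; rewrite add0r /h.
have [->|w0] := eqVneq w 0.
  by rewrite e subrr cabs0 mulr_ge0 // exprn_ge0.
rewrite c'0 in p'E.
apply: le_trans (ineq p' q' K' _ w w0 p'E (hp' w ws)) _.
by rewrite ler_wpM2l // exprSr ler_piMr ?exprn_ge0 ?cabs_ge0.
Qed.

(** The disc is punctured, so that the condition passes to g / z whatever value the quotient has at
    0; for a jet the value at 0 is recovered by [bigOat0_eq0]. *)
Definition bigOat0 g k := exists K r : R, 0 < r /\
  forall w, w != 0 -> cabs w < r -> cabs (g w) <= K * cabs w ^+ k.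

Lemma bigOat0_eq0 g k : jet g 0 -> bigOat0 g k.+1 -> g 0 = 0.
Proof.
move=> /jet_lipschitz[L [s [s0 L0 hL]]] [K [r [r0 hK]]].
apply/eqP; rewrite -cabs_eq0 eq_le cabs_ge0 andbT.
apply: (@le0_small _ (`|K| + L) (Num.min (Num.min r s) 1)) => [|t t0].
  by rewrite !lt_min r0 s0 ltr01.
rewrite !lt_min => /andP[/andP[tr ts] /ltW t1].
have tE : cabs (rc t) = t by rewrite cabs_rc gtr0_norm.
have t00 : rc t != 0 by rewrite -cabs_eq0 tE gt_eqF.
have := hK (rc t) t00; rewrite tE => /(_ tr) => h1.
have := hL (rc t); rewrite tE add0r => /(_ ts) => h2.
have := cabsD (g (rc t)) (g 0 - g (rc t)); rewrite subrKC cabsB mulrDl => h3.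
apply: le_trans h3 _; apply: lerD => //; apply: le_trans h1 _.
rewrite exprS mulrCA mulrC ler_wpM2r // ?(ltW t0) //.
have : t ^+ k <= 1 by rewrite exprn_ile1 ?(ltW t0).
have : 0 <= t ^+ k by rewrite exprn_ge0 ?(ltW t0).
have := ler_norm K; have := normr_ge0 K; nra.
Qed.

Lemma bigOat0_div g h k : (forall z, z != 0 -> h z = g z * z^-1) ->
  bigOat0 g k.+1 -> bigOat0 h k.
Proof.
move=> hE [K [r [r0 hK]]]; exists K, r; split=> // w w0 wr.
rewrite hE // cabsM cabsV ler_pdivrMr ?cabs_gt0 // -mulrA -exprSr.
exact: hK.
Qed.

(** Divide by z once for each order of vanishing. On the unit circle this does not change the
    modulus, so the maximum principle keeps the constant M. *)
Lemma schwarz g (M : R) k : (forall z, cabs z <= 1 -> jet g z) ->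
  (forall z, cabs z = 1 -> cabs (g z) <= M) -> bigOat0 g k ->
  forall z, cabs z <= 1 -> cabs (g z) <= M * cabs z ^+ k.
Proof.
elim: k g => [|k ih] g hg hM gO z z1.
  by rewrite mulr1; apply: (max_principle hg).
have j0 : jet g 0 by apply: hg; rewrite cabs0.
have [h jh hE] := jet_div j0 (bigOat0_eq0 j0 gO).
rewrite (hE z).1 cabsM exprS mulrCA ler_wpM2l ?cabs_ge0 //.
apply: ih => //.
- move=> y y1; have [->//|y0] := eqVneq y 0.
  have j : jet (fun z => g z * z^-1) y by apply: jetM; [exact: hg|exact: jetV].
  apply: (@near_jet _ _ _ (cabs y)) j; first by rewrite cabs_gt0.
  move=> w wy; rewrite (hE _).2 //; apply: contraTneq wy => /eqP.
  by rewrite addr_eq0 => /eqP ->; rewrite cabsN ltxx.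
- move=> y y1; have y0 : y != 0 by rewrite -cabs_eq0 y1 oner_eq0.
  by rewrite (hE y).2 // cabsM cabsV y1 invr1 mulr1; apply: hM.
- by apply: bigOat0_div gO => y; case: (hE y).
Qed.

Lemma bigOat0_coef g k : jet g 0 -> bigOat0 g k -> exists c, exists K r : R,
  0 < r /\ forall w, cabs w < r -> cabs (g w - c * w ^+ k) <= K * cabs w ^+ k.+1.
Proof.
elim: k g => [|k ih] g jg gO.
  have [K [r [r0 K0 hK]]] := jet_lipschitz jg.
  by exists (g 0), K, r; split=> // w /hK; rewrite add0r mulr1 expr1.
have [h jh hE] := jet_div jg (bigOat0_eq0 jg gO).
have hO : bigOat0 h k by apply: bigOat0_div gO => y; case: (hE y).
have [c [K [r [r0 hK]]]] := ih h jh hO; exists c, K, r; split=> // w wr.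
rewrite (hE w).1 !exprS.
have -> : w * h w - c * (w * w ^+ k) = w * (h w - c * w ^+ k) by ring.
by rewrite cabsM mulrCA ler_wpM2l ?cabs_ge0 // -exprS hK.
Qed.

Lemma circle_const g c : (forall z, cabs z <= 1 -> jet g z) ->
  (forall z, cabs z = 1 -> g z = c) -> forall z, cabs z <= 1 -> g z = c.
Proof.
move=> hg hc z z1; apply/eqP; rewrite -subr_eq0 -cabs_eq0 eq_le cabs_ge0 andbT.
apply: (@max_principle _ (fun z => g z - c)) z z1 => z hz.
  by apply: jetB; [exact: hg|exact: jet_cst].
by rewrite hc // subrr cabs0.
Qed.
End Schwarz.

(** * Power series *)

Section Summability.
Variable R : realType.
Local Notation C := (cplx R).
Local Notation cabs := (@cabs R).
Local Notation rc := (@rc R).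

Definition net_limit (I : choiceType) (x : I -> C) (l : C) := forall e : R, 0 < e ->
  exists A : {fset I}, forall B : {fset I}, (A `<=` B)%fset ->
    cabs (\sum_(i <- B) x i - l) < e.

Lemma sum_fsetU (I : choiceType) (V : nmodType) (A B : {fset I}) (x : I -> V) :
  [disjoint A & B]%fset ->
  \sum_(i <- (A `|` B)%fset) x i = \sum_(i <- A) x i + \sum_(i <- B) x i.
Proof.
move=> /fdisjointP dAB; rewrite (big_fsetID _ (fun i => i \in A)) /=.
have -> : [fset i in (A `|` B)%fset | i \in A]%fset = A.
  by apply/fsetP => i; rewrite !inE /= andb_orl andbb; case: (i \in A); rewrite // andbF.
have -> // : [fset i in (A `|` B)%fset | i \notin A]%fset = B.
apply/fsetP => i; rewrite !inE /= andb_orl andbN /= andb_idr // => iB.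
by apply/negP => /dAB; rewrite iB.
Qed.

(** Finite sums disjoint from a suitable set A have modulus at most 2. Grouping the terms by the
    sign of the real part, then of the imaginary part, turns this into absolute bounds: 2 + 2 for
    each part, 8 in all. *)
Lemma net_limit_abs_bounded (I : choiceType) (x : I -> C) (l : C) : net_limit x l ->
  exists M : R, forall B : {fset I}, \sum_(i <- B) cabs (x i) <= M.
Proof.
move=> /(_ 1 ltr01)[A hA].
have off (B : {fset I}) : [disjoint A & B]%fset -> cabs (\sum_(i <- B) x i) <= 2.
  move=> dAB; have -> : \sum_(i <- B) x i =
      (\sum_(i <- (A `|` B)%fset) x i - l) - (\sum_(i <- A) x i - l).
    by rewrite sum_fsetU //; ring.
  apply: le_trans (cabsD _ _) _; rewrite cabsN.
  have := hA _ (fsubsetUl A B); have := hA _ (fsubset_refl A); lra.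
exists (8 + \sum_(i <- A) cabs (x i)) => B.
rewrite (big_fsetID _ (fun i => i \in A)) /= addrC; apply: lerD; last first.
  rewrite [leRHS](big_fsetID _ (fun i => i \in B)) /=.
  rewrite (_ : [fset x0 in B | x0 \in A]%fset = [fset x0 in A | x0 \in B]%fset).
    by rewrite lerDl sumr_ge0 // => i _; apply: cabs_ge0.
  by apply/fsetP => i; rewrite !inE andbC.
set B' := [fset _ in B | _]%fset.
have dB' : forall Q : pred I, [disjoint A & [fset i in B' | Q i]]%fset.
  move=> Q; apply/fdisjointP => i iA; by rewrite !inE /= iA andbF.
have half : forall Q : pred I, cabs (\sum_(i <- B' | Q i) x i) <= 2.
  move=> Q; by rewrite big_fset_condE; apply: off.
have part (F : C -> R) (hF : zmod_morphism F) (hF1 : forall z, `|F z| <= cabs z) :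
    \sum_(i <- B') `|F (x i)| <= 4.
  pose m := GRing.isZmodMorphism.Build C R F hF.
  pose F' : {additive C -> R} := HB.pack F m.
  rewrite (bigID (fun i => 0 <= F (x i))) /=.
  rewrite (eq_bigr (fun i => F' (x i))) => [|i Pi]; last by rewrite ger0_norm.
  rewrite [X in _ + X](eq_bigr (fun i => - F' (x i))) => [|i Pi]; last first.
    by rewrite ler0_norm // ltW // ltNge.
  rewrite sumrN -!raddf_sum.
  have h1 := half (fun i => 0 <= F (x i)); have h2 := half (fun i => ~~ (0 <= F (x i))).
  have := ler_norm (F' (\sum_(i <- B' | 0 <= F (x i)) x i)).
  have := hF1 (\sum_(i <- B' | 0 <= F (x i)) x i).
  have := ler_norm (- F' (\sum_(i <- B' | ~~ (0 <= F (x i))) x i)); rewrite normrN.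
  have := hF1 (\sum_(i <- B' | ~~ (0 <= F (x i))) x i).
  rewrite -![F _]/(F' _); lra.
have h1 := part _ (@re_is_zmod_morphism R) (@cabs_re R).
have h2 := part _ (@im_is_zmod_morphism R) (@cabs_im R).
apply: le_trans (_ : \sum_(i <- B') (`|re (x i)| + `|im (x i)|) <= _).
  by apply: ler_sum => i _; apply: cabs_le_reim.
by rewrite big_split /=; lra.
Qed.

Variable n : nat.
Local Notation multi := ('M[nat]_n * 'M[nat]_n)%type.
Implicit Types (H X : mxpair R n) (a : multi).

(** The l1 norm of all entries dominates each entry, hence bounds a monomial of degree d by its d-th
    power. *)
Definition nrm H : R := \sum_i \sum_j (cabs (H.1 i j) + cabs (H.2 i j)).
Definition deg a : nat := (\sum_i \sum_j (a.1 i j + a.2 i j))%N.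

Lemma nrm_ge0 H : 0 <= nrm H.
Proof.
by apply: sumr_ge0 => i _; apply: sumr_ge0 => j _; rewrite addr_ge0 ?cabs_ge0.
Qed.

Lemma entry_le_nrm H i j : cabs (H.1 i j) <= nrm H /\ cabs (H.2 i j) <= nrm H.
Proof.
have h : cabs (H.1 i j) + cabs (H.2 i j) <= nrm H.
  rewrite /nrm (bigD1 i) //= (bigD1 j) //= -addrA lerDl addr_ge0 //.
    by apply: sumr_ge0 => k _; rewrite addr_ge0 ?cabs_ge0.
  by apply: sumr_ge0 => k _; apply: sumr_ge0 => l _; rewrite addr_ge0 ?cabs_ge0.
have := cabs_ge0 (H.1 i j); have := cabs_ge0 (H.2 i j); split; lra.
Qed.

Lemma cabs_prod (I : Type) (s : seq I) (F : I -> C) :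
  cabs (\prod_(i <- s) F i) = \prod_(i <- s) cabs (F i).
Proof. by apply: (big_morph cabs (@cabsM R) (@cabs1 R)). Qed.

Lemma monomial_le a H (h : R) : nrm H <= h -> cabs (monomial a H) <= h ^+ deg a.
Proof.
move=> Hh; rewrite /monomial /deg cabs_prod expr_sum.
apply: ler_prod => i _; rewrite cabs_ge0 cabs_prod expr_sum.
apply: ler_prod => j _; rewrite cabs_ge0 cabsM !cabsX exprD.
have [h1 h2] := entry_le_nrm H i j.
by apply: ler_pM; rewrite ?exprn_ge0 ?cabs_ge0 // lerXn2r ?nnegrE ?cabs_ge0 //;
   (try exact: le_trans (cabs_ge0 _) (le_trans h1 Hh)); apply: le_trans Hh.
Qed.

Lemma monomial_cst a (t : R) :
  monomial a (const_mx (rc t), const_mx (rc t)) = rc (t ^+ deg a).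
Proof.
rewrite /monomial /deg expr_sum rmorph_prod; apply: eq_bigr => i _.
rewrite expr_sum rmorph_prod; apply: eq_bigr => j _.
by rewrite !mxE -exprD rmorphXn.
Qed.

(** Every exponent is at most the degree, so matrices of exponents below N suffice; this exhibits
    the set as finite. *)
Definition low_degree (N : nat) : {fset multi} :=
  [fset a in [seq (map_mx (@nat_of_ord N) b.1, map_mx (@nat_of_ord N) b.2)
    | b : 'M['I_N]_n * 'M['I_N]_n] | (deg a < N)%N]%fset.

Lemma entry_le_deg a i j : (a.1 i j <= deg a)%N /\ (a.2 i j <= deg a)%N.
Proof.
have h : (a.1 i j + a.2 i j <= deg a)%N.
  by rewrite /deg (bigD1 i) //= (bigD1 j) //= -addnA leq_addr.
by split; apply: leq_trans h; rewrite ?leq_addr ?leq_addl.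
Qed.

Lemma mem_low_degree N a : (a \in low_degree N) = (deg a < N)%N.
Proof.
rewrite !inE /=; case: ltnP => [aN|]; rewrite ?andbF // andbT.
case: N aN => // N aN; apply/mapP.
exists (map_mx (@inord N) a.1, map_mx (@inord N) a.2); rewrite ?mem_enum //=.
case: a aN => a1 a2 aN; congr pair; apply/matrixP => i j; rewrite !mxE inordK //;
  by have [/= h1 h2] := entry_le_deg (a1, a2) i j; apply: leq_ltn_trans aN.
Qed.

Lemma has_sum_entry (I : choiceType) (x : I -> 'M[C]_n) (l : 'M[C]_n) (i j : 'I_n) :
  has_sum x l -> net_limit (fun b : I => x b i j) (l i j).
Proof.
move=> hx e e0.
have e0' : 0 < rc e by rewrite /rc ltcR.
have /hx : nbhs l [set M : 'M[C]_n | ball (l i j) (rc e) (M i j)].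
  have h := @coord_continuous _ n n i j l.
  apply: (h [set z : C | ball (l i j) (rc e) z]); exact: nbhsx_ballx.
case=> A _ hA; exists A => B AB.
have := hA B AB; rewrite /ball /= summxE norm_cabs cabsB /rc ltcR.
by [].
Qed.

(** The series converges absolutely at the point all of whose entries are t. This bounds the sum of
    the t^deg(a) |c_a|, and at H the terms of degree at least N are smaller by the factor (|H| /
    t)^N. *)
Lemma taylor (D : set (mxpair R n)) (f : mxpair R n -> 'M[C]_n) X :
  analytic_on D f -> D X -> exists2 t : R, 0 < t &
   (forall H, nrm H <= t -> D (X + H)) /\
   exists c, forall N, exists2 K : R, 0 <= K & forall H, nrm H <= t -> forall i j,
     cabs ((f (X + H) - \sum_(a <- low_degree N) monomial a H *: c a) i j)
       <= K * nrm H ^+ N.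
Proof.
move=> hf DX; have [r [r0 [c hc]]] := hf X DX.
have rE : r = rc (re r) by apply: complex_eq => //; exact: (ger0_Im (ltW r0)).
have re0 : 0 < re r by rewrite -ltcR -[X in _ < X]rE.
pose t := re r / 2; have t0 : 0 < t by rewrite divr_gt0.
have inp H : nrm H <= t -> polydisc r H.
  move=> Ht i j; have [h1 h2] := entry_le_nrm H i j.
  by rewrite rE !norm_cabs !ltcR /t in Ht *; split; lra.
exists t => //; split=> [H /inp /hc[]//|]; exists c => N.
have [M hM] : exists M : R, forall i j (B : {fset multi}),
    \sum_(a <- B) t ^+ deg a * cabs (c a i j) <= M.
  have cst : polydisc r (const_mx (rc t) : 'M[C]_n, const_mx (rc t) : 'M[C]_n).
    move=> i j; rewrite /= !mxE rE norm_cabs cabs_rc gtr0_norm // !ltcR /t.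
    by split; lra.
  have [_ hs] := hc _ cst.
  have [M hM] : exists M : 'M[R]_n, forall i j (B : {fset multi}),
      \sum_(a <- B) t ^+ deg a * cabs (c a i j) <= M i j.
    have hij i j : exists M : R, forall B : {fset multi},
        \sum_(a <- B) t ^+ deg a * cabs (c a i j) <= M.
      have [M hM] := net_limit_abs_bounded (has_sum_entry i j hs).
      exists M => B; apply: le_trans (hM B); apply: ler_sum => a _.
      by rewrite mxE cabsM monomial_cst cabs_rc ger0_norm // exprn_ge0 // ltW.
    exists (\matrix_(i, j) projT1 (choice (hij i)) j) => i j B.
    by rewrite mxE; apply: (projT2 (choice (hij i))).
  exists (\sum_i \sum_j `|M i j|) => i j B; apply: le_trans (hM i j B) _.
  apply: le_trans (ler_norm _) _.
  rewrite (bigD1 i) //= (bigD1 j) //= -addrA lerDl addr_ge0 //.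
    exact: sumr_ge0.
  by apply: sumr_ge0 => k _; apply: sumr_ge0.
exists (`|M| / t ^+ N) => [|H Ht i j]; first by rewrite divr_ge0 // exprn_ge0 // ltW.
have h0 := nrm_ge0 H; set h := nrm H in Ht h0 *.
apply/ler_addgt0Pl => e e0.
have [_ hs] := hc _ (inp H Ht).
have [A hA] := has_sum_entry i j hs e0.
pose B := (A `|` low_degree N)%fset.
have := hA B (fsubsetUl _ _).
rewrite (big_fsetID _ (fun a => a \in low_degree N)) /=.
have -> : [fset x in B | x \in low_degree N]%fset = low_degree N.
  apply/fsetP => a; rewrite 3!inE; apply/andP/idP => [[]//|ha].
  by split=> //; rewrite ha orbT.
set B' := [fset _ in B | _]%fset.
set S := \sum_(i0 <- low_degree N) _; set S' := \sum_(i0 <- B') _ => hS.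
have -> : (f (X + H) - \sum_(a <- low_degree N) monomial a H *: c a) i j
   = S' - (S + S' - f (X + H) i j).
  by rewrite !mxE summxE -/S; ring.
apply: le_trans (cabsD _ _) _; rewrite cabsN addrC; apply: lerD; first exact: ltW.
apply: le_trans (cabs_sum _ _ _) _.
apply: le_trans (_ : (h / t) ^+ N * \sum_(a <- B') t ^+ deg a * cabs (c a i j) <= _);
  last first.
  have -> : `|M| / t ^+ N * h ^+ N = (h / t) ^+ N * `|M| 
    by rewrite [(h / t) ^+ N]expr_div_n mulrC -[RHS]mulrA; congr (_ * _); exact: mulrC.
  apply: ler_wpM2l; last exact: le_trans (hM i j B') (ler_norm _).
  by rewrite exprn_ge0 // divr_ge0 // ltW.
rewrite mulr_sumr big_seq [leRHS]big_seq; apply: ler_sum => a.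
rewrite in_fset inE /= => /andP[_].
rewrite mem_low_degree -leqNgt => Na.
rewrite mxE cabsM mulrA; apply: ler_wpM2r; first exact: cabs_ge0.
apply: le_trans (monomial_le a (lexx _)) _; rewrite -/h.
rewrite -[in leLHS](subnKC Na) -[in leRHS](subnKC Na) !exprD mulrA.
rewrite [(h / t) ^+ N]expr_div_n divfK ?expf_neq0 ?gt_eqF //.
apply: ler_wpM2l; first exact: exprn_ge0.
by rewrite lerXn2r // nnegrE // ltW.
Qed.
End Summability.

(** * Analytic functions along curves *)

Section AnalyticCurves.
Variable R : realType.
Local Notation C := (cplx R).
Local Notation cabs := (@cabs R).
Local Notation rc := (@rc R).

Definition jetm m n (g : C -> 'M[C]_(m, n)) z0 := forall i j, jet (fun z => g z i j) z0.
Definition jetp n (g : C -> mxpair R n) z0 :=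
  jetm (fun z => (g z).1) z0 /\ jetm (fun z => (g z).2) z0.

Lemma jet_approx (g : C -> C) z0 :
  (forall N, exists h, exists K r : R, [/\ jet h z0, 0 < r, 0 <= K &
     forall w, cabs w < r -> cabs (g (z0 + w) - h (z0 + w)) <= K * cabs w ^+ N]) ->
  jet g z0.
Proof.
move=> hg N; have [h [K [r [/(_ N)[p [L [s [s0 L0 hp]]]] r0 K0 hK]]]] := hg N.
exists p, (K + L), (Num.min r s); split; rewrite ?lt_min ?r0 ?addr_ge0 //.
move=> w; rewrite lt_min => /andP[wr ws]; rewrite mulrDl.
by apply: le_trans (cabsBD (h (z0 + w)) _ _) _; apply: lerD; [apply: hK|apply: hp].
Qed.

Variable n : nat.
Implicit Types (H X : mxpair R n).

Lemma jet_monomial (a : 'M[nat]_n * 'M[nat]_n) (g : C -> mxpair R n) z0 :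
  jetp g z0 -> jet (fun z => monomial a (g z)) z0.
Proof.
move=> [h1 h2]; apply: jet_prod => i _; apply: jet_prod => j _.
by apply: jetM; apply: jetX; [exact: h1|exact: h2].
Qed.

Lemma jetm_lipschitz p q (g : C -> 'M[C]_(p, q)) z0 : jetm g z0 ->
  exists K r : R, [/\ 0 < r, 0 <= K & forall w, cabs w < r -> forall i j,
    cabs (g (z0 + w) i j - g z0 i j) <= K * cabs w].
Proof.
move=> hg; have hij i j := jet_lipschitz (hg i j).
suff [K [r [r0 K0 hK]]] : exists K r : R, [/\ 0 < r, 0 <= K &
    forall ij, ij \in enum {: 'I_p * 'I_q} -> forall w, cabs w < r ->
    cabs (g (z0 + w) ij.1 ij.2 - g z0 ij.1 ij.2) <= K * cabs w].
  by exists K, r; split=> // w wr i j; apply: (hK (i, j)); rewrite ?mem_enum.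
elim: (enum _) => [|ij s [K [r [r0 K0 hK]]]]; first by exists 0, 1.
have [L [t [t0 L0 hL]]] := hij ij.1 ij.2.
exists (K + L), (Num.min r t); split; rewrite ?lt_min ?r0 ?addr_ge0 //.
move=> kl; rewrite inE => /orP[/eqP ->|kls] w; rewrite lt_min => /andP[wr wt].
  by apply: le_trans (hL w wt) _; rewrite ler_wpM2r ?cabs_ge0 // lerDr.
by apply: le_trans (hK kl kls w wr) _; rewrite ler_wpM2r ?cabs_ge0 // lerDl.
Qed.

Lemma nrm_le (H : mxpair R n) (h : R) :
  (forall i j, cabs (H.1 i j) <= h /\ cabs (H.2 i j) <= h) ->
  nrm H <= (2 * n ^ 2)%:R * h.
Proof.
move=> hH; apply: le_trans (_ : \sum_(i < n) \sum_(j < n) (h + h) <= _).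
  by apply: ler_sum => i _; apply: ler_sum => j _; have [] := hH i j; apply: lerD.
by rewrite !sumr_const !card_ord -!mulr2n -!mulrnA -[leLHS]mulr_natl -mulnn mulnA.
Qed.

Lemma jetp_nrm (g : C -> mxpair R n) z0 : jetp g z0 ->
  exists K r : R, [/\ 0 < r, 0 <= K & forall w, cabs w < r ->
    nrm (g (z0 + w) - g z0) <= K * cabs w].
Proof.
move=> [/jetm_lipschitz[K [r [r0 K0 hK]]] /jetm_lipschitz[L [s [s0 L0 hL]]]].
exists ((2 * n ^ 2)%:R * (K + L)), (Num.min r s); split.
- by rewrite lt_min r0.
- by rewrite mulr_ge0 ?addr_ge0.
move=> w; rewrite lt_min => /andP[wr ws]; rewrite -mulrA; apply: nrm_le => i j.
rewrite mulrDl !mxE; split.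
  by apply: le_trans (hK w wr i j) _; rewrite lerDl mulr_ge0 ?cabs_ge0.
by apply: le_trans (hL w ws i j) _; rewrite lerDr mulr_ge0 ?cabs_ge0.
Qed.

(** The Taylor polynomial of f of order N, composed with g, is a jet, and its error is of order N
    because g is Lipschitz at z0. *)
Lemma analytic_jet (D : set (mxpair R n)) (f : mxpair R n -> 'M[C]_n)
    (g : C -> mxpair R n) z0 :
  analytic_on D f -> jetp g z0 -> D (g z0) -> jetm (fun z => f (g z)) z0.
Proof.
move=> hf jg Dg i j; have [t t0 [_ [c hc]]] := taylor hf Dg.
have [L [r [r0 L0 hL]]] := jetp_nrm jg.
apply: jet_approx => N; have [K K0 hK] := hc N.
exists (fun z => (\sum_(a <- low_degree n N) monomial a (g z - g z0) *: c a) i j).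
exists (K * L ^+ N), (Num.min r (t / (L + 1))); split.
- apply: (@eq_jet _ (fun z => \sum_(a <- low_degree n N)
     monomial a (g z - g z0) * c a i j)).
    by move=> w; rewrite summxE; apply: eq_bigr => a _; rewrite !mxE.
  apply: jet_sum => a _; apply: jetM; last exact: jet_cst.
  case: jg => j1 j2; apply: jet_monomial; split=> k l.
    apply: (@eq_jet _ (fun z => (g z).1 k l - (g z0).1 k l)) => [w|].
      by rewrite !mxE.
    by apply: jetB; [exact: j1|exact: jet_cst].
  apply: (@eq_jet _ (fun z => (g z).2 k l - (g z0).2 k l)) => [w|].
    by rewrite !mxE.
  by apply: jetB; [exact: j2|exact: jet_cst].
- by rewrite lt_min r0 divr_gt0 //; lra.
- by rewrite mulr_ge0 ?exprn_ge0.
move=> w; rewrite lt_min => /andP[wr]; rewrite ltr_pdivlMr; last by lra.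
move=> wt; have hw := hL w wr; have w0 := cabs_ge0 w.
have Ht : nrm (g (z0 + w) - g z0) <= t by nra.
have := hK _ Ht i j; rewrite subrKC !mxE => h.
apply: le_trans h _; rewrite -mulrA -exprMn ler_wpM2l // lerXn2r ?nnegrE ?nrm_ge0 //.
by rewrite mulr_ge0.
Qed.

Lemma monomial_deg0 (a : 'M[nat]_n * 'M[nat]_n) : deg a = 0%N ->
  forall H, monomial a H = 1.
Proof.
move=> a0 H; rewrite /monomial big1 // => i _; rewrite big1 // => j _.
by have [] := entry_le_deg a i j; rewrite a0 !leqn0 => /eqP -> /eqP ->; rewrite mulr1.
Qed.

Lemma monomial_deg1 (a : 'M[nat]_n * 'M[nat]_n) : deg a = 1%N ->
  exists i j, (forall H, monomial a H = H.1 i j) \/ (forall H, monomial a H = H.2 i j).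
Proof.
move=> a1.
have [i [hi hi']] : exists i, (\sum_j (a.1 i j + a.2 i j) = 1)%N /\
    forall k, k != i -> (\sum_j (a.1 k j + a.2 k j) = 0)%N.
  have /eqP := a1; rewrite /deg => /sum_nat_eq1.
  by case=> i [_ hi hi']; exists i; split=> // k ki; apply: hi'.
have [j [hj hj']] : exists j, (a.1 i j + a.2 i j = 1)%N /\
    forall k, k != j -> (a.1 i k + a.2 i k = 0)%N.
  have /eqP := hi; rewrite /deg => /sum_nat_eq1.
  by case=> j [_ hj hj']; exists j; split=> // k ki; apply: hj'.
exists i, j.
have mE H : monomial a H = H.1 i j ^+ a.1 i j * H.2 i j ^+ a.2 i j.
  rewrite /monomial (bigD1 i) //= (bigD1 j) //= !big1 ?mulr1 // => k ki.
    rewrite big1 // => l _; have /eqP := hi' k ki; rewrite sum_nat_eq0.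
    move=> /forallP/(_ l); rewrite /= addn_eq0 => /andP[/eqP -> /eqP ->].
    by rewrite mulr1.
  have /eqP := hj' k ki; rewrite addn_eq0 => /andP[/eqP -> /eqP ->].
  by rewrite mulr1.
case: (a.1 i j) (a.2 i j) hj mE => [|[|k]] [|[|l]] //= _ mE; [right|left] => H;
  by rewrite mE ?mul1r ?mulr1.
Qed.

Lemma analytic_derivative (D : set (mxpair R n)) (f : mxpair R n -> 'M[C]_n) X :
  analytic_on D f -> D X -> exists G : mxpair R n -> 'M[C]_n,
   [/\ forall H H', G (H + H') = G H + G H',
       forall (z : C) H, G (z *: H.1, z *: H.2) = z *: G H &
       exists2 t : R, 0 < t & (forall H, nrm H <= t -> D (X + H)) /\
       exists2 K : R, 0 <= K & forall H, nrm H <= t -> forall i j,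
       cabs ((f (X + H) - f X - G H) i j) <= K * nrm H ^+ 2].
Proof.
move=> hf DX; have [t t0 [Dt [c hc]]] := taylor hf DX; have [K K0 hK] := hc 2%N.
pose G H := \sum_(a <- low_degree n 2 | deg a == 1%N) monomial a H *: c a.
(* The constant term; written as a sum it avoids singling out the zero multi-index. *)
pose c0 := \sum_(a <- low_degree n 2 | deg a != 1%N) c a.
have GE H : \sum_(a <- low_degree n 2) monomial a H *: c a = c0 + G H.
  rewrite (bigID (fun a => deg a == 1%N)) /= addrC; congr (_ + _).
  rewrite /c0 big_seq_cond [RHS]big_seq_cond; apply: eq_bigr => a.
  rewrite mem_low_degree => /andP[]; case E: (deg a) => [|[|k]] // _ _.
  by rewrite monomial_deg0 // scale1r.
have G0 : G 0 = 0.
  rewrite /G big1 // => a /eqP /monomial_deg1[i [j []]] ->; by rewrite mxE scale0r.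
have nrm0 : nrm (0 : mxpair R n) = 0.
  by rewrite /nrm big1 // => i _; rewrite big1 // => j _; rewrite !mxE cabs0 addr0.
have fX : f X = c0.
  apply/matrixP => i j; apply/eqP; rewrite -subr_eq0 -cabs_eq0 eq_le cabs_ge0 andbT.
  have := hK 0; rewrite nrm0 => /(_ (ltW t0) i j).
  by rewrite GE G0 !addr0 expr0n mulr0 !mxE.
exists G; split.
- move=> H H'; rewrite /G -big_split; apply: eq_bigr => a /eqP /monomial_deg1.
  by case=> i [j []] mE; rewrite !mE mxE scalerDl.
- move=> z H; rewrite /G scaler_sumr; apply: eq_bigr => a /eqP /monomial_deg1.
  by case=> i [j []] mE; rewrite !mE mxE scalerA.
exists t => //; split=> //; exists K => // H Ht i j.
by have := hK H Ht i j; rewrite GE fX opprD addrA.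
Qed.
End AnalyticCurves.

(** * The pencil *)

(* Matrix identities are proved over an abstract copy of the complex numbers:
   over R[i] itself unification keeps unfolding the arithmetic of the field. *)
Record complexOver (R : realType) := ComplexOver {
  carrier :> numClosedFieldType;
  reF : carrier -> R;
  rcF : R -> carrier;
  absF : carrier -> R;
  reF_morph : zmod_morphism reF;
  rcF_zmorph : zmod_morphism rcF;
  rcF_mmorph : monoid_morphism rcF;
  reF_rcM : forall t x, reF (rcF t * x) = t * reF x;
  reF_rc : forall t, reF (rcF t) = t;
  reF_conj : forall x, reF (x^*) = reF x;
  rcF_conj : forall t, (rcF t)^* = rcF t;
  rcF_real : forall x : carrier, x^* = x -> x = rcF (reF x);
  absF_ge0 : forall x, 0 <= absF x;
  absF_sqr : forall x, absF x ^+ 2 = reF (x * x^*);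
  absF_eq0 : forall x, (absF x == 0) = (x == 0);
  absFM : forall x y, absF (x * y) = absF x * absF y;
  absFD : forall x y, absF (x + y) <= absF x + absF y;
  absF_rc : forall t, absF (rcF t) = `|t|;
  absF_re : forall x, `|reF x| <= absF x
}.
Arguments reF {R c}.
Arguments rcF {R c}.
Arguments absF {R c}.
HB.instance Definition _ (R : realType) (K : complexOver R) :=
  GRing.isZmodMorphism.Build K R (@reF R K) (@reF_morph R K).
HB.instance Definition _ (R : realType) (K : complexOver R) :=
  GRing.isZmodMorphism.Build R K (@rcF R K) (@rcF_zmorph R K).
HB.instance Definition _ (R : realType) (K : complexOver R) :=
  GRing.isMonoidMorphism.Build R K (@rcF R K) (@rcF_mmorph R K).

Canonical cplx_over (R : realType) : complexOver R :=
  @ComplexOver R (cplx R) (@re R) (@rc R) (@cabs R) (@re_is_zmod_morphism R)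
    (@rc_is_zmod_morphism R) (@rc_is_monoid_morphism R) (@re_rcM R) (@re_rc R)
    (@re_conj R) (@conj_rc R) (@rc_real R) (@cabs_ge0 R) (@cabs_sqr_conj R) (@cabs_eq0 R)
    (@cabsM R) (@cabsD R) (@cabs_rc R) (@cabs_re R).

Section ComplexOver.
Variables (R : realType) (C : complexOver R).
Implicit Types x y : C.
Lemma absF0 : absF (0 : C) = 0.
Proof. by apply/eqP; rewrite absF_eq0. Qed.
Lemma absF_gt0 x : (0 < absF x) = (x != 0).
Proof. by rewrite lt_neqAle absF_ge0 andbT eq_sym absF_eq0. Qed.
Lemma absF1 : absF (1 : C) = 1.
Proof. by rewrite -(rmorph1 (@rcF R C)) absF_rc normr1. Qed.
Lemma absFN x : absF (- x) = absF x.
Proof.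
by rewrite -mulN1r -(rmorph1 (@rcF R C)) -rmorphN absFM absF_rc normrN normr1 mul1r.
Qed.
Lemma absFV x : absF x^-1 = (absF x)^-1.
Proof.
have [->|x0] := eqVneq x 0; first by rewrite !(invr0, absF0).
have a0 : absF x != 0 by rewrite absF_eq0.
by apply: (mulfI a0); rewrite -absFM !divff // absF1.
Qed.
Lemma absF1_conj u : absF u = 1 -> u * u^* = 1 :> C.
Proof.
move=> u1; rewrite [LHS]rcF_real -?absF_sqr ?u1 ?expr1n ?rmorph1 //.
by rewrite rmorphM /= conjCK mulrC.
Qed.
Lemma rotate_to_absF x : exists2 u : C, absF u = 1 & u * x = rcF (absF x).
Proof.
have [->|x0] := eqVneq x 0; first by exists 1; rewrite ?absF1 // mulr0 absF0 rmorph0.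
exists (x^-1 * rcF (absF x)); last by rewrite mulrAC mulVf // mul1r.
by rewrite absFM absFV absF_rc ger0_norm ?absF_ge0 // mulVf // absF_eq0.
Qed.
End ComplexOver.

(** Only the real part of the Hilbert-Schmidt product is kept: positivity and stationarity are real
    conditions, and phases are handled separately. *)
HB.lock Definition ip (R : realType) (C : complexOver R) m n (X Y : 'M[C]_(m, n)) : R :=
  reF (\tr (X ^t* *m Y)).

Section InnerProduct.
Variables (R : realType) (C : complexOver R).

Lemma ctM m n p (A : 'M[C]_(m, n)) (B : 'M[C]_(n, p)) :
  (A *m B) ^t* = B ^t* *m A ^t*.
Proof. by rewrite trmx_mul map_mxM. Qed.
Lemma ctD m n (A B : 'M[C]_(m, n)) : (A + B) ^t* = A ^t* + B ^t*.
Proof. by apply/matrixP => i j; rewrite !mxE rmorphD. Qed.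
Lemma ctN m n (A : 'M[C]_(m, n)) : (- A) ^t* = - A ^t*.
Proof. by apply/matrixP => i j; rewrite !mxE rmorphN. Qed.
Lemma ctB m n (A B : 'M[C]_(m, n)) : (A - B) ^t* = A ^t* - B ^t*.
Proof. by rewrite ctD ctN. Qed.
Lemma ctZ m n (c : C) (A : 'M[C]_(m, n)) : (c *: A) ^t* = c^* *: A ^t*.
Proof. by apply/matrixP => i j; rewrite !mxE rmorphM. Qed.
Lemma ct0 m n : (0 : 'M[C]_(m, n)) ^t* = 0.
Proof. by apply/matrixP => i j; rewrite !mxE rmorph0. Qed.
Lemma ct1 n : (1%:M : 'M[C]_n) ^t* = 1%:M.
Proof. by rewrite trmx1 map_mx1. Qed.
Lemma ct_row m n p (A : 'M[C]_(m, n)) (B : 'M[C]_(m, p)) :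
  (row_mx A B) ^t* = col_mx (A ^t*) (B ^t*).
Proof. by rewrite tr_row_mx map_col_mx. Qed.
Lemma ct_col m n p (A : 'M[C]_(m, n)) (B : 'M[C]_(p, n)) :
  (col_mx A B) ^t* = row_mx (A ^t*) (B ^t*).
Proof. by rewrite tr_col_mx map_row_mx. Qed.
Lemma ct_block m n p q (A : 'M[C]_(m, n)) (B : 'M[C]_(m, p)) (D : 'M[C]_(q, n))
   (E : 'M[C]_(q, p)) :
  (block_mx A B D E) ^t* = block_mx (A ^t*) (D ^t*) (B ^t*) (E ^t*).
Proof. by rewrite tr_block_mx map_block_mx. Qed.
Lemma ct_tr m n (A : 'M[C]_(m, n)) : (A^T) ^t* = (A ^t*)^T.
Proof. by rewrite map_trmx. Qed.

Definition nn m n (X : 'M[C]_(m, n)) : R := ip X X.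

Lemma ipE m n (X Y : 'M[C]_(m, n)) :
  ip X Y = \sum_i \sum_j reF ((X i j)^* * Y i j).
Proof.
rewrite ip.unlock /mxtrace raddf_sum exchange_big /=; apply: eq_bigr => j _.
by rewrite mxE raddf_sum; apply: eq_bigr => i _; rewrite !mxE.
Qed.

Lemma ipC m n (X Y : 'M[C]_(m, n)) : ip X Y = ip Y X.
Proof.
rewrite !ipE; apply: eq_bigr => i _; apply: eq_bigr => j _.
by rewrite -[LHS]reF_conj rmorphM /= conjCK mulrC.
Qed.
Lemma ipDr m n (X Y Z : 'M[C]_(m, n)) : ip X (Y + Z) = ip X Y + ip X Z.
Proof. by rewrite ip.unlock mulmxDr mxtraceD raddfD. Qed.
Lemma ipDl m n (X Y Z : 'M[C]_(m, n)) : ip (Y + Z) X = ip Y X + ip Z X.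
Proof. by rewrite ipC ipDr !(ipC X). Qed.
Lemma ipNr m n (X Y : 'M[C]_(m, n)) : ip X (- Y) = - ip X Y.
Proof. by rewrite ip.unlock mulmxN raddfN raddfN. Qed.
Lemma ipNl m n (X Y : 'M[C]_(m, n)) : ip (- X) Y = - ip X Y.
Proof. by rewrite ipC ipNr ipC. Qed.
Lemma ipBr m n (X Y Z : 'M[C]_(m, n)) : ip X (Y - Z) = ip X Y - ip X Z.
Proof. by rewrite ipDr ipNr. Qed.
Lemma ipBl m n (X Y Z : 'M[C]_(m, n)) : ip (Y - Z) X = ip Y X - ip Z X.
Proof. by rewrite ipDl ipNl. Qed.
Lemma ip0r m n (X : 'M[C]_(m, n)) : ip X 0 = 0.
Proof. by rewrite ip.unlock mulmx0 mxtrace0 raddf0. Qed.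
Lemma ip0l m n (X : 'M[C]_(m, n)) : ip 0 X = 0.
Proof. by rewrite ipC ip0r. Qed.
Lemma ipZr m n (t : R) (X Y : 'M[C]_(m, n)) : ip X (rcF t *: Y) = t * ip X Y.
Proof. by rewrite ip.unlock -scalemxAr mxtraceZ reF_rcM. Qed.
Lemma ipZl m n (t : R) (X Y : 'M[C]_(m, n)) : ip (rcF t *: X) Y = t * ip X Y.
Proof. by rewrite ipC ipZr ipC. Qed.
Lemma ip_mull m n p (A : 'M[C]_(p, m)) (X : 'M[C]_(m, n)) (Y : 'M[C]_(p, n)) :
  ip (A *m X) Y = ip X (A ^t* *m Y).
Proof. by rewrite ip.unlock ctM mulmxA. Qed.
Lemma ip_mulr m n p (A : 'M[C]_(n, p)) (X : 'M[C]_(m, n)) (Y : 'M[C]_(m, p)) :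
  ip (X *m A) Y = ip X (Y *m A ^t*).
Proof. by rewrite ip.unlock ctM -mulmxA mxtrace_mulC -mulmxA. Qed.
Lemma ip_adj m n (X Y : 'M[C]_(m, n)) : ip (X ^t*) (Y ^t*) = ip X Y.
Proof. by rewrite ipC ip.unlock trmxCK mxtrace_mulC. Qed.
Lemma ip_tr m n (X Y : 'M[C]_(m, n)) : ip X^T Y^T = ip X Y.
Proof.
rewrite !ipE exchange_big /=; apply: eq_bigr => i _; apply: eq_bigr => j _.
by rewrite !mxE.
Qed.

Lemma nnE m n (X : 'M[C]_(m, n)) : nn X = \sum_i \sum_j absF (X i j) ^+ 2.
Proof.
rewrite /nn ipE; apply: eq_bigr => i _; apply: eq_bigr => j _.
by rewrite absF_sqr mulrC.
Qed.
Lemma nn_ge0 m n (X : 'M[C]_(m, n)) : 0 <= nn X.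
Proof. by rewrite nnE; do 2!apply: sumr_ge0 => ? _; apply: sqr_ge0. Qed.
Lemma entry_nn m n (X : 'M[C]_(m, n)) i j : absF (X i j) ^+ 2 <= nn X.
Proof.
rewrite nnE (bigD1 i) //= (bigD1 j) //= -addrA lerDl addr_ge0 //.
  by apply: sumr_ge0 => k _; apply: sqr_ge0.
by do 2!apply: sumr_ge0 => ? _; apply: sqr_ge0.
Qed.
Lemma nn_eq0 m n (X : 'M[C]_(m, n)) : (nn X == 0) = (X == 0).
Proof.
apply/eqP/eqP => [X0|->]; last by rewrite /nn ip0l.
apply/matrixP => i j; rewrite mxE; apply/eqP; rewrite -absF_eq0 -sqrf_eq0.
by rewrite eq_le sqr_ge0 andbT -X0 entry_nn.
Qed.
Lemma nn_gt0 m n (X : 'M[C]_(m, n)) : (0 < nn X) = (X != 0).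
Proof. by rewrite lt_neqAle nn_ge0 andbT eq_sym nn_eq0. Qed.
Lemma nn0 m n : nn (0 : 'M[C]_(m, n)) = 0. Proof. exact: ip0l. Qed.
Lemma nnN m n (X : 'M[C]_(m, n)) : nn (- X) = nn X.
Proof. by rewrite /nn ipNl ipNr opprK. Qed.
Lemma nnZ m n (c : C) (X : 'M[C]_(m, n)) : nn (c *: X) = absF c ^+ 2 * nn X.
Proof.
rewrite !nnE mulr_sumr; apply: eq_bigr => i _; rewrite mulr_sumr.
by apply: eq_bigr => j _; rewrite mxE absFM exprMn.
Qed.
Lemma nn_adj m n (X : 'M[C]_(m, n)) : nn (X ^t*) = nn X.
Proof. exact: ip_adj. Qed.

Lemma ip_col m n p (A B : 'M[C]_(n, m)) (D E : 'M[C]_(p, m)) :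
  ip (col_mx A D) (col_mx B E) = ip A B + ip D E.
Proof. by rewrite ip.unlock ct_col mul_row_col mxtraceD raddfD. Qed.
Lemma ip_row m n p (A B : 'M[C]_(m, n)) (D E : 'M[C]_(m, p)) :
  ip (row_mx A D) (row_mx B E) = ip A B + ip D E.
Proof. by rewrite -ip_tr !tr_row_mx ip_col !ip_tr. Qed.
Lemma nn_col m n p (A : 'M[C]_(n, m)) (D : 'M[C]_(p, m)) :
  nn (col_mx A D) = nn A + nn D.
Proof. exact: ip_col. Qed.
Lemma nn_row m n p (A : 'M[C]_(m, n)) (D : 'M[C]_(m, p)) :
  nn (row_mx A D) = nn A + nn D.
Proof. exact: ip_row. Qed.

End InnerProduct.

(* Up to the order of the four blocks, now grouped as H0 + (H1' + H1'') + H2, the pencil at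
   a scalar point b is 1 + Lam b + (Lam b)^*.  The blocks of Lam h are the row r(h) from H1
   to H0 and the column c(h) from H2 to H1. *)
HB.lock Definition Lam (R : realType) (C : complexOver R) (s : nat) (C1 C2 : 'M[C]_s)
    (h : C * C) : 'M[C]_(s + ((s + s) + s)) :=
  block_mx 0 (row_mx (row_mx (h.1 *: C1) (h.2 *: C2)) 0) 0
    (block_mx 0 (col_mx (h.2 *: C2) (h.1 *: C1)) 0 0).

Section Pencil.
Variables (R : realType) (C : complexOver R) (s : nat) (C1 C2 : 'M[C]_s).

Definition rmx (h : C * C) : 'M[C]_(s, s + s) := row_mx (h.1 *: C1) (h.2 *: C2).
Definition cmx (h : C * C) : 'M[C]_(s + s, s) := col_mx (h.2 *: C2) (h.1 *: C1).
Local Notation Lam := (Lam C1 C2).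
Definition N1 := Lam (1, 0).
Definition N2 := Lam (0, 1).

Lemma LamE h : Lam h = h.1 *: N1 + h.2 *: N2.
Proof.
case: h => h1 h2; rewrite /N1 /N2 Lam.unlock /= !scale1r !scale0r.
rewrite !(scale_block_mx, scale_row_mx, scale_col_mx) !scaler0.
rewrite !(add_block_mx, add_row_mx, add_col_mx) !(addr0, add0r).
by [].
Qed.

Lemma Lam_col n h (Y0 : 'M[C]_(s, n)) (Y1 : 'M[C]_(s + s, n)) (Y2 : 'M[C]_(s, n)) :
  Lam h *m col_mx Y0 (col_mx Y1 Y2) = col_mx (rmx h *m Y1) (col_mx (cmx h *m Y2) 0).
Proof.
rewrite Lam.unlock mul_block_col !mul0mx add0r add0r mul_row_col mul0mx addr0.
by rewrite mul_block_col !mul0mx add0r addr0.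
Qed.

Lemma N1_col n (Y0 : 'M[C]_(s, n)) (Y1 Y2 Y3 : 'M[C]_(s, n)) :
  N1 *m col_mx Y0 (col_mx (col_mx Y1 Y2) Y3)
   = col_mx (C1 *m Y1) (col_mx (col_mx 0 (C1 *m Y3)) 0).
Proof.
apply: etrans (Lam_col (1, 0) _ _ _) _.
by rewrite /rmx /cmx /= !scale1r !scale0r mul_row_col mul_col_mx !mul0mx addr0.
Qed.

Lemma N2_col n (Y0 : 'M[C]_(s, n)) (Y1 Y2 Y3 : 'M[C]_(s, n)) :
  N2 *m col_mx Y0 (col_mx (col_mx Y1 Y2) Y3)
   = col_mx (C2 *m Y2) (col_mx (col_mx (C2 *m Y3) 0) 0).
Proof.
apply: etrans (Lam_col (0, 1) _ _ _) _.
by rewrite /rmx /cmx /= !scale1r !scale0r mul_row_col mul_col_mx !mul0mx add0r.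
Qed.

Definition pen n (X : 'M[C]_n * 'M[C]_n) (Y : 'M[C]_(s + ((s + s) + s), n)) : R :=
  ip Y (N1 *m Y *m X.1^T) + ip Y (N2 *m Y *m X.2^T).

Lemma penE n (X : 'M[C]_n * 'M[C]_n) (Y0 Y1 Y2 Y3 : 'M[C]_(s, n)) :
  pen X (col_mx Y0 (col_mx (col_mx Y1 Y2) Y3)) =
    ip Y0 (C1 *m Y1 *m X.1^T) + ip Y2 (C1 *m Y3 *m X.1^T)
    + ip Y0 (C2 *m Y2 *m X.2^T) + ip Y1 (C2 *m Y3 *m X.2^T).
Proof.
rewrite /pen N1_col N2_col.
by rewrite !mul_col_mx !mul0mx !ip_col !(addr0, add0r, ip0r) !addrA.
Qed.

End Pencil.

(** The complex number of which [pen] is the real part: it is linear in X over C, and its modulus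
    enters [pencil_pos_norm]. *)
HB.lock Definition penc (R : realType) (C : complexOver R) (s : nat) (C1 C2 : 'M[C]_s) n
    (X : 'M[C]_n * 'M[C]_n) (Y : 'M[C]_(s + ((s + s) + s), n)) : C :=
  \tr (Y ^t* *m (N1 C1 C2 *m Y *m X.1^T)) + \tr (Y ^t* *m (N2 C1 C2 *m Y *m X.2^T)).

(** * The domain of positivity and its symmetries *)

Section Domain.
Variables (R : realType) (C : complexOver R) (s : nat) (C1 C2 : 'M[C]_s).
Local Notation k := (s + ((s + s) + s))%N.
Local Notation penc := (penc C1 C2).
Local Notation Lam := (Lam C1 C2).
Local Notation N1 := (N1 C1 C2).
Local Notation N2 := (N2 C1 C2).
Local Notation pen := (pen C1 C2).

(* A vector of the tensor product of C^k and C^n is encoded as a k x n matrix Y, on which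
   A (x) X acts by Y |-> A Y X^T. *)
Definition pencil_pos n (X : 'M[C]_n * 'M[C]_n) : Prop :=
  forall Y : 'M[C]_(k, n), Y != 0 -> 0 < nn Y + 2 * pen X Y.

Lemma pen_penc n (X : 'M[C]_n * 'M[C]_n) Y : pen X Y = reF (penc X Y).
Proof. by rewrite /pen penc.unlock raddfD ip.unlock. Qed.

Lemma pencD n (X X' : 'M[C]_n * 'M[C]_n) Y : penc (X + X') Y = penc X Y + penc X' Y.
Proof.
have tD (A B : 'M[C]_n) : (A + B)^T = A^T + B^T by apply/matrixP => i j; rewrite !mxE.
by rewrite penc.unlock /= !tD !mulmxDr !mxtraceD addrACA.
Qed.

Lemma pencZ n z (X : 'M[C]_n * 'M[C]_n) Y : penc (z *: X.1, z *: X.2) Y = z * penc X Y.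
Proof.
have tZ (A : 'M[C]_n) : (z *: A)^T = z *: A^T by apply/matrixP => i j; rewrite !mxE.
by rewrite penc.unlock /= !tZ -!scalemxAr !mxtraceZ mulrDr.
Qed.

Lemma penc_col n (X : 'M[C]_n * 'M[C]_n) (Y0 Y1 Y2 Y3 : 'M[C]_(s, n)) :
  penc X (col_mx Y0 (col_mx (col_mx Y1 Y2) Y3)) =
    \tr (Y0 ^t* *m (C1 *m Y1 *m X.1^T)) + \tr (Y2 ^t* *m (C1 *m Y3 *m X.1^T))
    + \tr (Y0 ^t* *m (C2 *m Y2 *m X.2^T)) + \tr (Y1 ^t* *m (C2 *m Y3 *m X.2^T)).
Proof.
rewrite penc.unlock N1_col N2_col !ct_col !mul_col_mx !mul0mx !mul_row_col.
by rewrite !mulmx0 !addr0 !add0r !mxtraceD !addrA.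
Qed.

Lemma split4 n (Y : 'M[C]_(k, n)) : exists Y0 Y1 Y2 Y3,
  Y = col_mx Y0 (col_mx (col_mx Y1 Y2) Y3).
Proof.
exists (usubmx Y), (usubmx (usubmx (dsubmx Y))), (dsubmx (usubmx (dsubmx Y))),
  (dsubmx (dsubmx Y)).
by rewrite !vsubmxK.
Qed.

(* The pencil is graded: H0, H1 = H1' + H1'', H2 have weights 0, 1, 2. *)
Lemma penc_rotate n (X : 'M[C]_n * 'M[C]_n) (Y : 'M[C]_(k, n)) u : absF u = 1 ->
  exists Y' : 'M[C]_(k, n), nn Y' = nn Y /\ penc X Y' = u * penc X Y.
Proof.
move=> u1; have [Y0 [Y1 [Y2 [Y3 ->]]]] := split4 Y.
exists (col_mx Y0 (col_mx (col_mx (u *: Y1) (u *: Y2)) (u ^+ 2 *: Y3))).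
split; first by rewrite !nn_col !nnZ expr2 !absFM u1 !mulr1 !expr1n !mul1r.
have T (a b : C) (A : 'M[C]_s) (B : 'M[C]_n) (Z Z' : 'M[C]_(s, n)) :
    \tr ((a *: Z) ^t* *m (A *m (b *: Z') *m B)) = a^* * b * \tr (Z ^t* *m (A *m Z' *m B)).
  have -> : A *m (b *: Z') *m B = b *: (A *m Z' *m B).
    by rewrite -scalemxAr -scalemxAl.
  by rewrite ctZ -scalemxAl -scalemxAr !mxtraceZ mulrA.
have T1 (b : C) (A : 'M[C]_s) (B : 'M[C]_n) (Z Z' : 'M[C]_(s, n)) :
    \tr (Z ^t* *m (A *m (b *: Z') *m B)) = b * \tr (Z ^t* *m (A *m Z' *m B)).
  by have := T 1 b A B Z Z'; rewrite scale1r rmorph1 mul1r.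
rewrite !penc_col (T1 u C1 _ Y0 Y1) (T1 u C2 _ Y0 Y2) (T u (u ^+ 2) C1 _ Y2 Y3).
rewrite (T u (u ^+ 2) C2 _ Y1 Y3).
have uu : u^* * u ^+ 2 = u by rewrite expr2 mulrA [u^* * u]mulrC absF1_conj // mul1r.
by rewrite uu !mulrDr.
Qed.

(** The grading puts any phase on the value, at a vector of the same norm, so positivity is a bound
    on a numerical radius. That the domain is balanced and convex is read off from it. *)
Lemma pencil_pos_norm n (X : 'M[C]_n * 'M[C]_n) : pencil_pos X <->
  forall Y : 'M[C]_(k, n), Y != 0 -> 2 * absF (penc X Y) < nn Y.
Proof.
rewrite /pencil_pos; split=> h Y Y0; last first.
  have := h Y Y0; have := absF_re (penc X Y); rewrite pen_penc ler_norml.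
  by move=> /andP[]; lra.
have [u u1 uE] := rotate_to_absF (- penc X Y).
have [Y' [nY pY]] := penc_rotate X Y u1.
have := h Y'; rewrite -nn_gt0 nY nn_gt0 pen_penc pY => /(_ Y0).
have -> : u * penc X Y = - rcF (absF (penc X Y)) by rewrite -absFN -uE mulrN opprK.
by rewrite raddfN /= reF_rc; lra.
Qed.

Lemma pencil_pos_scale n (X : 'M[C]_n * 'M[C]_n) z : absF z <= 1 -> pencil_pos X ->
  @pencil_pos n (z *: X.1, z *: X.2).
Proof.
move=> z1 /pencil_pos_norm h; apply/pencil_pos_norm => Y Y0; rewrite pencZ absFM.
by have := h Y Y0; have := absF_ge0 z; have := absF_ge0 (penc X Y); nra.
Qed.

Lemma pencil_pos_convex n (X X' : 'M[C]_n * 'M[C]_n) (t : R) :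
  0 <= t -> t <= 1 -> pencil_pos X -> pencil_pos X' ->
  pencil_pos ((rcF t *: X.1, rcF t *: X.2) + (rcF (1 - t) *: X'.1, rcF (1 - t) *: X'.2)).
Proof.
move=> t0 t1 /pencil_pos_norm h /pencil_pos_norm h'; apply/pencil_pos_norm => Y Y0.
rewrite pencD !pencZ.
apply: (@le_lt_trans _ _ (2 * (t * absF (penc X Y) + (1 - t) * absF (penc X' Y)))).
  rewrite ler_pM2l //; apply: le_trans (absFD _ _) _; rewrite !absFM !absF_rc.
  by rewrite !ger0_norm //; lra.
have := h Y Y0; have := h' Y Y0; move: (absF _) (absF _) (nn Y) => a b m bm am.
have [->|tn] := eqVneq t 0; first by lra.
have tp : 0 < t by rewrite lt_neqAle eq_sym tn.
have : 0 < t * (m - 2 * a) by rewrite mulr_gt0 ?subr_gt0.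
have : 0 <= (1 - t) * (m - 2 * b) by rewrite mulr_ge0 ?subr_ge0 // ltW.
lra.
Qed.

Lemma pencil_pos_unitary n (X : 'M[C]_n * 'M[C]_n) U : U \is unitarymx -> pencil_pos X ->
  @pencil_pos n (U ^t* *m X.1 *m U, U ^t* *m X.2 *m U).
Proof.
move=> hU /pencil_pos_norm h; apply/pencil_pos_norm => Y Y0.
have UU : U^T *m (U^T) ^t* = 1%:M.
  by apply/unitarymxP; rewrite trmx_unitary.
have -> : penc (n := n) (U ^t* *m X.1 *m U, U ^t* *m X.2 *m U) Y = penc X (Y *m U^T).
  rewrite penc.unlock /= !ctM !trmx_mul.
  have -> : (U ^t*)^T = (U^T) ^t* by rewrite ct_tr.
  by rewrite !mulmxA !(mxtrace_mulC _ ((U^T) ^t*)) !mulmxA.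
have nY : nn (Y *m U^T) = nn Y by rewrite /nn ip_mulr -mulmxA UU mulmx1.
by rewrite -nY; apply: h; rewrite -nn_gt0 nY nn_gt0.
Qed.

Lemma pencil_pos_dsum n m (X : 'M[C]_n * 'M[C]_n) (X' : 'M[C]_m * 'M[C]_m) :
  pencil_pos X -> pencil_pos X' ->
  @pencil_pos (n + m) (block_mx X.1 0 0 X'.1, block_mx X.2 0 0 X'.2).
Proof.
move=> h h' Y.
rewrite -(hsubmxK Y); set Y1 := lsubmx Y; set Y2 := rsubmx Y => Y0.
have -> : pen (n := n + m) (block_mx X.1 0 0 X'.1, block_mx X.2 0 0 X'.2) (row_mx Y1 Y2)
    = pen X Y1 + pen X' Y2.
  rewrite /pen /= !tr_block_mx !trmx0 !mul_mx_row.
  by rewrite !mul_row_block !mulmx0 !addr0 !add0r !ip_row; ring.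
rewrite nn_row.
have [e1|n1] := eqVneq Y1 0; have [e2|n2] := eqVneq Y2 0.
- by move: Y0; rewrite e1 e2 row_mx0 eqxx.
- have := h' _ n2; rewrite e1 nn0 /(pen X) ip0l ip0l; lra.
- have := h _ n1; rewrite e2 nn0 /(pen X') ip0l ip0l; lra.
- by have := h _ n1; have := h' _ n2; lra.
Qed.

Lemma pencil_pos_0 n : @pencil_pos n (0, 0).
Proof.
move=> Y Y0; rewrite /pen /= !trmx0 !mulmx0 !ip0r addr0 mulr0 addr0.
by rewrite nn_gt0.
Qed.

(** A vector with two nonzero blocks, both matrix units, isolates the product of a nonzero entry of
    C_j with a given entry of X_j. *)
Lemma pencil_pos_bounded n : C1 != 0 -> C2 != 0 -> exists2 M : R, 0 <= M &
  forall X : 'M[C]_n * 'M[C]_n, pencil_pos X -> forall i j,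
    absF (X.1 i j) <= M /\ absF (X.2 i j) <= M.
Proof.
have nz (A : 'M[C]_s) : A != 0 -> exists a b, 0 < absF (A a b).
  move=> A0; have /matrix0Pn[a [b h]] := A0; exists a, b; by rewrite absF_gt0.
move=> /nz[a [b h1]] /nz[c [d h2]].
pose M1 := (absF (C1 a b))^-1; pose M2 := (absF (C2 c d))^-1.
have M1p : 0 < M1 by rewrite invr_gt0.
have M2p : 0 < M2 by rewrite invr_gt0.
exists (M1 + M2) => [|X /pencil_pos_norm hX i j]; first lra.
have tr_delta (A : 'M[C]_s) (B : 'M[C]_n) (p q : 'I_s) :
    \tr ((delta_mx p i : 'M[C]_(s, n)) ^t* *m (A *m delta_mx q j *m B^T)) = A p q * B i j.
  have -> : (delta_mx p i : 'M[C]_(s, n)) ^t* = delta_mx i p.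
    by apply/matrixP => x y; rewrite !mxE rmorph_nat andbC.
  rewrite mxtrace_mulC; rewrite /mxtrace (bigD1 p) //= big1 ?addr0 => [|x xp]; last first.
    rewrite mxE big1 // => y _; rewrite !mxE [x == p](negbTE xp) andbF mulr0 //.
  rewrite mxE (bigD1 i) //= big1 ?addr0 => [|y yi]; last first.
    by rewrite [delta_mx _ _ _ _]mxE (negbTE yi) mulr0.
  rewrite [delta_mx _ _ _ _]mxE !eqxx mulr1 mxE (bigD1 j) //= big1 ?addr0 => [|y yj]; last first.
    rewrite mxE big1 ?mul0r // => z _; rewrite mxE (negbTE yj) andbF mulr0 //.
  rewrite mxE (bigD1 q) //= big1 ?addr0 => [|z zq]; last first.
    by rewrite mxE (negbTE zq) mulr0.
  by rewrite !mxE !eqxx mulr1.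
have nd (p : 'I_s) (q : 'I_n) : nn (delta_mx p q : 'M[C]_(s, n)) = 1.
  rewrite nnE (bigD1 p) //= (bigD1 q) //= !mxE !eqxx absF1 expr1n.
  rewrite !big1 ?addr0 // => [x xp|x xq].
    by rewrite big1 // => y _; rewrite mxE (negbTE xp) absF0 expr0n.
  by rewrite mxE (negbTE xq) andbF absF0 expr0n.
have bnd (x y : R) : 0 < x -> x * y < 1 -> y <= x^-1.
  by move=> x0 xy; rewrite -[leRHS]mul1r ler_pdivlMr // mulrC ltW.
split.
- apply: (@le_trans _ _ M1); last lra; apply: bnd => //.
  have := hX (col_mx (delta_mx a i) (col_mx (col_mx (delta_mx b j) 0) 0)).
  rewrite -nn_gt0 !nn_col !nn0 !nd penc_col !ct0 !mul0mx !mulmx0 !mul0mx !mulmx0.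
  by rewrite !mxtrace0 !addr0 tr_delta absFM; lra.
- apply: (@le_trans _ _ M2); last lra; apply: bnd => //.
  have := hX (col_mx (delta_mx c i) (col_mx (col_mx 0 (delta_mx d j)) 0)).
  rewrite -nn_gt0 !nn_col !nn0 !nd penc_col !ct0 !mul0mx !mulmx0 !mul0mx !mulmx0.
  by rewrite !mxtrace0 !addr0 !add0r tr_delta absFM; lra.
Qed.

Definition sc n (b : C * C) : 'M[C]_n * 'M[C]_n := (b.1%:M, b.2%:M).
Definition Lb (b : C * C) : 'M[C]_k := 1%:M + Lam b + (Lam b) ^t*.

Lemma ip_Lb b n (Y : 'M[C]_(k, n)) : ip Y (Lb b *m Y) = nn Y + 2 * ip Y (Lam b *m Y).
Proof.
rewrite /Lb !mulmxDl mul1mx !ipDr -/(nn Y) -ip_mull [ip (Lam b *m Y) Y]ipC; ring.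
Qed.

Definition pd (L : 'M[C]_k) := forall y : 'cV[C]_k, y != 0 -> 0 < ip y (L *m y).

Lemma ip_cols m n (Y Z : 'M[C]_(m, n)) : ip Y Z = \sum_j ip (col j Y) (col j Z).
Proof.
rewrite ipE exchange_big /=; apply: eq_bigr => j _; rewrite ipE.
by apply: eq_bigr => i _; rewrite big_ord1 !mxE.
Qed.

Lemma pd_mx (L : 'M[C]_k) n (Y : 'M[C]_(k, n)) : pd L -> Y != 0 -> 0 < ip Y (L *m Y).
Proof.
move=> hL /matrix0Pn[i [j Yij]].
have cM j' : col j' (L *m Y) = L *m col j' Y.
  by apply/matrixP => i' l; rewrite !mxE; apply: eq_bigr => m _; rewrite !mxE.
have ge j' : 0 <= ip (col j' Y) (col j' (L *m Y)).
  rewrite cM; have [->|/hL/ltW//] := eqVneq (col j' Y) 0.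
  by rewrite ip0l.
rewrite ip_cols (bigD1 j) //=; apply: ltr_pwDl; last exact: sumr_ge0.
rewrite cM; apply: hL; apply: contraNneq Yij => /matrixP/(_ i 0).
by rewrite !mxE => ->.
Qed.

Lemma pen_sc n b (Y : 'M[C]_(k, n)) : pen (sc n b) Y = ip Y (Lam b *m Y).
Proof.
rewrite /pen /sc /= !tr_scalar_mx !mul_mx_scalar LamE mulmxDl ipDr.
by rewrite -!scalemxAl.
Qed.

Lemma pencil_pos_sc n b : (0 < n)%N -> pencil_pos (sc n b) <-> pd (Lb b).
Proof.
move=> n0; rewrite /pencil_pos; split=> h.
  move=> y y0; pose Y : 'M[C]_(k, n) := y *m (\row_j (j == Ordinal n0)%:R).
  have e : (\row_j (j == Ordinal n0)%:R : 'rV[C]_n) *m (\row_j (j == Ordinal n0)%:R) ^t* = 1%:M.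
    apply/matrixP => i j; rewrite !mxE (bigD1 (Ordinal n0)) //= big1 => [|l ln].
      by rewrite !mxE !eqxx rmorph_nat mulr1 addr0 !ord1.
    by rewrite !mxE (negbTE ln) mul0r.
  have ipY A : ip Y (A *m Y) = ip y (A *m y).
    by rewrite /Y ip_mulr -!mulmxA e mulmx1.
  have nY : nn Y = nn y by have := ipY 1%:M; rewrite !mul1mx.
  have := h Y; rewrite -nn_gt0 nY nn_gt0 pen_sc ipY ip_Lb; exact.
by move=> Y Y0; rewrite pen_sc -ip_Lb; apply: pd_mx.
Qed.

Definition upper p q (b : C * C) (h : 'M[C]_(p, q) * 'M[C]_(p, q)) :
    'M[C]_(p + q) * 'M[C]_(p + q) :=
  (block_mx b.1%:M h.1 0 b.1%:M, block_mx b.2%:M h.2 0 b.2%:M).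

(** The diagonal blocks contribute the pencil at b, and the corner h only pairs the two components
    through [N1] and [N2]: h lies in the open unit ball of the pencil, measured in the form of
    [Lb b]. *)
Lemma pencil_pos_upper p q b (h : 'M[C]_(p, q) * 'M[C]_(p, q)) : pencil_pos (upper b h) <->
  forall (Y : 'M[C]_(k, p)) (Z : 'M[C]_(k, q)), (Y != 0) || (Z != 0) ->
   0 < ip Y (Lb b *m Y) + ip Z (Lb b *m Z)
      + 2 * (ip Y (N1 *m Z *m h.1^T) + ip Y (N2 *m Z *m h.2^T)).
Proof.
have E (Y : 'M[C]_(k, p)) (Z : 'M[C]_(k, q)) :
   nn (row_mx Y Z) + 2 * pen (upper b h) (row_mx Y Z) =
   ip Y (Lb b *m Y) + ip Z (Lb b *m Z)
      + 2 * (ip Y (N1 *m Z *m h.1^T) + ip Y (N2 *m Z *m h.2^T)).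
  rewrite !ip_Lb nn_row /pen /upper /= !tr_block_mx !trmx0 !tr_scalar_mx !mul_mx_row.
  rewrite !mul_row_block !mulmx0 !mul_mx_scalar !add0r !ip_row !ipDr LamE.
  rewrite ![(_ + _) *m _]mulmxDl -!scalemxAl !ipDr; ring.
have Z0 (Y : 'M[C]_(k, p)) (Z : 'M[C]_(k, q)) :
    (row_mx Y Z != 0) = (Y != 0) || (Z != 0).
  by rewrite -negb_and -row_mx_eq0.
rewrite /pencil_pos; split=> H; first by move=> Y Z; rewrite -Z0 -E; apply: H.
by move=> Y; rewrite -(hsubmxK Y) E Z0; apply: H.
Qed.
End Domain.

(** * The spectrahedron in terms of the regrouped pencil *)

Section Pencil.
Variable R : realType.
Local Notation C := (cplx R).
Variables (s : nat) (C1 C2 : 'M[C]_s).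
Local Notation pen := (pen C1 C2).

Lemma posdefmx_ip n (A : 'M[C]_n) : A ^t* = A ->
  posdefmx A <-> forall v : 'cV[C]_n, v != 0 -> 0 < ip v (A *m v).
Proof.
move=> hA; have E (v : 'cV[C]_n) : ip v (A *m v) = re ((v ^t* *m A *m v) 0 0).
  by rewrite ip.unlock mulmxA trace_mx11.
split=> [[_ h] v /h|h]; first by rewrite E ltcE => /andP[].
split=> // v /h; rewrite E ltcE => ->; rewrite andbT eq_sym.
have /matrixP/(_ 0 0) : (v ^t* *m A *m v) ^t* = v ^t* *m A *m v.
  by rewrite !ctM trmxCK hA mulmxA.
rewrite !mxE; case: (\sum_j _) => a b [] /= e; apply/eqP; lra.
Qed.
Definition vec n (Y : 'M[C]_(s, n)) : 'cV[C]_(s * n) :=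
  \col_k Y (mxtens_unindex k).1 (mxtens_unindex k).2.

Lemma sum_mxtens (V : nmodType) p q (F : 'I_p -> 'I_q -> V) :
  \sum_(k < p * q) F (mxtens_unindex k).1 (mxtens_unindex k).2
   = \sum_i \sum_j F i j.
Proof.
rewrite pair_big /= (reindex (@mxtens_unindex p q)) //=.
exists (@mxtens_index p q) => k _; [exact: mxtens_unindexK|exact: mxtens_indexK].
Qed.

Lemma tens_vec n (A : 'M[C]_s) (B : 'M[C]_n) (Y : 'M[C]_(s, n)) :
  (A *t B) *m vec Y = vec (A *m Y *m B^T).
Proof.
apply/colP => k; rewrite mxE.
under eq_bigr do rewrite !mxE.
rewrite (@sum_mxtens _ _ _ (fun i j => A (mxtens_unindex k).1 i
   * B (mxtens_unindex k).2 j * Y i j)) !mxE exchange_big /=.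
apply: eq_bigr => j _; rewrite !mxE mulr_suml; apply: eq_bigr => i _; ring.
Qed.

Lemma ip_vec n (Y Z : 'M[C]_(s, n)) : ip (vec Y) (vec Z) = ip Y Z.
Proof.
rewrite !ipE; under eq_bigr do rewrite big_ord1 !mxE.
by rewrite (@sum_mxtens _ _ _ (fun i j => re ((Y i j)^* * Z i j))).
Qed.

Lemma vec_surj n (v : 'cV[C]_(s * n)) : exists Y, v = vec Y.
Proof.
exists (\matrix_(i, j) v (mxtens_index (i, j)) 0).
by apply/colP => k; rewrite !mxE -[k in LHS]mxtens_unindexK; case: mxtens_unindex.
Qed.

Lemma pencil_herm n (X : mxpair R n) : (pencil C1 C2 X) ^t* = pencil C1 C2 X.
Proof.
rewrite /pencil !ct_block !ct0 !trmxCK.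
have -> : ((1%:M : 'M[C]_s) *t (1%:M : 'M[C]_n)) ^t* = 1%:M *t 1%:M.
  rewrite trmx_tens !trmx1; apply/matrixP => i j; rewrite !mxE.
  by rewrite rmorphM !rmorph_nat.
by [].
Qed.

Lemma spectrahedronP n (X : mxpair R n) : spectrahedron C1 C2 X <-> pencil_pos C1 C2 X.
Proof.
(* [v] keeps the grouping (0 1) (2 3) of the 4 x 4 block matrix, [w] regroups the blocks by weight
   as 0 (1 2) 3. *)
pose v (Y0 Y1 Y2 Y3 : 'M[C]_(s, n)) :=
  col_mx (col_mx (vec Y0) (vec Y1)) (col_mx (vec Y2) (vec Y3)).
pose w (Y0 Y1 Y2 Y3 : 'M[C]_(s, n)) := col_mx Y0 (col_mx (col_mx Y1 Y2) Y3).
have nvw Y0 Y1 Y2 Y3 : nn (v Y0 Y1 Y2 Y3) = nn (w Y0 Y1 Y2 Y3).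
  rewrite !nn_col /nn !ip_vec; lra.
have key Y0 Y1 Y2 Y3 : ip (v Y0 Y1 Y2 Y3) (pencil C1 C2 X *m v Y0 Y1 Y2 Y3)
    = nn (w Y0 Y1 Y2 Y3) + 2 * pen X (w Y0 Y1 Y2 Y3).
  have mulA (A B : 'M[C]_(s * n)) (Z : 'cV[C]_(s * n)) (Z' : 'cV[C]_(s * n)) :
      block_mx 1%:M A B 1%:M *m col_mx Z Z' = col_mx (Z + A *m Z') (B *m Z + Z').
    by rewrite mul_block_col !mul1mx.
  have mulD (A : 'M[C]_(s * n)) (Z Z' : 'cV[C]_(s * n)) :
      block_mx A 0 0 A *m col_mx Z Z' = col_mx (A *m Z) (A *m Z').
    by rewrite mul_block_col !mul0mx addr0 add0r.
  have I1 : (1%:M : 'M[C]_s) *t (1%:M : 'M[C]_n) = 1%:M.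
    apply/matrixP => i j; rewrite !mxE -natrM mulnb; congr ((_ : bool)%:R).
    by rewrite -xpair_eqE -!surjective_pairing (can_eq (@mxtens_unindexK s n)).
  rewrite -nvw /w /v /pencil /= I1 mul_block_col !mulA !mulD !add_col_mx.
  rewrite !ip_col penE !nn_col.
  rewrite !ipDr !tens_vec.
  have t A1 A2 (Y Z : 'M[C]_(s, n)) :
      ip (vec Y) ((A1 *t A2) ^t* *m vec Z) = ip Z (A1 *m Y *m A2^T).
    by rewrite -ip_mull ipC tens_vec ip_vec.
  rewrite !t /nn !ip_vec; ring.
have wsurj Y : exists Y0 Y1 Y2 Y3, Y = w Y0 Y1 Y2 Y3.
  exists (usubmx Y), (usubmx (usubmx (dsubmx Y))), (dsubmx (usubmx (dsubmx Y))),
    (dsubmx (dsubmx Y)).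
  by rewrite /w !vsubmxK.
have vsurj y : exists Y0 Y1 Y2 Y3, y = v Y0 Y1 Y2 Y3.
  have [Y0 e0] := vec_surj (usubmx (usubmx y)).
  have [Y1 e1] := vec_surj (dsubmx (usubmx y)).
  have [Y2 e2] := vec_surj (usubmx (dsubmx y)).
  have [Y3 e3] := vec_surj (dsubmx (dsubmx y)).
  by exists Y0, Y1, Y2, Y3; rewrite /v -e0 -e1 -e2 -e3 !vsubmxK.
rewrite /spectrahedron /=; split.
  move=> /(posdefmx_ip (pencil_herm X)) h Y Y0.
  have [Y0' [Y1 [Y2 [Y3 e]]]] := wsurj Y; rewrite e -key; apply: h.
  by rewrite -nn_gt0 nvw -e nn_gt0.
move=> h; apply/(posdefmx_ip (pencil_herm X)) => y y0.
have [Y0' [Y1 [Y2 [Y3 e]]]] := vsurj y; rewrite e key; apply: h.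
by rewrite -nn_gt0 -nvw -e nn_gt0.
Qed.
End Pencil.

(** * Pairings of pencils and their norms *)

Section Spectral.
Variables (R : realType) (C : complexOver R).

Lemma herm_spectral n (H : 'M[C]_n) : H ^t* = H -> exists (U : 'M[C]_n) (d : 'I_n -> R),
  U \is unitarymx /\ H = U ^t* *m diag_mx (\row_i rcF (d i)) *m U.
Proof.
move=> hH; have nH : H \is normalmx by apply/normalmxP; rewrite hH.
have /orthomx_spectralP := nH.
set U := spectralmx H; set D := spectral_diag H => HE.
have hU : U \is unitarymx by exact: spectral_unitarymx.
rewrite invmx_unitary // in HE.
have UU := unitarymxP hU.
have UU' : U ^t* *m U = 1%:M by apply: mulmx1C.
have DE : diag_mx D = U *m H *m U ^t*.
  by rewrite HE !mulmxA UU mul1mx -mulmxA UU mulmx1.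
have Dc : (diag_mx D) ^t* = diag_mx D by rewrite DE !ctM trmxCK hH mulmxA.
exists U, (fun i => reF (D 0 i)); split=> //.
rewrite {1}HE; congr (_ *m diag_mx _ *m _); apply/rowP => i; rewrite !mxE.
apply: rcF_real; have /matrixP/(_ i i) := Dc.
by rewrite !mxE eqxx !mulr1n.
Qed.

Lemma nn_unitary m n (z : 'M[C]_(m, n)) (U : 'M[C]_n) : U \is unitarymx -> nn (z *m U) = nn z.
Proof. by move=> /unitarymxP UU; rewrite /nn ip_mulr -mulmxA UU mulmx1. Qed.

Lemma herm_top n (H : 'M[C]_n) : (0 < n)%N -> H ^t* = H -> exists c : R,
  (forall z : 'rV[C]_n, ip z (z *m H) <= c * nn z) /\
  exists2 z : 'rV[C]_n, z != 0 & ip z (z *m H) = c * nn z.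
Proof.
move=> n0 /herm_spectral[U [d [hU HE]]].
have UU' : U ^t* *m U = 1%:M by apply: mulmx1C; apply/unitarymxP.
pose i0 := [arg max_(i > Ordinal n0) d i]%O.
have di0 i : d i <= d i0 by rewrite /i0; case: arg_maxP => // j _ h; apply: h.
have E (z : 'rV[C]_n) : ip (z *m U) (z *m U *m H) = \sum_i d i * absF (z 0 i) ^+ 2.
  rewrite HE ip_mulr !mulmxA -![z *m U *m _]mulmxA (unitarymxP hU) mulmx1.
  rewrite -mulmxA (unitarymxP hU) mulmx1 ipE big_ord1; apply: eq_bigr => i _.
  rewrite mul_mx_diag !mxE.
  have -> : (z 0 i)^* * (z 0 i * rcF (d i)) = rcF (d i) * (z 0 i * (z 0 i)^*) by ring.
  by rewrite reF_rcM absF_sqr.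
have N (z : 'rV[C]_n) : nn z = \sum_i absF (z 0 i) ^+ 2 by rewrite nnE big_ord1.
exists (d i0); split=> [z|].
  have zE : z = (z *m U ^t*) *m U by rewrite -mulmxA UU' mulmx1.
  rewrite zE E nn_unitary // N mulr_sumr; apply: ler_sum => i _.
  by rewrite ler_wpM2r // sqr_ge0.
pose e : 'rV[C]_n := delta_mx 0 i0.
have sume (F : 'I_n -> R) : \sum_i F i * absF (e 0 i) ^+ 2 = F i0.
  rewrite (bigD1 i0) //= mxE !eqxx absF1 expr1n mulr1 big1 ?addr0 // => i ii0.
  by rewrite mxE eqxx (negbTE ii0) absF0 expr0n mulr0.
have ne : nn e = 1 by rewrite N -[RHS](sume (fun=> 1)); apply: eq_bigr => i _; rewrite mul1r.
exists (e *m U); last by rewrite E sume nn_unitary // ne mulr1.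
by rewrite -nn_gt0 nn_unitary // ne.
Qed.

(* A polar decomposition without partial isometries: |X^*| = w' w'^* and |X| = w w^*. *)
Lemma polar p q (X : 'M[C]_(p, q)) : exists (w' : 'M[C]_(p, q)) (w : 'M[C]_q),
  [/\ X = w' *m w ^t*, nn (w' *m w' ^t*) = nn X, nn (w *m w ^t*) = nn X &
      (w *m w ^t*) *m (w *m w ^t*) = X ^t* *m X].
Proof.
have hH : (X ^t* *m X) ^t* = X ^t* *m X by rewrite ctM trmxCK.
have [U [d [hU HE]]] := herm_spectral hH.
have UU := unitarymxP hU.
have UU' : U ^t* *m U = 1%:M by apply: mulmx1C.
pose dg (f : 'I_q -> R) : 'M[C]_q := diag_mx (\row_i rcF (f i)).
have dgM f g : dg f *m dg g = dg (fun i => f i * g i).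
  by rewrite mulmx_diag; congr diag_mx; apply/rowP => i; rewrite !mxE rmorphM.
have dgC f : (dg f) ^t* = dg f.
  apply/matrixP => i j; rewrite !mxE eq_sym; case: eqVneq => [->|_].
    by rewrite !mulr1n rcF_conj.
  by rewrite !mulr0n rmorph0.
have dg_eq f g : (forall i, f i = g i) -> dg f = dg g.
  by move=> h; congr diag_mx; apply/rowP => i; rewrite !mxE h.
have trdg f : reF (\tr (dg f)) = \sum_i f i.
  rewrite /mxtrace raddf_sum; apply: eq_bigr => i _.
  by rewrite /= !mxE eqxx mulr1n reF_rc.
rewrite -/(dg d) in HE.
have DE : (U *m X ^t*) *m (X *m U ^t*) = dg d.
  rewrite !mulmxA -[U *m _ *m X]mulmxA HE !mulmxA UU mul1mx -mulmxA UU mulmx1 //.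
have d0 i : 0 <= d i.
  have -> : d i = nn (X *m U ^t* *m (delta_mx i 0 : 'cV[C]_q)).
    rewrite /nn ip_mull ctM trmxCK mulmxA DE ipE.
    under eq_bigr do rewrite big_ord1 mxE.
    rewrite (bigD1 i) //= big1 ?addr0 => [|j ji]; last first.
      by rewrite (negbTE ji) rmorph0 mul0r raddf0.
    rewrite !eqxx rmorph_nat mul1r mxE (bigD1 i) //= big1 ?addr0 => [|j ji].
      by rewrite !mxE !eqxx mulr1 mulr1n reF_rc.
    by rewrite !mxE eq_sym (negbTE ji) mulr0n mul0r.
  exact: nn_ge0.
(* With |X| = U^* diag(e) U, the factors w = U^* diag(f) and w' = X U^* diag(1 / f) split X into
   halves of equal weight. Where f vanishes its inverse is 0, and the column of X U^* vanishes as
   well. *)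
pose e i := Num.sqrt (d i); pose f i := Num.sqrt (e i).
have e0 i : 0 <= e i by rewrite sqrtr_ge0.
have ff i : f i * f i = e i by rewrite -expr2 sqr_sqrtr.
have ee i : e i * e i = d i by rewrite -expr2 sqr_sqrtr.
pose w := U ^t* *m dg f; pose w' := X *m U ^t* *m dg (fun i => (f i)^-1).
exists w', w.
have wwE : w *m w ^t* = U ^t* *m dg e *m U.
  rewrite /w ctM trmxCK dgC !mulmxA -[_ *m dg f *m dg f]mulmxA dgM.
  by rewrite (dg_eq _ e).
have w2 : (w *m w ^t*) *m (w *m w ^t*) = X ^t* *m X.
  rewrite HE wwE !mulmxA -[_ *m U *m U ^t*]mulmxA UU mulmx1.
  by rewrite -[_ *m dg e *m dg e]mulmxA dgM (dg_eq _ d).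
have nX : nn X = \sum_i d i.
  rewrite /nn ip.unlock HE mxtrace_mulC mulmxA UU mul1mx; exact: trdg.
have nw : nn (w *m w ^t*) = nn X.
  have hw : (w *m w ^t*) ^t* = w *m w ^t* by rewrite ctM trmxCK.
  by rewrite {1}/nn ip.unlock hw w2 /nn ip.unlock.
have wf : w' *m w ^t* = X.
  pose g i := (f i)^-1 * f i.
  have -> : w' *m w ^t* = X *m U ^t* *m dg g *m U.
    by rewrite /w' /w ctM trmxCK dgC !mulmxA -[_ *m dg _ *m dg f]mulmxA dgM.
  have h : X *m U ^t* *m dg (fun i => 1 - g i) = 0.
    apply/eqP; rewrite -nn_eq0 /nn ip.unlock ctM dgC ctM trmxCK.
    rewrite -mulmxA (mulmxA (U *m X ^t*)) DE !dgM trdg big1 // => i _.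
    rewrite /g /f /e; have [->|di] := eqVneq (d i) 0; first by rewrite mul0r mulr0.
    rewrite mulVf ?subrr ?mul0r //; rewrite gt_eqF // !sqrtr_gt0 lt_neqAle eq_sym di.
    exact: d0.
  have s1 : dg (fun i => 1 - g i) + dg g = 1%:M.
    apply/matrixP => i j; rewrite !mxE; case: eqVneq => [->|_].
      by rewrite !mulr1n -rmorphD subrK rmorph1.
    by rewrite !mulr0n addr0.
  have : X *m U ^t* *m (dg (fun i => 1 - g i) + dg g) = X *m U ^t* by rewrite s1 mulmx1.
  by rewrite mulmxDr h add0r => ->; rewrite -mulmxA UU' mulmx1.
split=> //.
rewrite {1}/nn ip.unlock ctM trmxCK.
have -> : w' *m w' ^t* = (X *m U ^t*) *m dg (fun i => (e i)^-1) *m (U *m X ^t*).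
  rewrite /w' !ctM trmxCK dgC !mulmxA -[_ *m dg _ *m dg _]mulmxA dgM.
  by rewrite (dg_eq _ (fun i => (e i)^-1)) // => i; rewrite -invfM ff.
have cyc (A : 'M[C]_(p, q)) (A' : 'M[C]_(q, p)) (Z : 'M[C]_q) :
    \tr ((A *m Z *m A') *m (A *m Z *m A')) = \tr (((A' *m A) *m Z) *m ((A' *m A) *m Z)).
  by rewrite -!mulmxA mxtrace_mulC -!mulmxA mxtrace_mulC !mulmxA.
rewrite cyc DE !dgM trdg nX; apply: eq_bigr => i _.
have [->|di] := eqVneq (d i) 0; first by rewrite !mul0r.
have ei : e i != 0 by rewrite gt_eqF // sqrtr_gt0 lt_neqAle eq_sym di d0.
by move: (e i) (ee i) ei => x <- xn; field.
Qed.
End Spectral.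

(** * Pairings and the equality case *)

Section Rigidity.
Variables (R : realType) (C : complexOver R).

(** The real form of A1 (x) conj(B1) + A2 (x) conj(B2) between the matrices X and Y read as vectors.
    The least constant in [bounded_by] is the operator norm of this sum. *)
Definition bform m n p q (A1 A2 : 'M[C]_(m, n)) (B1 B2 : 'M[C]_(p, q))
    (X : 'M[C]_(m, p)) (Y : 'M[C]_(n, q)) : R :=
  ip X (A1 *m Y *m B1 ^t*) + ip X (A2 *m Y *m B2 ^t*).

Definition bounded_by m n p q (A1 A2 : 'M[C]_(m, n)) (B1 B2 : 'M[C]_(p, q)) (c : R) :=
  forall X Y, 2 * bform A1 A2 B1 B2 X Y <= c * (nn X + nn Y).

Definition attains m n p q (A1 A2 : 'M[C]_(m, n)) (B1 B2 : 'M[C]_(p, q)) (c : R) X Y :=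
  2 * bform A1 A2 B1 B2 X Y = c * (nn X + nn Y).

Lemma ip_mxvec m n (X Y : 'M[C]_(m, n)) : ip (mxvec X) (mxvec Y) = ip X Y.
Proof.
rewrite !ipE big_ord1 pair_big /= (reindex _ (curry_mxvec_bij m n)) /=.
by apply: eq_bigr => -[i j] _; rewrite !mxvecE.
Qed.

(** The constant is the largest eigenvalue of the hermitian dilation [H] of the operator, and an
    eigenvector gives the pair. *)
Lemma optimal_bound m n p q (A1 A2 : 'M[C]_(m, n)) (B1 B2 : 'M[C]_(p, q)) :
  (0 < m)%N -> (0 < p)%N -> exists c : R, bounded_by A1 A2 B1 B2 c /\
    exists X Y, 0 < nn X + nn Y /\ attains A1 A2 B1 B2 c X Y.
Proof.
move=> m0 p0.
pose f (Y : 'M[C]_(n, q)) : 'M[C]_(m, p) := A1 *m Y *m B1 ^t* + A2 *m Y *m B2 ^t*.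
have lf : linear f.
  move=> a Y Z; rewrite /f !mulmxDr !mulmxDl -!scalemxAr -!scalemxAl scalerDr.
  by rewrite addrACA.
pose fm := GRing.isLinear.Build C _ _ _ f lf.
pose F : {linear 'M[C]_(n, q) -> 'M[C]_(m, p)} := HB.pack f fm.
pose L := lin_mx F.
have LE Y : mxvec Y *m L = mxvec (f Y) by rewrite mul_vec_lin.
pose H := block_mx 0 (L ^t*) L 0.
have hH : H ^t* = H by rewrite /H ct_block !ct0 trmxCK.
have N0 : (0 < m * p + n * q)%N by rewrite addn_gt0 muln_gt0 m0 p0.
have E X Y : ip (row_mx (mxvec X) (mxvec Y)) (row_mx (mxvec X) (mxvec Y) *m H)
    = 2 * bform A1 A2 B1 B2 X Y.
  rewrite /H mul_row_block !mulmx0 add0r addr0 ip_row.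
  rewrite [ip (mxvec Y) _]ipC ip_mulr trmxCK LE ip_mxvec /f ipDr -/(bform _ _ _ _ _ _).
  ring.
have Nv (X : 'M[C]_(m, p)) (Y : 'M[C]_(n, q)) : nn (row_mx (mxvec X) (mxvec Y)) = nn X + nn Y.
  by rewrite nn_row /nn !ip_mxvec.
have surj (z : 'rV[C]_(m * p + n * q)) : exists X Y, z = row_mx (mxvec X) (mxvec Y).
  by exists (vec_mx (lsubmx z)), (vec_mx (rsubmx z)); rewrite !vec_mxK hsubmxK.
have [c [hc [z z0 hz]]] := herm_top N0 hH.
exists c; split=> [X Y|]; first by rewrite -E -Nv.
have [X [Y zE]] := surj z; exists X, Y; rewrite -Nv -zE nn_gt0; split=> //.
by rewrite /attains -E -Nv -zE.
Qed.

Lemma bform_ipl m n p q (A1 A2 : 'M[C]_(m, n)) (B1 B2 : 'M[C]_(p, q)) X Y :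
  bform A1 A2 B1 B2 X Y = ip X (A1 *m Y *m B1 ^t* + A2 *m Y *m B2 ^t*).
Proof. by rewrite /bform ipDr. Qed.

Lemma bform_ipr m n p q (A1 A2 : 'M[C]_(m, n)) (B1 B2 : 'M[C]_(p, q)) X Y :
  bform A1 A2 B1 B2 X Y = ip (A1 ^t* *m X *m B1 + A2 ^t* *m X *m B2) Y.
Proof.
rewrite /bform ipDl; congr (_ + _);
  by rewrite ip_mulr ip_mull trmxCK mulmxA.
Qed.

Lemma linear_term_eq0 (a b : R) : (forall t : R, 0 <= a * t + b * t ^+ 2) -> a = 0.
Proof.
move=> h; apply/eqP; rewrite -normr_le0.
apply: (@le0_small _ _ `|b| 1) => // t t0 t1.
have h1 := h t; have h2 := h (- t).
have hb := ler_norm b; rewrite ler_norml; apply/andP; split; nra.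
Qed.

(** First-order conditions: a maximizing pair is a pair of singular vectors for the value c. *)
Lemma attains_stationary m n p q (A1 A2 : 'M[C]_(m, n)) (B1 B2 : 'M[C]_(p, q)) c X Y :
  bounded_by A1 A2 B1 B2 c -> attains A1 A2 B1 B2 c X Y ->
  A1 *m Y *m B1 ^t* + A2 *m Y *m B2 ^t* = rcF c *: X /\
  A1 ^t* *m X *m B1 + A2 ^t* *m X *m B2 = rcF c *: Y.
Proof.
move=> hb ha; set U := _ + _; set V := (X in _ /\ X = _).
have XV Z : bform A1 A2 B1 B2 Z Y = ip Z U by rewrite bform_ipl.
have YV Z : bform A1 A2 B1 B2 X Z = ip V Z by rewrite bform_ipr.
move: ha; rewrite /attains => ha.
have nnD (m' n' : nat) (A B : 'M[C]_(m', n')) (t : R) :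
    nn (A + rcF t *: B) = nn A + t * (2 * ip A B) + t ^+ 2 * nn B.
  by rewrite /nn !(ipDl, ipDr) !(ipZl, ipZr) [ip B A]ipC; ring.
have fl (t : R) (Z : 'M[C]_(m, p)) :
    bform A1 A2 B1 B2 (X + rcF t *: Z) Y = bform A1 A2 B1 B2 X Y + t * ip Z U.
  by rewrite !XV ipDl ipZl.
have fr (t : R) (Z : 'M[C]_(n, q)) :
    bform A1 A2 B1 B2 X (Y + rcF t *: Z) = bform A1 A2 B1 B2 X Y + t * ip V Z.
  by rewrite !YV ipDr ipZr.
split; apply/eqP; rewrite eq_sym -subr_eq0 -nn_eq0.
- set D := rcF c *: X - U.
  suff : 2 * nn D = 0 by move=> h; apply/eqP; lra.
  apply: (@linear_term_eq0 _ (c * nn D)) => t.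
  have := hb (X + rcF t *: D) Y; rewrite fl nnD.
  have : nn D = c * ip X D - ip D U by rewrite {1}/nn /D ipBl ipZl [ip U _]ipC.
  move: ha; move: (nn D) (ip X D) (ip D U) (bform _ _ _ _ _ _) (nn X) (nn Y).
  move=> d x u f0 x2 y2 ha dE; rewrite dE; lra.
- set D := rcF c *: Y - V.
  suff : 2 * nn D = 0 by move=> h; apply/eqP; lra.
  apply: (@linear_term_eq0 _ (c * nn D)) => t.
  have := hb X (Y + rcF t *: D); rewrite fr nnD.
  have : nn D = c * ip Y D - ip V D by rewrite {1}/nn /D ipBl ipZl.
  move: ha; move: (nn D) (ip Y D) (ip V D) (bform _ _ _ _ _ _) (nn X) (nn Y).
  move=> d x u f0 x2 y2 ha dE; rewrite dE; lra.
Qed.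

(* Factoring through the absolute values, Cauchy-Schwarz separates the two pencils. *)
Lemma bform_absolute_values m n p q (A1 A2 : 'M[C]_(m, n)) (B1 B2 : 'M[C]_(p, q)) l l'
    (w' : 'M[C]_(m, l)) (w : 'M[C]_(p, l)) (y' : 'M[C]_(n, l')) (y : 'M[C]_(q, l')) :
  2 * bform A1 A2 B1 B2 (w' *m w ^t*) (y' *m y ^t*) <=
    bform A1 A2 A1 A2 (w' *m w' ^t*) (y' *m y' ^t*)
    + bform B1 B2 B1 B2 (w *m w ^t*) (y *m y ^t*).
Proof.
(* Cyclicity of the trace moves A with the primed factors to one side and B with the other factors
   to the other, so that the two pencils separate. *)
have cross a b d e (A : 'M[C]_(a, b)) (B : 'M[C]_(d, e)) (u' : 'M[C]_(a, l))
   (u : 'M[C]_(d, l)) (v' : 'M[C]_(b, l')) (v : 'M[C]_(e, l')) :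
   ip (u' *m u ^t*) (A *m (v' *m v ^t*) *m B ^t*)
     = ip (u ^t* *m B *m v) (u' ^t* *m A *m v').
  rewrite ip.unlock !ctM !trmxCK mxtrace_mulC [in RHS]mxtrace_mulC !mulmxA.
  rewrite -!mulmxA mxtrace_mulC -!mulmxA mxtrace_mulC -!mulmxA.
  rewrite [in RHS]mxtrace_mulC -!mulmxA [in RHS]mxtrace_mulC -!mulmxA.
  rewrite [in RHS]mxtrace_mulC -!mulmxA //.
have two a b (A B : 'M[C]_(a, b)) : 2 * ip A B <= nn A + nn B.
  have := nn_ge0 (A - B); rewrite /nn ipBl !ipBr [ip B A]ipC; lra.
rewrite /bform !cross.
have := two _ _ (w ^t* *m B1 *m y) (w' ^t* *m A1 *m y').
have := two _ _ (w ^t* *m B2 *m y) (w' ^t* *m A2 *m y').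
rewrite /nn; lra.
Qed.

Lemma bounded_by_mixed m n p q (A1 A2 : 'M[C]_(m, n)) (B1 B2 : 'M[C]_(p, q)) c :
  bounded_by A1 A2 A1 A2 c -> bounded_by B1 B2 B1 B2 c -> bounded_by A1 A2 B1 B2 c.
Proof.
move=> hA hB X Y; have [w' [w [XE n1 n2 _]]] := polar X.
have [y' [y [YE n3 n4 _]]] := polar Y.
have := bform_absolute_values A1 A2 B1 B2 w' w y' y; rewrite -XE -YE => h.
have := hA (w' *m w' ^t*) (y' *m y' ^t*); rewrite n1 n3.
have := hB (w *m w ^t*) (y *m y ^t*); rewrite n2 n4; lra.
Qed.

(** Put Z_j = T_j W' - W r_j. The three moment identities make Z1 Q Z1^* + Z2 Q Z2^* vanish, and Q
    is positive definite because y is invertible. *)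
Lemma summand_half m n p q (T1 T2 : 'M[C]_(m, n)) (r1 r2 : 'M[C]_(p, q))
    (W : 'M[C]_(m, p)) (W' : 'M[C]_(n, q)) (P : 'M[C]_p) (y : 'M[C]_q) (c : C) :
  y \in unitmx -> let Q := y *m y ^t* in
  r1 *m Q *m r1 ^t* + r2 *m Q *m r2 ^t* = c *: P ->
  T1 *m (W' *m Q) *m r1 ^t* + T2 *m (W' *m Q) *m r2 ^t* = c *: (W *m P) ->
  T1 *m (W' *m Q *m W' ^t*) *m T1 ^t* + T2 *m (W' *m Q *m W' ^t*) *m T2 ^t*
    = c *: (W *m P *m W ^t*) ->
  T1 *m W' = W *m r1 /\ T2 *m W' = W *m r2.
Proof.
move=> hy Q hr hTr hT.
have QC : Q ^t* = Q by rewrite /Q ctM trmxCK.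
have QE : Q = y *m y ^t* by []; clearbody Q.
pose Z1 := T1 *m W' - W *m r1; pose Z2 := T2 *m W' - W *m r2.
have ZQ : Z1 *m Q *m r1 ^t* + Z2 *m Q *m r2 ^t* = 0.
  have -> : Z1 *m Q *m r1 ^t* + Z2 *m Q *m r2 ^t* =
     (T1 *m (W' *m Q) *m r1 ^t* + T2 *m (W' *m Q) *m r2 ^t*)
     - W *m (r1 *m Q *m r1 ^t* + r2 *m Q *m r2 ^t*).
    rewrite /Z1 /Z2 !mulmxBl !mulmxDr !mulmxA opprD addrACA //.
  by rewrite hr hTr scalemxAr subrr.
have ZQ' : r1 *m Q *m Z1 ^t* + r2 *m Q *m Z2 ^t* = 0.
  have := congr1 (fun M => M ^t*) ZQ; rewrite /= ct0 ctD !ctM !trmxCK QC.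
  by rewrite !mulmxA.
have TE : T1 *m W' = W *m r1 + Z1 by rewrite /Z1 addrC subrK.
have TE2 : T2 *m W' = W *m r2 + Z2 by rewrite /Z2 addrC subrK.
have ZZ : Z1 *m Q *m Z1 ^t* + Z2 *m Q *m Z2 ^t* = 0.
  have E : T1 *m (W' *m Q *m W' ^t*) *m T1 ^t* + T2 *m (W' *m Q *m W' ^t*) *m T2 ^t*
     = W *m (r1 *m Q *m r1 ^t* + r2 *m Q *m r2 ^t*) *m W ^t*
       + W *m (r1 *m Q *m Z1 ^t* + r2 *m Q *m Z2 ^t*)
       + (Z1 *m Q *m r1 ^t* + Z2 *m Q *m r2 ^t*) *m W ^t*
       + (Z1 *m Q *m Z1 ^t* + Z2 *m Q *m Z2 ^t*).
    have half (T : 'M[C]_(m, n)) (r : 'M[C]_(p, q)) Z : T *m W' = W *m r + Z ->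
      T *m (W' *m Q *m W' ^t*) *m T ^t* = W *m (r *m Q *m r ^t*) *m W ^t*
         + W *m (r *m Q *m Z ^t*) + (Z *m Q *m r ^t*) *m W ^t* + Z *m Q *m Z ^t*.
      move=> e; have -> : T *m (W' *m Q *m W' ^t*) *m T ^t*
         = (T *m W') *m Q *m (T *m W') ^t* by rewrite ctM !mulmxA.
      rewrite e ctD ctM !mulmxDl !mulmxDr !mulmxA !addrA.
      by rewrite [X in X + _]addrAC.
    rewrite (half _ _ _ TE) (half _ _ _ TE2) !mulmxDr !mulmxDl.
    by rewrite addrACA [X in X + _]addrACA [X in X + _ + _]addrACA.
  move: hT; rewrite E hr ZQ ZQ' mulmx0 mul0mx !addr0 -scalemxAr -scalemxAl.
  by move=> /eqP; rewrite -[X in _ == X]addr0 (inj_eq (addrI _)) => /eqP.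
have nz : nn (Z1 *m y) + nn (Z2 *m y) = 0.
  have h (Z : 'M[C]_(m, q)) : nn (Z *m y) = reF (\tr (Z *m Q *m Z ^t*)).
    by rewrite /nn ip.unlock mxtrace_mulC ctM QE !mulmxA.
  by rewrite !h -raddfD -mxtraceD ZZ mxtrace0 raddf0.
have z0 (Z : 'M[C]_(m, q)) : nn (Z *m y) = 0 -> Z = 0.
  move=> /eqP; rewrite nn_eq0 => /eqP e.
  by rewrite -[Z](mulmxK hy) e mul0mx.
have := nn_ge0 (Z1 *m y); have := nn_ge0 (Z2 *m y) => g1 g2.
have e1 : Z1 = 0 by apply: z0; lra.
have e2 : Z2 = 0 by apply: z0; lra.
by rewrite TE TE2 e1 e2 !addr0.
Qed.

(** Attaining the mixed bound forces equality in Cauchy-Schwarz, so the absolute values of X and Y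
    attain the bounds of both pencils. The last hypothesis makes |X| and |Y| invertible; the polar
    parts of X and Y are then isometries, and stationarity makes them intertwine the
    coefficients. *)
Lemma rigidity m n p q (T1 T2 : 'M[C]_(m, n)) (r1 r2 : 'M[C]_(p, q)) c X Y :
  bounded_by T1 T2 T1 T2 c -> bounded_by r1 r2 r1 r2 c ->
  attains T1 T2 r1 r2 c X Y -> 0 < nn X + nn Y ->
  (forall (w : 'M[C]_p) (y : 'M[C]_q), 0 < nn (w *m w ^t*) + nn (y *m y ^t*) ->
     r1 *m (y *m y ^t*) *m r1 ^t* + r2 *m (y *m y ^t*) *m r2 ^t* = rcF c *: (w *m w ^t*) ->
     r1 ^t* *m (w *m w ^t*) *m r1 + r2 ^t* *m (w *m w ^t*) *m r2 = rcF c *: (y *m y ^t*) ->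
     w \in unitmx /\ y \in unitmx) ->
  exists (W : 'M[C]_(m, p)) (W' : 'M[C]_(n, q)),
    [/\ W ^t* *m W = 1%:M, W' ^t* *m W' = 1%:M,
        T1 *m W' = W *m r1 /\ T2 *m W' = W *m r2 &
        T1 ^t* *m W = W' *m r1 ^t* /\ T2 ^t* *m W = W' *m r2 ^t*].
Proof.
move=> hT hr hX pos irr.
have hTr : bounded_by T1 T2 r1 r2 c by apply: bounded_by_mixed.
have [w' [w [XE n1 n2 X2]]] := polar X.
have [y' [y [YE n3 n4 Y2]]] := polar Y.
have fa := bform_absolute_values T1 T2 r1 r2 w' w y' y.
have hT' := hT (w' *m w' ^t*) (y' *m y' ^t*).
have hr' := hr (w *m w ^t*) (y *m y ^t*).
rewrite -XE -YE in fa; rewrite n1 n3 in hT'; rewrite n2 n4 in hr'.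
rewrite /attains in hX.
have aT : attains T1 T2 T1 T2 c (w' *m w' ^t*) (y' *m y' ^t*).
  by rewrite /attains n1 n3; lra.
have ar : attains r1 r2 r1 r2 c (w *m w ^t*) (y *m y ^t*).
  by rewrite /attains n2 n4; lra.
have [sr1 sr2] := attains_stationary hr ar.
have [sT1 sT2] := attains_stationary hT aT.
have [sX1 sX2] := attains_stationary hTr hX.
have [hw hy] : w \in unitmx /\ y \in unitmx.
  by apply: irr => //; rewrite n2 n4.
set P := w *m w ^t* in sr1 sr2 X2; set Q := y *m y ^t* in sr1 sr2 Y2.
have ctu k (v : 'M[C]_k) : v \in unitmx -> v ^t* \in unitmx.
  by rewrite map_unitmx unitmx_tr.
have hP : P \in unitmx by rewrite /P unitmx_mul hw ctu.
have hQ : Q \in unitmx by rewrite /Q unitmx_mul hy ctu.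
have PC : P ^t* = P by rewrite /P ctM trmxCK.
have QC : Q ^t* = Q by rewrite /Q ctM trmxCK.
have invC k (M : 'M[C]_k) : M \in unitmx -> M ^t* = M -> (invmx M) ^t* = invmx M.
  by move=> hM MC; rewrite trmx_inv map_invmx MC.
pose W := X *m invmx P; pose W' := Y *m invmx Q.
have WP : W *m P = X by rewrite /W mulmxKV.
have W'Q : W' *m Q = Y by rewrite /W' mulmxKV.
have iso k l (M : 'M[C]_(k, l)) (N : 'M[C]_l) : N \in unitmx -> N ^t* = N ->
    N *m N = M ^t* *m M -> (M *m invmx N) ^t* *m (M *m invmx N) = 1%:M.
  move=> hN NC NN; rewrite ctM invC // mulmxA -[_ *m M]mulmxA -NN !mulmxA.
  by rewrite mulVmx // mul1mx mulmxV.
(* The isometry in the polar decomposition carries the absolute value of M to that of its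
   adjoint. *)
have abs k l (M u' : 'M[C]_(k, l)) (u : 'M[C]_l) : u \in unitmx -> M = u' *m u ^t* ->
    (M *m invmx (u *m u ^t*)) *m (u *m u ^t*) *m (M *m invmx (u *m u ^t*)) ^t*
     = u' *m u' ^t*.
  move=> hu ME; have hN : u *m u ^t* \in unitmx by rewrite unitmx_mul hu ctu.
  rewrite mulmxKV // ctM invC //; last by rewrite ctM trmxCK.
  rewrite {1}ME {1}ME ctM trmxCK !mulmxA -[u' *m u ^t* *m _]mulmxA.
  have -> : u ^t* *m invmx (u *m u ^t*) = invmx u.
    apply: (can_inj (mulKmx hu)); rewrite mulmxV // mulmxA mulmxV //.
  by rewrite -[u' *m _ *m u]mulmxA mulVmx // mulmx1.
exists W, W'; split; [exact: iso|exact: iso| |].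
- apply: (@summand_half _ _ _ _ _ _ _ _ W W' P y (rcF c)) => //.
    by rewrite -/Q W'Q WP.
  by rewrite /W /W' (abs _ _ _ _ _ hw XE) (abs _ _ _ _ _ hy YE).
- apply: (@summand_half _ _ _ _ _ _ _ _ W' W Q w (rcF c)) => //;
    rewrite ?trmxCK //.
    by rewrite -/P W'Q WP.
  by rewrite /W /W' (abs _ _ _ _ _ hw XE) (abs _ _ _ _ _ hy YE).
Qed.
End Rigidity.

(** * Pencils with the same unit ball *)

Section Transfer.
Variables (R : realType) (C : complexOver R).

Lemma bform_adj m n p q (A1 A2 : 'M[C]_(m, n)) (B1 B2 : 'M[C]_(p, q)) X Y :
  bform A1 A2 B1 B2 X Y = bform B1 B2 A1 A2 (X ^t*) (Y ^t*).
Proof.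
rewrite /bform; congr (_ + _);
by rewrite -ip_adj !ctM trmxCK mulmxA.
Qed.

Lemma bounded_by_sym m n p q (A1 A2 : 'M[C]_(m, n)) (B1 B2 : 'M[C]_(p, q)) c :
  bounded_by A1 A2 B1 B2 c -> bounded_by B1 B2 A1 A2 c.
Proof.
by move=> h X Y; have := h (X ^t*) (Y ^t*); rewrite bform_adj !trmxCK !nn_adj.
Qed.

Lemma bounded_by_le m n p q (A1 A2 : 'M[C]_(m, n)) (B1 B2 : 'M[C]_(p, q)) c c' :
  c <= c' -> bounded_by A1 A2 B1 B2 c -> bounded_by A1 A2 B1 B2 c'.
Proof.
move=> cc h X Y; apply: le_trans (h X Y) _; rewrite ler_wpM2r //.
by rewrite addr_ge0 // nn_ge0.
Qed.

Lemma bounded_by_ge0 m n p q (A1 A2 : 'M[C]_(m, n)) (B1 B2 : 'M[C]_(p, q)) c :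
  (0 < m)%N -> (0 < p)%N -> bounded_by A1 A2 B1 B2 c -> 0 <= c.
Proof.
move=> m0 p0 /(_ (const_mx 1) 0); rewrite /bform !mulmx0 !mul0mx !ip0r addr0 mulr0.
rewrite nn0 addr0 => h; have : 0 < nn (const_mx 1 : 'M[C]_(m, p)).
  rewrite nn_gt0; apply/eqP => /matrixP/(_ (Ordinal m0) (Ordinal p0)).
  by rewrite !mxE => /eqP; rewrite oner_eq0.
by move=> n1; move: h; rewrite pmulr_lge0.
Qed.

Lemma bounded_by_attained m n p q (A1 A2 : 'M[C]_(m, n)) (B1 B2 : 'M[C]_(p, q)) c c' X Y :
  bounded_by A1 A2 B1 B2 c -> attains A1 A2 B1 B2 c' X Y -> 0 < nn X + nn Y -> c' <= c.
Proof. by move=> h + p0; rewrite /attains => e; have := h X Y; rewrite e ler_pM2r. Qed.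

Lemma bounded_byZ m n p q (A1 A2 : 'M[C]_(m, n)) (B1 B2 : 'M[C]_(p, q)) c (t : R) :
  0 < t -> bounded_by (rcF t *: A1) (rcF t *: A2) B1 B2 c <->
    bounded_by A1 A2 B1 B2 (c / t).
Proof.
move=> t0.
have E X Y : bform (rcF t *: A1) (rcF t *: A2) B1 B2 X Y = t * bform A1 A2 B1 B2 X Y.
  by rewrite /bform -!scalemxAl !ipZr mulrDr.
split=> h X Y; have := h X Y; rewrite E.
  by rewrite mulrAC ler_pdivlMr //; lra.
by rewrite mulrAC ler_pdivlMr //; lra.
Qed.

Lemma bounded_byZr m n p q (A1 A2 : 'M[C]_(m, n)) (B1 B2 : 'M[C]_(p, q)) c (t : R) :
  0 < t -> bounded_by A1 A2 (rcF t *: B1) (rcF t *: B2) c <->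
    bounded_by A1 A2 B1 B2 (c / t).
Proof.
move=> t0; split.
  by move=> /bounded_by_sym /(bounded_byZ _ _ _ _ _ t0)/bounded_by_sym.
by move=> /bounded_by_sym /(bounded_byZ _ _ _ _ _ t0)/bounded_by_sym.
Qed.

(* With A_j the coefficients of the pencil and L, M_j those of the pencil seen from another
   scalar point, this compares the upper triangular perturbations of the two points. *)
Definition same_ball k (L A1 A2 M1 M2 : 'M[C]_k) := forall p q (B1 B2 : 'M[C]_(p, q)),
  (forall (Y : 'M[C]_(k, p)) (Z : 'M[C]_(k, q)), (Y != 0) || (Z != 0) ->
     0 < nn Y + nn Z + 2 * bform A1 A2 B1 B2 Y Z) <->
  (forall (Y : 'M[C]_(k, p)) (Z : 'M[C]_(k, q)), (Y != 0) || (Z != 0) ->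
     0 < ip Y (L *m Y) + ip Z (L *m Z) + 2 * bform M1 M2 B1 B2 Y Z).

Lemma pd_factor k (L : 'M[C]_k) : L ^t* = L ->
  (forall y : 'cV[C]_k, y != 0 -> 0 < ip y (L *m y)) ->
  exists2 G : 'M[C]_k, G \in unitmx & L = G *m G ^t*.
Proof.
move=> hL pL; have [U [d [hU LE]]] := herm_spectral hL.
have UU := unitarymxP hU.
have UU' : U ^t* *m U = 1%:M by apply: mulmx1C.
have d0 i : 0 < d i.
  pose e : 'cV[C]_k := delta_mx i 0.
  have h (D : 'M[C]_k) : ip e (D *m e) = reF (D i i).
    rewrite /e ipE; under eq_bigr do rewrite big_ord1 mxE.
    rewrite (bigD1 i) //= big1 ?addr0 => [|j ji]; last first.
      by rewrite (negbTE ji) rmorph0 mul0r raddf0.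
    rewrite !eqxx rmorph_nat mul1r mxE (bigD1 i) //= big1 ?addr0 => [|j ji].
      by rewrite !mxE !eqxx mulr1.
    by rewrite !mxE (negbTE ji) mulr0.
  have ne : nn e = 1 by have := h 1%:M; rewrite mul1mx mxE eqxx mulr1n -(rmorph1 rcF) reF_rc.
  have := pL (U ^t* *m e); rewrite -nn_gt0 {1}/nn !ip_mull trmxCK mulmxA UU mul1mx.
  rewrite -/(nn e) ne ltr01 => /(_ isT); rewrite LE !mulmxA UU mul1mx.
  rewrite -[_ *m U *m _]mulmxA UU mulmx1 h !mxE eqxx mulr1n reF_rc //.
pose D := diag_mx (\row_i rcF (Num.sqrt (d i))) : 'M[C]_k.
have DC : D ^t* = D.
  apply/matrixP => i j; rewrite !mxE eq_sym; case: eqVneq => [->|_].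
    by rewrite !mulr1n rcF_conj.
  by rewrite !mulr0n rmorph0.
exists (U ^t* *m D); last first.
  rewrite ctM trmxCK DC !mulmxA -[_ *m D *m D]mulmxA LE; congr (_ *m _ *m _).
  rewrite /D mulmx_diag; congr diag_mx; apply/rowP => i; rewrite !mxE -rmorphM.
  by rewrite -expr2 sqr_sqrtr // ltW.
rewrite unitmx_mul; apply/andP; split.
  by rewrite map_unitmx unitmx_tr unitarymx_unit.
rewrite unitmxE det_diag unitfE prodf_seq_neq0; apply/allP => i _ /=.
by rewrite mxE -absF_eq0 absF_rc normr_eq0 gt_eqF // sqrtr_gt0.
Qed.

(** The substitution of G^-* Y for Y turns the form of L into the standard norm. Scaling B by all t
    with c t < 1 converts the bounds, which are not strict, into the strict positivity compared by
    [same_ball]. *)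
Lemma same_ball_transfer k (L A1 A2 M1 M2 G : 'M[C]_k) : G \in unitmx ->
  L = G *m G ^t* -> same_ball L A1 A2 M1 M2 ->
  let T M := invmx G *m M *m (invmx G) ^t* in
  forall p q (B1 B2 : 'M[C]_(p, q)) c, 0 <= c ->
    bounded_by A1 A2 B1 B2 c <-> bounded_by (T M1) (T M2) B1 B2 c.
Proof.
move=> hG LE sb T p q B1 B2 c c0.
pose Gi := invmx G.
have hGi : Gi \in unitmx by rewrite unitmx_inv.
have hGc : Gi ^t* \in unitmx by rewrite map_unitmx unitmx_tr.
have LG n (Y : 'M[C]_(k, n)) : ip (Gi ^t* *m Y) (L *m (Gi ^t* *m Y)) = nn Y.
  rewrite ip_mull trmxCK LE !mulmxA mulVmx // mul1mx.
  by rewrite -ctM mulVmx // ct1 mul1mx.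
have formT Y Z : bform (T M1) (T M2) B1 B2 Y Z = bform M1 M2 B1 B2 (Gi ^t* *m Y) (Gi ^t* *m Z).
  by rewrite /bform /T -/Gi !ip_mull !trmxCK !mulmxA.
have nz m n (Y : 'M[C]_(k, m)) (Z : 'M[C]_(k, n)) :
    (Y != 0) || (Z != 0) = (0 < nn Y + nn Z).
  have [->|Y0] /= := eqVneq Y 0; first by rewrite nn0 add0r nn_gt0.
  by rewrite ltr_pwDl ?nn_gt0 ?nn_ge0.
have formN A A' (Y : 'M[C]_(k, p)) Z : bform A A' B1 B2 (- Y) Z = - bform A A' B1 B2 Y Z.
  by rewrite /bform !ipNl opprD.
(* both bounds are characterized by strict positivity after scaling *)
have char (K : 'M[C]_k) (J1 J2 : 'M[C]_k) :
    bounded_by J1 J2 B1 B2 c <-> forall t : R, 0 < t -> c * t < 1 ->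
     forall (Y : 'M[C]_(k, p)) (Z : 'M[C]_(k, q)), (Y != 0) || (Z != 0) ->
       0 < nn Y + nn Z + 2 * bform J1 J2 (rcF t *: B1) (rcF t *: B2) Y Z.
  have fZ t Y Z : bform J1 J2 (rcF t *: B1) (rcF t *: B2) Y Z = t * bform J1 J2 B1 B2 Y Z.
    by rewrite /bform !ctZ !rcF_conj -!scalemxAr !ipZr mulrDr.
  split=> h.
    move=> t t0 ct Y Z; rewrite nz fZ => p0.
    have := h (- Y) Z; rewrite formN nnN; move: p0 (bform _ _ _ _ _ _) => p0 f hf.
    have : - (2 * (t * f)) <= c * t * (nn Y + nn Z) by nra.
    have : c * t * (nn Y + nn Z) < nn Y + nn Z by rewrite gtr_pMl.
    lra.
  move=> X Y; have [|] := boolP ((X != 0) || (Y != 0)); last first.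
    rewrite negb_or !negbK => /andP[/eqP -> /eqP ->].
    by rewrite /bform !mulmx0 !mul0mx !ip0r !nn0 !addr0 !mulr0.
  move=> XY0; have XY := XY0; rewrite nz in XY0.
  apply/ler_addgt0Pr => e e0.
  (* At t = 1 / c' strict positivity gives the bound with c' n0 = c n0 + e, and e is arbitrary. *)
  pose n0 := nn X + nn Y; pose c' := c + e / n0.
  have en : 0 < e / n0 by rewrite divr_gt0.
  have c'0 : 0 < c' by rewrite /c'; lra.
  have := h c'^-1; rewrite invr_gt0 => /(_ c'0).
  rewrite ltr_pdivrMr // mul1r /c' ltrDl => /(_ en) /(_ (- X) Y).
  rewrite oppr_eq0 => /(_ XY); rewrite fZ formN nnN -/c' -/n0 => hh.
  have : 2 * bform J1 J2 B1 B2 X Y < c' * n0.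
    by rewrite -ltr_pdivrMl //; move: hh; lra.
  have -> : c' * n0 = c * n0 + e by rewrite /c' (mulrDl c) divfK // gt_eqF.
  rewrite -/n0; lra.
rewrite (char 0) (char 0).
split=> h t t0 ct Y Z YZ.
  have [/(_ (h t t0 ct))H _] := sb _ _ (rcF t *: B1) (rcF t *: B2).
  have fT : bform (T M1) (T M2) (rcF t *: B1) (rcF t *: B2) Y Z =
     bform M1 M2 (rcF t *: B1) (rcF t *: B2) (Gi ^t* *m Y) (Gi ^t* *m Z).
    by rewrite /bform /T -/Gi !ip_mull !trmxCK !mulmxA.
  rewrite fT -(LG _ Y) -(LG _ Z); apply: H.
  have inj n (X : 'M[C]_(k, n)) : (Gi ^t* *m X == 0) = (X == 0).
    apply/eqP/eqP => [e|->]; last by rewrite mulmx0.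
    by rewrite -[X](mulKmx hGc) e mulmx0.
  by rewrite !inj.
have [_ H] := sb _ _ (rcF t *: B1) (rcF t *: B2); apply: (H _ Y Z YZ) => {YZ}.
move=> {}Y {}Z YZ.
have fT : bform M1 M2 (rcF t *: B1) (rcF t *: B2) Y Z =
    bform (T M1) (T M2) (rcF t *: B1) (rcF t *: B2) (G ^t* *m Y) (G ^t* *m Z).
  rewrite /bform /T -/Gi !ip_mull !trmxCK !mulmxA mulmxV // !mul1mx.
  by rewrite -![_ *m Gi ^t* *m G ^t*]mulmxA -ctM mulmxV // ct1 !mulmx1.
have LG' n (X : 'M[C]_(k, n)) : ip X (L *m X) = nn (G ^t* *m X).
  by rewrite LE /nn ip_mull trmxCK mulmxA.
rewrite fT !LG'; apply: h => //.
have hGt : G ^t* \in unitmx by rewrite map_unitmx unitmx_tr.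
have inj n (X : 'M[C]_(k, n)) : (G ^t* *m X == 0) = (X == 0).
  apply/eqP/eqP => [e|->]; last by rewrite mulmx0.
  by rewrite -[X](mulKmx hGt) e mulmx0.
by rewrite !inj.
Qed.
End Transfer.

(** * The row pencil as a direct summand *)

Section Summand.
Variables (R : realType) (C : complexOver R) (s : nat) (C1 C2 : 'M[C]_s).
Local Notation k := (s + ((s + s) + s))%N.
Local Notation N1 := (N1 C1 C2).
Local Notation N2 := (N2 C1 C2).
Local Notation r1 := (row_mx C1 (0 : 'M[C]_s)).
Local Notation r2 := (row_mx (0 : 'M[C]_s) C2).
Local Notation c1 := (col_mx (0 : 'M[C]_s) C1).
Local Notation c2 := (col_mx C2 (0 : 'M[C]_s)).

(* Absence of nontrivial reducing subspaces. *)
Definition irreducible_pair n (E1 E2 : 'M[C]_n) := forall B : 'M[C]_n, B ^t* = B ->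
  B *m E1 = E1 *m B -> B *m E2 = E2 *m B -> exists a, B = a%:M.

Lemma N1_col3 n (Y0 : 'M[C]_(s, n)) (Y1 : 'M[C]_(s + s, n)) (Y2 : 'M[C]_(s, n)) :
  N1 *m col_mx Y0 (col_mx Y1 Y2) = col_mx (r1 *m Y1) (col_mx (c1 *m Y2) 0).
Proof. by rewrite /N1 Lam_col /rmx /cmx /= !scale1r !scale0r. Qed.

Lemma N2_col3 n (Y0 : 'M[C]_(s, n)) (Y1 : 'M[C]_(s + s, n)) (Y2 : 'M[C]_(s, n)) :
  N2 *m col_mx Y0 (col_mx Y1 Y2) = col_mx (r2 *m Y1) (col_mx (c2 *m Y2) 0).
Proof. by rewrite /N2 Lam_col /rmx /cmx /= !scale1r !scale0r. Qed.

Lemma bform_N p q (B1 B2 : 'M[C]_(p, q)) X0 X1 X2 Y0 Y1 Y2 :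
  bform N1 N2 B1 B2 (col_mx X0 (col_mx X1 X2)) (col_mx Y0 (col_mx Y1 Y2)) =
  bform r1 r2 B1 B2 X0 Y1 + bform c1 c2 B1 B2 X1 Y2.
Proof.
rewrite /bform N1_col3 N2_col3 !mul_col_mx !mul0mx !ip_col !ip0r.
by ring.
Qed.

(** The row and the column pencil act between orthogonal blocks, so the norm of the whole is the
    larger of the two. *)
Lemma bounded_by_N p q (B1 B2 : 'M[C]_(p, q)) (c : R) : 0 <= c ->
  bounded_by r1 r2 B1 B2 c -> bounded_by c1 c2 B1 B2 c -> bounded_by N1 N2 B1 B2 c.
Proof.
move=> c0 hr hc X Y; rewrite -(vsubmxK X) -(vsubmxK Y).
rewrite -(vsubmxK (dsubmx X)) -(vsubmxK (dsubmx Y)) bform_N !nn_col mulrDr.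
set X0 := usubmx X; set X1 := usubmx (dsubmx X); set X2 := dsubmx (dsubmx X).
set Y0 := usubmx Y; set Y1 := usubmx (dsubmx Y); set Y2 := dsubmx (dsubmx Y).
have := hr X0 Y1; have := hc X1 Y2.
have := nn_ge0 X2; have := nn_ge0 Y0 => y0 x2 h1 h2.
have := mulr_ge0 c0 y0; have := mulr_ge0 c0 x2; lra.
Qed.

Lemma bounded_by_r p q (B1 B2 : 'M[C]_(p, q)) (c : R) :
  bounded_by N1 N2 B1 B2 c -> bounded_by r1 r2 B1 B2 c.
Proof.
move=> h X Y; have := h (col_mx X (col_mx 0 0)) (col_mx 0 (col_mx Y 0)).
rewrite bform_N !nn_col !nn0 !addr0 !add0r.
by rewrite {2}/bform !mulmx0 !mul0mx !ip0r !addr0.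
Qed.

Hypotheses (s0 : (0 < s)%N) (hC1 : C1 \in unitmx) (hC2 : C2 \in unitmx).

Lemma optimal_r_gt0 (c : R) : bounded_by r1 r2 r1 r2 c -> 0 < c.
Proof.
move=> h; have ss0 : (0 < s + s)%N by rewrite addn_gt0 s0.
have c0 := bounded_by_ge0 s0 s0 h.
rewrite lt_neqAle c0 andbT; apply/eqP => e; rewrite -e in h.
have := h (r1 *m r1 ^t* + r2 *m r2 ^t*) 1%:M.
rewrite mul0r /bform !mulmx1 -ipDr -/(nn _) => nE.
have := nn_ge0 (r1 *m r1 ^t* + r2 *m r2 ^t*) => g.
have /eqP : nn (r1 *m r1 ^t* + r2 *m r2 ^t*) = 0 by lra.
rewrite nn_eq0 => /eqP z.
have : reF (\tr (r1 *m r1 ^t* + r2 *m r2 ^t*)) = 0 by rewrite z mxtrace0 raddf0.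
have trE m n (A : 'M[C]_(m, n)) : reF (\tr (A *m A ^t*)) = nn A.
  by rewrite /nn ip.unlock mxtrace_mulC.
rewrite mxtraceD raddfD /= !trE !nn_row !nn0.
have := nn_ge0 C1; have := nn_ge0 C2 => g2 g1 e2.
have /eqP : nn C1 = 0 by lra.
rewrite nn_eq0 => /eqP C10; move: hC1; rewrite C10 -(ltn_predK s0) unitr0 //.
Qed.

Hypothesis irrE : irreducible_pair (C1 *m C1 ^t*) (C2 *m C2 ^t*).

(** A Perron-Frobenius argument. Eliminating Q leaves E1 P E1 + E2 P E2 = c^2 P with P = w w^* and
    E_j = C_j C_j^*. The kernel of such a P reduces E1 and E2, so it is zero by irreducibility. *)
Lemma r_irreducible (c : R) (w : 'M[C]_s) (y : 'M[C]_(s + s)) : 0 < c ->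
  0 < nn (w *m w ^t*) + nn (y *m y ^t*) ->
  r1 *m (y *m y ^t*) *m r1 ^t* + r2 *m (y *m y ^t*) *m r2 ^t* = rcF c *: (w *m w ^t*) ->
  r1 ^t* *m (w *m w ^t*) *m r1 + r2 ^t* *m (w *m w ^t*) *m r2 = rcF c *: (y *m y ^t*) ->
  w \in unitmx /\ y \in unitmx.
Proof.
set P := w *m w ^t*; set Q := y *m y ^t*; move=> c0 pos eP eQ.
have rc0 : rcF c != 0 :> C by rewrite -absF_eq0 absF_rc normr_eq0 gt_eqF.
have PC : P ^t* = P by rewrite /P ctM trmxCK.
have QE : rcF c *: Q = block_mx (C1 ^t* *m P *m C1) 0 0 (C2 ^t* *m P *m C2).
  rewrite -eQ !ct_row !ct0 !(mul_col_mx _ _ P) !mul0mx !mul_col_row !mulmx0 !mul0mx.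
  by rewrite add_block_mx !addr0 !add0r.
have PE : C1 *m C1 ^t* *m P *m (C1 *m C1 ^t*) + C2 *m C2 ^t* *m P *m (C2 *m C2 ^t*)
    = (rcF c * rcF c) *: P.
  have h (r : 'M[C]_(s, s + s)) :
      rcF c *: (r *m Q *m r ^t*) = r *m (rcF c *: Q) *m r ^t*.
    by rewrite -scalemxAr -scalemxAl.
  rewrite -scalerA -eP scalerDr !h QE.
  rewrite !mul_row_block !mulmx0 !mul0mx !ct_row !ct0 !mul_row_col !mulmx0.
  by rewrite !(addr0, add0r, mul0mx, mulmx0) !mulmxA.
have P0 : P != 0.
  apply/eqP => e; move: QE; rewrite e !mulmx0 !mul0mx block_mx0 => /eqP.
  rewrite scaler_eq0 (negbTE rc0) /= => /eqP e2.
  by move: pos; rewrite e e2 !nn0 addr0 ltxx.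
have [U [d [hU PU]]] := herm_spectral PC.
have UU := unitarymxP hU.
have UU' : U ^t* *m U = 1%:M by apply: mulmx1C.
pose dg (f : 'I_s -> C) : 'M[C]_s := U ^t* *m diag_mx (\row_i f i) *m U.
have dgM f g : dg f *m dg g = dg (fun i => f i * g i).
  rewrite /dg !mulmxA -[_ *m U *m U ^t*]mulmxA UU mulmx1 -[_ *m diag_mx _ *m diag_mx _]mulmxA.
  by rewrite mulmx_diag; congr (_ *m diag_mx _ *m _); apply/rowP => i; rewrite !mxE.
have dgD f g : dg f + dg g = dg (fun i => f i + g i).
  rewrite /dg -mulmxDl -mulmxDr -raddfD; congr (_ *m diag_mx _ *m _).
  by apply/rowP => i; rewrite !mxE.
have dg_eq f g : (forall i, f i = g i) -> dg f = dg g.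
  by move=> h; congr (_ *m diag_mx _ *m _); apply/rowP => i; rewrite !mxE h.
have dg1 : dg (fun=> 1) = 1%:M.
  rewrite /dg (_ : diag_mx _ = 1%:M) ?mulmx1 //.
  by apply/matrixP => i j; rewrite !mxE.
have dg0 : dg (fun=> 0) = 0.
  rewrite /dg (_ : diag_mx _ = 0) ?mulmx0 ?mul0mx //.
  by apply/matrixP => i j; rewrite !mxE mul0rn.
(* The projection onto the kernel of P, and the pseudo-inverse of P, which uses that the inverse of
   0 is 0. *)
pose Pi := dg (fun i => (d i == 0)%:R); pose Pp := dg (fun i => (rcF (d i))^-1).
have PiC : Pi ^t* = Pi.
  rewrite /Pi /dg !ctM trmxCK mulmxA; congr (_ *m _ *m _).
  apply/matrixP => i j; rewrite !mxE [i == j]eq_sym; case: (eqVneq j i) => [->|_].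
    by rewrite !mulr1n rmorph_nat.
  by rewrite !mulr0n rmorph0.
have PPi : P *m Pi = 0.
  rewrite PU -/(dg (fun i => rcF (d i))) dgM -dg0; apply: dg_eq => i.
  by have [->|] := eqVneq (d i) 0; rewrite ?rmorph0 ?mul0r ?mulr0.
have PpP : Pp *m P = 1%:M - Pi.
  apply/eqP; rewrite eq_sym subr_eq eq_sym; apply/eqP.
  rewrite PU -/(dg (fun i => rcF (d i))) dgM dgD -dg1; apply: dg_eq => i.
  have [->|di] := eqVneq (d i) 0; first by rewrite rmorph0 mulr0 add0r.
  by rewrite mulVf ?addr0 // -absF_eq0 absF_rc normr_eq0.
clearbody Pi Pp.
have wPi (E1 E2 : 'M[C]_s) : E1 ^t* = E1 -> E2 ^t* = E2 ->
    E1 *m P *m E1 + E2 *m P *m E2 = (rcF c * rcF c) *: P ->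
    Pi *m E1 = E1 *m Pi /\ Pi *m E2 = E2 *m Pi.
  move=> h1 h2 hE.
  (* Compressing the equation to the kernel of P annihilates a sum of two positive terms. Hence E1
     and E2 map the kernel into itself and, being hermitian, commute with [Pi]. *)
  have z : nn (w ^t* *m E1 *m Pi) + nn (w ^t* *m E2 *m Pi) = 0.
    have h E : E ^t* = E -> nn (w ^t* *m E *m Pi) = reF (\tr (Pi *m (E *m P *m E) *m Pi)).
      by move=> hE'; rewrite /nn ip.unlock !ctM PiC hE' trmxCK /P !mulmxA.
    rewrite !h // -raddfD -mxtraceD -mulmxDl -mulmxDr hE -scalemxAr -scalemxAl.
    by rewrite -mulmxA PPi mulmx0 scaler0 mxtrace0 raddf0.
  have one E : E ^t* = E -> nn (w ^t* *m E *m Pi) = 0 -> Pi *m E = E *m Pi.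
    move=> hE' /eqP; rewrite nn_eq0 => /eqP e.
    have : Pp *m (w *m (w ^t* *m E *m Pi)) = 0 by rewrite e !mulmx0.
    rewrite !mulmxA -[Pp *m w *m _]mulmxA -/P PpP !mulmxBl mul1mx => /eqP.
    rewrite subr_eq0 => /eqP e2; rewrite e2.
    have := congr1 (fun M => M ^t*) e2; by rewrite /= !ctM PiC hE' mulmxA.
  have := nn_ge0 (w ^t* *m E1 *m Pi); have := nn_ge0 (w ^t* *m E2 *m Pi) => g2 g1.
  split; apply: one => //; lra.
have [a aE] : exists a, Pi = a%:M.
  have EC (A : 'M[C]_s) : (A *m A ^t*) ^t* = A *m A ^t* by rewrite ctM trmxCK.
  by have [e1 e2] := wPi _ _ (EC C1) (EC C2) PE; apply: irrE.
have a0 : a = 0.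
  move: PPi; rewrite aE mul_mx_scalar => /eqP.
  by rewrite scaler_eq0 (negbTE P0) orbF => /eqP.
have Punit : P \in unitmx.
  move: PpP; rewrite aE a0 raddf0 subr0 => /mulmx1_unit[] //.
have Qunit : Q \in unitmx.
  have : rcF c *: Q \in unitmx.
    have u (A : 'M[C]_s) : A \in unitmx -> A ^t* *m P *m A \in unitmx.
      by move=> hA; rewrite unitmx_mul (unitmx_mul _ P) Punit hA map_unitmx unitmx_tr hA.
    by rewrite QE unitmxE det_ublock unitrM -!unitmxE !u.
  by rewrite unitmxZ // unitfE.
by move: Punit Qunit; rewrite !unitmx_mul => /andP[] -> _ /andP[] -> _.
Qed.

(* By [rigidity] the row pencil r is a direct summand of the pencil of T_j = G^-1 M_j G^-*,
   where L = G G^*; V and S are the inclusions of that summand. *)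
Lemma summand_relations (L M1 M2 : 'M[C]_k) c X Y : L ^t* = L -> pd L ->
  same_ball L N1 N2 M1 M2 ->
  bounded_by r1 r2 r1 r2 c -> attains r1 r2 r1 r2 c X Y -> 0 < nn X + nn Y ->
  bounded_by c1 c2 c1 c2 c ->
  exists (V : 'M[C]_(k, s + s)) (S : 'M[C]_(k, s)),
    [/\ V ^t* *m L *m V = 1%:M, S ^t* *m L *m S = 1%:M,
        M1 *m V = L *m S *m r1 /\ M2 *m V = L *m S *m r2 &
        M1 ^t* *m S = L *m V *m r1 ^t* /\ M2 ^t* *m S = L *m V *m r2 ^t*].
Proof.
move=> LC pL sb rr arr XY cc.
have ss0 : (0 < s + s)%N by rewrite addn_gt0 s0.
have k0 : (0 < k)%N by rewrite addn_gt0 s0.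
have c0 := optimal_r_gt0 rr; have c0' := ltW c0.
have [G hG LE] := pd_factor LC pL.
have tr := same_ball_transfer hG LE sb.
set T := (fun M => _) in tr; cbv zeta in tr.
have rc : bounded_by r1 r2 c1 c2 c by apply: bounded_by_mixed.
have cr := bounded_by_sym rc.
have Nr : bounded_by N1 N2 r1 r2 c by apply: bounded_by_N.
have Nc : bounded_by N1 N2 c1 c2 c by apply: bounded_by_N.
have NN : bounded_by N1 N2 N1 N2 c.
  by apply: bounded_by_N => //; apply: bounded_by_sym.
have Tr : bounded_by (T M1) (T M2) r1 r2 c by apply/(tr _ _ r1 r2 c c0').
(* Against r the transferred pencil has the same optimal constant c, because r is a block of the
   pencil at 0 and attains c against itself. *)
have [c' [Tr' [X' [Y' [XY' aTr]]]]] := optimal_bound (T M1) (T M2) r1 r2 k0 s0.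
have c'E : c' = c.
  apply/eqP; rewrite eq_le (bounded_by_attained Tr aTr XY') /=.
  apply: (bounded_by_attained _ arr XY); apply: bounded_by_r.
  by apply/(tr _ _ r1 r2 c') => //; apply: (bounded_by_ge0 k0 s0 Tr').
have TT : bounded_by (T M1) (T M2) (T M1) (T M2) c.
  have [t [TTt [X2 [Y2 [XY2 aTT]]]]] := optimal_bound (T M1) (T M2) (T M1) (T M2) k0 k0.
  have [tc|ct] := leP t c; first exact: bounded_by_le TTt.
  (* If T attained t > c against itself, Cauchy-Schwarz with N would bound N against T by sqrt(c t),
     hence, by transfer, T against T by sqrt(c t) < t. *)
  exfalso; pose kap := Num.sqrt (t / c).
  have t0 : 0 < t by apply: lt_trans ct.
  have tc0 : 0 < t / c by rewrite divr_gt0.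
  have kap0 : 0 < kap by rewrite sqrtr_gt0.
  have kap2 : kap * kap = t / c by rewrite -expr2 sqr_sqrtr // ltW.
  have NNt : bounded_by (rcF kap *: N1) (rcF kap *: N2) (rcF kap *: N1) (rcF kap *: N2) t.
    apply/bounded_byZ => //; apply/bounded_byZr => //.
    rewrite -mulrA -invfM kap2 invf_div mulrCA divff ?mulr1 // gt_eqF //.
  have := bounded_by_mixed NNt TTt => /(bounded_byZ _ _ _ _ _ kap0).
  move=> /(tr _ _ (T M1) (T M2) _ (ltW (divr_gt0 t0 kap0))) h.
  have := bounded_by_attained h aTT XY2; rewrite ler_pdivlMr //.
  rewrite ger_pMr // => k1.
  have : kap * kap <= 1 by rewrite -[leRHS]mul1r ler_pM // ltW.
  by rewrite kap2 ler_pdivrMr // mul1r leNgt ct.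
rewrite c'E in aTr.
have [W [W' [WW WW' [T1 T2] [T3 T4]]]] :=
  rigidity TT rr aTr XY' (fun w y => @r_irreducible c w y c0).
have hGt : G ^t* \in unitmx by rewrite map_unitmx unitmx_tr.
pose Gt := (invmx G) ^t*.
have GtG : G ^t* *m Gt = 1%:M by rewrite /Gt -ctM mulVmx // ct1.
have GGt : Gt *m G ^t* = 1%:M by rewrite /Gt -ctM mulmxV // ct1.
have GtC : Gt ^t* = invmx G by rewrite /Gt trmxCK.
have TG M : G *m (T M) *m G ^t* = M.
  by rewrite /T -/Gt !mulmxA mulmxV // mul1mx -mulmxA GGt mulmx1.
have TGc M : G *m (T M) ^t* *m G ^t* = M ^t*.
  have h (Z : 'M[C]_k) : G *m Z ^t* *m G ^t* = (G *m Z *m G ^t*) ^t*.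
    by rewrite !ctM trmxCK mulmxA.
  by rewrite h TG.
clearbody T Gt.
exists (Gt *m W'), (Gt *m W); rewrite LE; split.
- rewrite ctM GtC !mulmxA -[W' ^t* *m _ *m G]mulmxA mulVmx // mulmx1.
  by rewrite -[W' ^t* *m _ *m _]mulmxA GtG mulmx1.
- rewrite ctM GtC !mulmxA -[W ^t* *m _ *m G]mulmxA mulVmx // mulmx1.
  by rewrite -[W ^t* *m _ *m _]mulmxA GtG mulmx1.
- have h M r : T M *m W' = W *m r -> M *m (Gt *m W') = G *m G ^t* *m (Gt *m W) *m r.
    move=> e; rewrite -[in LHS](TG M) !mulmxA -[_ *m G ^t* *m Gt]mulmxA GtG mulmx1.
    by rewrite -[_ *m G ^t* *m Gt]mulmxA GtG mulmx1 -!mulmxA e.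
  by split; apply: h.
- have h M r : (T M) ^t* *m W = W' *m r ^t* ->
      M ^t* *m (Gt *m W) = G *m G ^t* *m (Gt *m W') *m r ^t*.
    move=> e; rewrite -[in LHS](TGc M) !mulmxA -[_ *m G ^t* *m Gt]mulmxA GtG mulmx1.
    by rewrite -[_ *m G ^t* *m Gt]mulmxA GtG mulmx1 -!mulmxA e.
  by split; apply: h.
Qed.
End Summand.

(** * Consequences of a summand *)

Section CoreRelations.
Variables (R : realType) (C : complexOver R) (s : nat) (C1 C2 : 'M[C]_s).
Local Notation k := (s + ((s + s) + s))%N.
Local Notation Lam := (Lam C1 C2).
Local Notation Lb := (Lb C1 C2).
Local Notation rmx := (rmx C1 C2).
Local Notation cmx := (cmx C1 C2).
Local Notation r1 := (row_mx C1 (0 : 'M[C]_s)).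
Local Notation r2 := (row_mx (0 : 'M[C]_s) C2).

Lemma rmxD (a a' : C) (x y : C * C) :
  rmx (a * x.1 + a' * y.1, a * x.2 + a' * y.2) = a *: rmx x + a' *: rmx y.
Proof. by rewrite /rmx /= !scale_row_mx add_row_mx !scalerA -!scalerDl. Qed.

Lemma cmxD (a a' : C) (x y : C * C) :
  cmx (a * x.1 + a' * y.1, a * x.2 + a' * y.2) = a *: cmx x + a' *: cmx y.
Proof. by rewrite /cmx /= !scale_col_mx add_col_mx !scalerA -!scalerDl. Qed.

Lemma Lam_adj_col n h (Y0 : 'M[C]_(s, n)) (Y1 : 'M[C]_(s + s, n)) (Y2 : 'M[C]_(s, n)) :
  (Lam h) ^t* *m col_mx Y0 (col_mx Y1 Y2)
   = col_mx 0 (col_mx ((rmx h) ^t* *m Y0) ((cmx h) ^t* *m Y1)).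
Proof.
rewrite Lam.unlock !ct_block !ct_row !ct_col !ct0 -/(rmx h) -/(cmx h).
rewrite mul_block_col !mul0mx addr0 mul_col_mx mul0mx mul_block_col !mul0mx !addr0.
by rewrite add_col_mx !(addr0, add0r) -!ct_col -!ct_row -/(rmx h) -/(cmx h).
Qed.

Lemma Lb_col n b (Y0 : 'M[C]_(s, n)) (Y1 : 'M[C]_(s + s, n)) (Y2 : 'M[C]_(s, n)) :
  Lb b *m col_mx Y0 (col_mx Y1 Y2) =
  col_mx (Y0 + rmx b *m Y1)
    (col_mx ((rmx b) ^t* *m Y0 + Y1 + cmx b *m Y2) ((cmx b) ^t* *m Y1 + Y2)).
Proof.
rewrite /Lb !mulmxDl mul1mx Lam_col Lam_adj_col !add_col_mx !addr0.
congr (col_mx _ (col_mx _ _)); last by rewrite addrC.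
by rewrite addrC addrA.
Qed.

Lemma Lb_adj b : (Lb b) ^t* = Lb b.
Proof. by rewrite /Lb !ctD ct1 trmxCK addrAC. Qed.

Section PositiveDefinite.
Variables (b : C * C) (pL : pd (Lb b)).

(** Schur complements: for a given outer block, the middle block is chosen to complete the square in
    the form of [Lb b]. *)
Lemma pd_contraction n (Y0 : 'M[C]_(s, n)) : Y0 != 0 ->
  nn ((rmx b) ^t* *m Y0) < nn Y0 /\ nn (cmx b *m Y0) < nn Y0.
Proof.
move=> Y0n; split; rewrite -subr_gt0.
  have := @pd_mx _ _ _ _ n (col_mx Y0 (col_mx (- ((rmx b) ^t* *m Y0)) 0)) pL.
  rewrite !col_mx_eq0 (negbTE Y0n) => /(_ isT).
  rewrite Lb_col !ip_col ip0l mulmx0 !addr0 mulmxN subrr ip0r addr0 ipBr -/(nn _).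
  by rewrite [nn (_ *m _)]/nn ip_mull trmxCK.
have := @pd_mx _ _ _ _ n (col_mx 0 (col_mx (- (cmx b *m Y0)) Y0)) pL.
rewrite !col_mx_eq0 (negbTE Y0n) !andbF => /(_ isT).
rewrite Lb_col !ip_col ip0l add0r mulmx0 add0r addrC addNr ip0r addr0 addrC.
by rewrite [nn (_ *m _)]/nn mulmxN ipDr ipNr ip_mull.
Qed.

Lemma pd_contraction_c n (Y1 : 'M[C]_(s + s, n)) : Y1 != 0 -> nn ((cmx b) ^t* *m Y1) < nn Y1.
Proof.
move=> Y1n; rewrite -subr_gt0.
have := @pd_mx _ _ _ _ n (col_mx 0 (col_mx Y1 (- ((cmx b) ^t* *m Y1)))) pL.
rewrite !col_mx_eq0 (negbTE Y1n) !andbF => /(_ isT).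
rewrite Lb_col !ip_col ip0l add0r subrr ip0r addr0 mulmx0 add0r mulmxN ipBr -/(nn _).
by rewrite [nn (_ *m _)]/nn ip_mull trmxCK.
Qed.
End PositiveDefinite.

Hypotheses (hC1 : C1 \in unitmx) (hC2 : C2 \in unitmx).

(* Read in blocks, the relations leave two nonzero blocks in V and one in K = L S, and
   W = V1 V1^* = (1 - r^* r)^-1.  The relation at b is the Sylvester equation
   2 Z = Z r r^* + c^* c Z for Z = (r c)^*, so that r c = 0 since r and c are contractions. *)
Lemma core_relations (b u v : C * C) (V : 'M[C]_(k, s + s)) (S : 'M[C]_(k, s)) :
  pd (Lb b) -> u != 0 -> v != 0 -> u.1 * v.2 - v.1 * u.2 != 0 ->
  V ^t* *m Lb b *m V = 1%:M -> S ^t* *m Lb b *m S = 1%:M ->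
  Lam u *m V = Lb b *m S *m r1 -> Lam v *m V = Lb b *m S *m r2 ->
  (Lam u) ^t* *m S = Lb b *m V *m r1 ^t* -> (Lam v) ^t* *m S = Lb b *m V *m r2 ^t* ->
  exists (K : 'M[C]_s) (W : 'M[C]_(s + s)),
  [/\ K \in unitmx /\ K *m K ^t* = 1%:M - rmx b *m (rmx b) ^t*,
      (1%:M - (rmx b) ^t* *m rmx b) *m W = 1%:M,
      (forall h h', K *m (rmx h *m (rmx h') ^t*) *m K ^t* =
        rmx (h.1 * u.1 + h.2 * v.1, h.1 * u.2 + h.2 * v.2) *m W *m
        (rmx (h'.1 * u.1 + h'.2 * v.1, h'.1 * u.2 + h'.2 * v.2)) ^t*)
    & b != 0 -> C1 *m C2 + C2 *m C1 = 0].
Proof.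
move=> pL u0 v0 uv.
rewrite -(vsubmxK V) -(vsubmxK (dsubmx V)) -(vsubmxK S) -(vsubmxK (dsubmx S)).
move: (usubmx V) (usubmx (dsubmx V)) (dsubmx (dsubmx V)) => V0 V1 V2.
move: (usubmx S) (usubmx (dsubmx S)) (dsubmx (dsubmx S)) => S0 S1 S2.
rewrite -!(mulmxA _ (Lb b)) !Lb_col !Lam_col !Lam_adj_col.
have [cu cuE] : exists cu, cu = cmx u by exists (cmx u).
have [cv cvE] : exists cv, cv = cmx v by exists (cmx v).
have [c cE] : exists c, c = cmx b by exists (cmx b).
rewrite -!cuE -!cvE -!cE !mul_col_mx; set r := rmx b.
(* K_i and J_i are the blocks of [Lb b *m S] and [Lb b *m V]. *)
set K0 := S0 + _; set K1 := _ + c *m S2; set K2 := _ + S2.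
set J0 := V0 + _; set J1 := _ + c *m V2; set J2 := _ + V2.
move=> hV hS /eq_col_mx[eu0] /eq_col_mx[eu1 eu2] /eq_col_mx[ev0] /eq_col_mx[ev1 ev2].
move=> /eq_col_mx[fu0] /eq_col_mx[fu1 fu2] /eq_col_mx[fv0] /eq_col_mx[fv1 fv2].
have r_inj m (A : 'M[C]_(m, s)) : A *m r1 = 0 -> A = 0.
  by rewrite mul_mx_row mulmx0 => /eqP; rewrite row_mx_eq0 => /andP[/eqP e _];
     rewrite -[A](mulmxK hC1) e mul0mx.
have ctu (A : 'M[C]_s) : A \in unitmx -> A ^t* \in unitmx.
  by rewrite map_unitmx unitmx_tr.
have K20 : K2 = 0 by apply: r_inj.
(* c(u) V2 = K1 r1 has zero right half and c(v) V2 = K1 r2 has zero left half, while c(e) is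
   injective for e <> 0. *)
have V20 : V2 = 0.
  move: eu1 ev1; rewrite -(hsubmxK V2) !mul_mx_row !mulmx0.
  move=> /eq_row_mx[_ e1] /eq_row_mx[e2 _].
  rewrite cuE cvE in e1 e2.
  have ci (e : C * C) (A : 'M[C]_s) : e != 0 -> cmx e *m A = 0 -> A = 0.
    rewrite /cmx mul_col_mx -!scalemxAl => e0 /eqP.
    rewrite col_mx_eq0 => /andP[/eqP z2 /eqP z1].
    have [e20|e20] := eqVneq e.2 0.
      have e10 : e.1 != 0.
        by move: e0 e20; case: (e) => x y /= + ye; rewrite ye; apply: contraNneq => ->.
      move/eqP: z1; rewrite scaler_eq0 (negbTE e10) /= => /eqP z.
      by rewrite -[A](mulKmx hC1) z mulmx0.
    move/eqP: z2; rewrite scaler_eq0 (negbTE e20) /= => /eqP z.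
    by rewrite -[A](mulKmx hC2) z mulmx0.
  by rewrite (ci _ _ u0 e1) (ci _ _ v0 e2) row_mx0.
have K10 : K1 = 0 by apply: r_inj; rewrite -eu1 V20 mulmx0.
have J00 : J0 = 0.
  move: fu0 fv0; rewrite -(hsubmxK J0) !ct_row !ct0 !mul_row_col !mulmx0 add0r addr0.
  move=> /esym e1 /esym e2.
  by rewrite -[lsubmx J0](mulmxK (ctu _ hC1)) e1 -[rsubmx J0](mulmxK (ctu _ hC2)) e2 !mul0mx row_mx0.
have SK : S0 ^t* *m K0 = 1%:M.
  by move: hS; rewrite !ct_col K10 K20 !mul_row_col !mulmx0 !addr0.
have KS : K0 ^t* *m S0 = 1%:M by rewrite -[S0]trmxCK -ctM SK ct1.
have SK' : S0 *m K0 ^t* = 1%:M by apply: mulmx1C.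
have VJ : V1 ^t* *m J1 = 1%:M.
  by move: hV; rewrite !ct_col J00 V20 !mul_row_col ct0 mulmx0 mul0mx !addr0 add0r.
have J1E : J1 = (1%:M - r ^t* *m r) *m V1.
  have -> : J1 = r ^t* *m V0 + V1 by rewrite /J1 V20 mulmx0 addr0.
  have -> : V0 = - (r *m V1) by apply/eqP; rewrite -addr_eq0 -/J0 J00.
  by rewrite mulmxBl mul1mx mulmxN mulmxA addrC.
have J2E : J2 = c ^t* *m V1 by rewrite /J2 V20 addr0.
have [W Wdef] : exists W, W = V1 *m V1 ^t* by exists (V1 *m V1 ^t*).
have WE : (1%:M - r ^t* *m r) *m W = 1%:M.
  by rewrite Wdef mulmxA -J1E; apply: mulmx1C.
have WE' := mulmx1C WE.
have WC : W ^t* = W by rewrite Wdef ctM trmxCK.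
have rV (h : C * C) : rmx (h.1 * u.1 + h.2 * v.1, h.1 * u.2 + h.2 * v.2) *m V1 = K0 *m rmx h.
  rewrite rmxD mulmxDl -!scalemxAl eu0 ev0 !scalemxAr -mulmxDr; congr (_ *m _).
  by rewrite !scale_row_mx add_row_mx !scaler0 addr0 add0r.
have KD h h' : K0 *m (rmx h *m (rmx h') ^t*) *m K0 ^t* =
        rmx (h.1 * u.1 + h.2 * v.1, h.1 * u.2 + h.2 * v.2) *m W *m
        (rmx (h'.1 * u.1 + h'.2 * v.1, h'.1 * u.2 + h'.2 * v.2)) ^t*.
  by rewrite Wdef !mulmxA rV -!mulmxA -!ctM rV ctM.
(* T expresses the middle block of S through its top block. The vanishing of K1 and K2 gives T - c
   c^* T = - r^*, and once r c = 0 is known T is - r^* itself. *)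
have [T Tdef] : exists T, T = S1 *m K0 ^t* by exists (S1 *m K0 ^t*).
have S1E : S1 = T *m S0 by rewrite Tdef -mulmxA KS mulmx1.
have S2E : S2 = - (c ^t* *m S1) by apply/eqP; rewrite -addr_eq0 addrC -/K2 K20.
have TE : (1%:M - c *m c ^t*) *m T = - r ^t*.
  have : (1%:M - c *m c ^t*) *m S1 = - r ^t* *m S0.
    apply/eqP; rewrite mulNmx -addr_eq0 mulmxBl mul1mx -mulmxA addrC addrA.
    by rewrite -mulmxN -S2E -/K1 K10.
  rewrite S1E => e; rewrite -[T]mulmx1 -SK' !mulmxA -[_ *m T *m S0]mulmxA e.
  by rewrite -mulmxA SK' mulmx1.
have rel0 (e : C * C) (e' : 'M[C]_(s, s + s)) : rmx e *m V1 = K0 *m e' ->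
    (cmx e) ^t* *m S1 = J2 *m e' ^t* -> c ^t* *m W *m (rmx e) ^t* = (cmx e) ^t* *m T.
  move=> h1 h2; rewrite Tdef mulmxA h2 J2E Wdef -!mulmxA; congr (_ *m (_ *m _)).
  by rewrite -!ctM h1.
rewrite cuE in fu2; rewrite cvE in fv2.
have relu := rel0 _ _ eu0 fu2; have relv := rel0 _ _ ev0 fv2.
(* Both sides are conjugate-linear in h, so the basis u, v suffices; the coordinates of h come from
   Cramer's rule. *)
have rel (h : C * C) : c ^t* *m W *m (rmx h) ^t* = (cmx h) ^t* *m T.
  pose d := u.1 * v.2 - v.1 * u.2.
  have -> : h = ((h.1 * v.2 - h.2 * v.1) / d * u.1 + (h.2 * u.1 - h.1 * u.2) / d * v.1,
                 (h.1 * v.2 - h.2 * v.1) / d * u.2 + (h.2 * u.1 - h.1 * u.2) / d * v.2).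
    rewrite [h in LHS]surjective_pairing; congr pair; rewrite /d; field; exact: uv.
  rewrite rmxD cmxD !ctD !ctZ mulmxDr mulmxDl -!scalemxAl -!scalemxAr.
  by rewrite relu relv.
have aux (x y z : R) : z < x -> y < x -> x - y = - (x - z) -> False by lra.
have rc : r *m c = 0.
  have [Z ZE] : exists Z, Z = c ^t* *m r ^t* by exists (c ^t* *m r ^t*).
  have ZC : Z ^t* = r *m c by rewrite ZE ctM !trmxCK.
  (* Q is evaluated by both sides of [rel] at b: multiplied by 1 - r r^* on the right it gives Z, by
     1 - c^* c on the left it gives - Z. *)
  have [Q QE] : exists Q, Q = c ^t* *m W *m r ^t* by exists (c ^t* *m W *m r ^t*).
  have Qr : Q *m (1%:M - r *m r ^t*) = Z.
    have e : r ^t* *m (1%:M - r *m r ^t*) = (1%:M - r ^t* *m r) *m r ^t*.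
      by rewrite mulmxBl mulmxBr mul1mx mulmx1 mulmxA.
    by rewrite QE -!mulmxA e [W *m _]mulmxA WE' mul1mx.
  have cQ : (1%:M - c ^t* *m c) *m Q = - Z.
    have e : (1%:M - c ^t* *m c) *m c ^t* = c ^t* *m (1%:M - c *m c ^t*).
      by rewrite mulmxBl mulmxBr mul1mx mulmx1 mulmxA.
    by rewrite QE rel -cE mulmxA e -mulmxA TE mulmxN ZE.
  have e : (1%:M - c ^t* *m c) *m Z = - (Z *m (1%:M - r *m r ^t*)).
    by rewrite -[RHS]mulNmx -cQ -[in LHS]Qr mulmxA.
  have [Z0|Zn] := eqVneq Z 0; first by rewrite -ZC Z0 ct0.
  have [_ h2] := pd_contraction pL Zn.
  have Zn' : Z ^t* != 0 by rewrite -nn_gt0 nn_adj nn_gt0.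
  have [h1 _] := pd_contraction pL Zn'.
  rewrite -ctM !nn_adj -/r -cE in h1 h2.
  have := congr1 (ip Z) e; rewrite !mulmxBl !mulmxBr mul1mx mulmx1 ipNr !ipBr.
  rewrite -[c ^t* *m c *m Z]mulmxA -ip_mull mulmxA -ip_mulr -/(nn _) -/(nn _) -/(nn _).
  by move=> e2; case: (aux _ _ _ h1 h2 e2).
have Tr : T = - r ^t*.
  apply/eqP; rewrite -subr_eq0 opprK; apply/eqP/eqP.
  apply: contraT => n0; have := pd_contraction_c pL n0; rewrite -cE.
  have e : T + r ^t* = c *m (c ^t* *m (T + r ^t*)).
    rewrite mulmxA; apply/eqP; rewrite -subr_eq0 -[X in X - _]mul1mx -mulmxBl.
    rewrite mulmxDr TE mulmxBl mul1mx -mulmxA -ctM rc ct0 mulmx0 subr0 addrC subrr //.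
  by rewrite [nn (T + _)]/nn {3}e -[c in ip _ (c *m _)]trmxCK -ip_mull -/(nn _) ltxx.
exists K0, W; split => //.
- split; first by have [_] := mulmx1_unit SK.
  have K0E : K0 = (1%:M - r *m r ^t*) *m S0.
    by rewrite /K0 S1E Tr mulNmx mulmxN mulmxBl mul1mx mulmxA.
  by rewrite {1}K0E -mulmxA SK' mulmx1.
move=> b0.
have Wc : W *m c = c.
  rewrite -[RHS]mul1mx -WE' -mulmxA mulmxBl mul1mx -mulmxA rc mulmx0 subr0 //.
have main (h : C * C) : rmx h *m c + r *m cmx h = 0.
  have := congr1 (fun M => M ^t*) (rel h); rewrite /= !ctM !trmxCK WC Tr ctN trmxCK mulNmx.
  by rewrite Wc => ->; rewrite addrC subrr.
(* This h gives the anticommutator of C1 and C2 the coefficient |b1|^2 + |b2|^2. *)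
have := main (b.2^*, b.1^*); rewrite cE /r /rmx /cmx /= !mul_row_col.
rewrite -!scalemxAl -!scalemxAr !scalerA => e.
have {e} : (b.1 * b.1^* + b.2 * b.2^*) *: (C1 *m C2 + C2 *m C1) = 0.
  rewrite -[RHS]e scalerDr !scalerDl ![_^* * _]mulrC; set A := C1 *m C2.
  by rewrite [(b.1 * _) *: A + _ in LHS]addrC addrACA.
move/eqP; rewrite scaler_eq0 paddr_eq0 ?mul_conjC_ge0 // !mul_conjC_eq0.
case/orP => [/andP[/eqP b1 /eqP b2]|/eqP //].
by move: b0; rewrite [b]surjective_pairing b1 b2 eqxx.
Qed.
End CoreRelations.

(** * Irreducible pairs of hermitian matrices *)

Section Endgame.
Variables (R : realType) (C : complexOver R) (s : nat).

(* E = A A^* is similar to kap E (1 - t E)^-2.  As x |-> x / (1 - t x)^2 is increasing, the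
   extreme eigenvalues of E satisfy kap >= (1 - t x)^2 at the bottom and <= at the top. *)
Lemma herm_similar_scalar (A K X : 'M[C]_s) (t : R) (kap : C) : (0 < s)%N ->
  A \in unitmx -> K \in unitmx -> 0 < t ->
  K *m K ^t* = 1%:M - rcF t *: (A *m A ^t*) ->
  K *m (A *m A ^t*) *m K ^t* = X ->
  (1%:M - rcF t *: (A *m A ^t*)) *m X = kap *: (A *m A ^t*) ->
  exists a, A *m A ^t* = a%:M.
Proof.
move=> s0 hA hK t0 KK XE EX.
have EC : (A *m A ^t*) ^t* = A *m A ^t* by rewrite ctM trmxCK.
have [U [d [hU EU]]] := herm_spectral EC.
have UU := unitarymxP hU.
have UU' : U ^t* *m U = 1%:M by apply: mulmx1C.
have ctu (B : 'M[C]_s) : B \in unitmx -> B ^t* \in unitmx.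
  by rewrite map_unitmx unitmx_tr.
pose x i : 'cV[C]_s := U ^t* *m delta_mx i 0.
have dE i : diag_mx (\row_j rcF (d j)) *m (delta_mx i 0 : 'cV[C]_s) = rcF (d i) *: delta_mx i 0.
  apply/matrixP => j l; rewrite mul_diag_mx !mxE.
  by case: (eqVneq j i) => [->//|_]; rewrite /= !mulr0.
have Ex i : A *m A ^t* *m x i = rcF (d i) *: x i.
  by rewrite EU /x !mulmxA -[_ *m U *m U ^t*]mulmxA UU mulmx1 -mulmxA dE scalemxAr.
have x0 i : x i != 0.
  apply/eqP => e; have := congr1 (mulmx U) e; rewrite /x mulmxA UU mul1mx mulmx0.
  by move=> /matrixP/(_ i 0); rewrite !mxE !eqxx => /eqP; rewrite oner_eq0.
have inj (B : 'M[C]_s) (y : 'cV[C]_s) : B \in unitmx -> y != 0 -> B *m y != 0.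
  by move=> hB; apply: contraNneq => e; rewrite -[y](mulKmx hB) e mulmx0.
have d0 i : 0 < d i.
  have : 0 < nn (A ^t* *m x i) by rewrite nn_gt0 inj // ctu.
  by rewrite /nn ip_mull trmxCK mulmxA Ex ipZr -/(nn _) pmulr_lgt0 // nn_gt0.
have g0 i : 0 < 1 - t * d i.
  have : 0 < nn (K ^t* *m x i) by rewrite nn_gt0 inj // ctu.
  rewrite /nn ip_mull trmxCK mulmxA KK mulmxBl mul1mx -scalemxAl Ex scalerA -rmorphM.
  by rewrite ipBr ipZr -[X in X - _]mul1r -mulrBl -/(nn _) pmulr_lgt0 // nn_gt0.
have eig i : exists j, rcF (d j) * rcF (1 - t * d i) ^+ 2 = kap * rcF (d i).
  (* The hypotheses say that K E K^-1 = kap E (1 - t E)^-2, so K^-1 carries an eigenvector of E to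
     another one, of eigenvalue mu. *)
  have [y yE] : exists y, y = invmx K *m x i by exists (invmx K *m x i).
  have y0 : y != 0 by rewrite yE inj // unitmx_inv.
  pose mu := kap * rcF (d i) / rcF (1 - t * d i) ^+ 2.
  have gn : rcF (1 - t * d i) != 0 :> C by rewrite -absF_eq0 absF_rc normr_eq0 gt_eqF.
  have tE : (1%:M - rcF t *: (A *m A ^t*)) *m x i = rcF (1 - t * d i) *: x i.
    rewrite mulmxBl mul1mx -scalemxAl Ex scalerA -rmorphM -[X in X - _]scale1r.
    by rewrite -scalerBl rmorphB rmorph1.
  have tU : 1%:M - rcF t *: (A *m A ^t*) \in unitmx by rewrite -KK unitmx_mul hK ctu.
  have Ey : A *m A ^t* *m y = mu *: y.
    apply: (can_inj (mulKmx hK)); rewrite -scalemxAr yE mulKVmx //.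
    apply: (can_inj (mulKmx tU)); rewrite -scalemxAr tE.
    have -> : invmx K *m x i = K ^t* *m ((rcF (1 - t * d i))^-1 *: x i).
      apply: (can_inj (mulKmx hK)); rewrite mulKVmx // [RHS]mulmxA KK -scalemxAr tE.
      by rewrite scalerA mulVf // scale1r.
    have e z : (1%:M - rcF t *: (A *m A ^t*)) *m (K *m (A *m A ^t* *m (K ^t* *m z)))
       = kap *: (A *m A ^t* *m z) :> 'cV[C]_s.
      rewrite [K *m (_ *m _)]mulmxA [K *m _ *m (_ *m _)]mulmxA XE.
      by rewrite [_ *m (X *m z)]mulmxA EX -scalemxAl.
    rewrite e -scalemxAr Ex !scalerA; congr (_ *: _); rewrite /mu.
    by move: gn; move: (rcF (1 - _)) (rcF (d i)) => g f gn; field.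
  have : diag_mx (\row_j rcF (d j)) *m (U *m y) = mu *: (U *m y).
    by rewrite scalemxAr -Ey EU !mulmxA UU mul1mx.
  have : U *m y != 0 by rewrite inj // unitarymx_unit.
  move: (U *m y) => w /matrix0Pn[j [l wj]] /matrixP/(_ j l); rewrite mul_diag_mx !mxE.
  move=> /(mulIf wj) dj; exists j; rewrite dj /mu.
  by move: gn; move: (rcF (1 - _)) (rcF (d i)) => g f gn; field.
pose i0 := Ordinal s0.
pose a := [arg max_(i > i0) d i]%O; pose z := [arg min_(i < i0) d i]%O.
have da i : d i <= d a by rewrite /a; case: arg_maxP => // j _ h; apply: h.
have dz i : d z <= d i by rewrite /z; case: arg_minP => // j _ h; apply: h.
have [ka kE] : exists k : R, kap = rcF k.
  have [j e] := eig i0; exists (d j * (1 - t * d i0) ^+ 2 / d i0).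
  have dn : rcF (d i0) != 0 :> C by rewrite -absF_eq0 absF_rc normr_eq0 gt_eqF.
  apply: (mulIf dn); rewrite -e -rmorphXn -!rmorphM; congr rcF.
  by rewrite divfK // gt_eqF.
have eigR i : exists j, d j * (1 - t * d i) ^+ 2 = ka * d i.
  have [j] := eig i; rewrite kE -rmorphXn -!rmorphM => e.
  by exists j; have := congr1 reF e; rewrite !reF_rc.
have h1 : ka <= (1 - t * d a) ^+ 2.
  have [j e] := eigR a; rewrite -(ler_pM2r (d0 a)) -e mulrC ler_pM2l //.
  by rewrite exprn_gt0.
have h2 : (1 - t * d z) ^+ 2 <= ka.
  have [j e] := eigR z; rewrite -(ler_pM2r (d0 z)) -e mulrC ler_pM2r //.
  by rewrite exprn_gt0.
have daz : d a <= d z.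
  have := le_trans h2 h1; rewrite ler_pXn2r ?nnegrE ?(ltW (g0 _)) //.
  by rewrite lerD2l lerN2 ler_pM2l.
exists (rcF (d a)); rewrite EU.
have -> : diag_mx (\row_j rcF (d j)) = (rcF (d a))%:M :> 'M[C]_s.
  apply/matrixP => i j; rewrite !mxE; congr (rcF _ *+ _); apply/eqP.
  by rewrite eq_le da (le_trans daz).
by rewrite mul_mx_scalar -scalemxAl UU' scalemx1.
Qed.

(** If they commuted, each would lie in their commutant and be scalar; a rank one projection would
    then commute with both without being scalar. *)
Lemma noncommuting (E1 E2 : 'M[C]_s) : (1 < s)%N -> E1 ^t* = E1 -> E2 ^t* = E2 ->
  irreducible_pair E1 E2 -> E1 *m E2 != E2 *m E1.
Proof.
move=> s1 h1 h2 irr; apply/eqP => e.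
have [a1 e1] := irr E1 h1 erefl e.
have [a2 e2] := irr E2 h2 (esym e) erefl.
pose i0 := Ordinal (ltnW s1); pose i1 := Ordinal s1.
have Dh : (delta_mx i0 i0 : 'M[C]_s) ^t* = delta_mx i0 i0.
  by apply/matrixP => i j; rewrite !mxE rmorph_nat andbC.
have [] := irr _ Dh; rewrite ?e1 ?e2 ?scalar_mxC // => a /matrixP h.
have := h i0 i0; have := h i1 i1; rewrite !mxE /= => <- /eqP.
by rewrite oner_eq0.
Qed.

Section Pair.
Variables E1 E2 : 'M[C]_s.
Hypotheses (h1 : E1 ^t* = E1) (h2 : E2 ^t* = E2) (nc : E1 *m E2 != E2 *m E1).

(** Commutators with E2 and with E1 isolate x and y. *)
Lemma pair_free (x y : C) : x *: E1 + y *: E2 = 0 -> x = 0 /\ y = 0.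
Proof.
move=> e; have e' : x *: (E1 *m E2 - E2 *m E1) = 0.
  have := congr1 (fun M => M *m E2 - E2 *m M) e; rewrite /= mul0mx mulmx0 subr0.
  rewrite mulmxDl mulmxDr -!scalemxAl -!scalemxAr opprD addrACA subrr addr0.
  by rewrite scalerBr.
have e'' : y *: (E1 *m E2 - E2 *m E1) = 0.
  have := congr1 (fun M => E1 *m M - M *m E1) e; rewrite /= mul0mx mulmx0 subr0.
  rewrite mulmxDl mulmxDr -!scalemxAl -!scalemxAr opprD addrACA subrr add0r.
  by rewrite scalerBr.
move/eqP: e'; move/eqP: e''; rewrite !scaler_eq0 !subr_eq0 (negbTE nc) !orbF.
by move=> /eqP -> /eqP ->.
Qed.

(* The antihermitian part N of p E1 + q E2 satisfies N (1 - D) + (1 - D) N = m [E1, E2] for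
   some scalar m, and the right-hand side is orthogonal to E1 and E2. *)
Lemma hermitian_coefficients (K X : 'M[C]_s) (d1 d2 p q : C) :
  d1^* = d1 -> d2^* = d2 -> K \in unitmx ->
  K *m K ^t* = 1%:M - (d1 *: E1 + d2 *: E2) -> X ^t* = X ->
  (1%:M - (d1 *: E1 + d2 *: E2)) *m X = p *: E1 + q *: E2 -> p * d2 = q * d1.
Proof.
move=> r1 r2 hK KK XC XE.
have [D DE] : exists D, D = d1 *: E1 + d2 *: E2 by exists (d1 *: E1 + d2 *: E2).
have DC : D ^t* = D by rewrite DE ctD !ctZ r1 r2 h1 h2.
rewrite -DE in KK XE.
have [Z ZE] : exists Z, Z = p *: E1 + q *: E2 by exists (p *: E1 + q *: E2).
have ZC : Z ^t* = X *m (1%:M - D) by rewrite ZE -XE ctM XC ctB ct1 DC.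
have e : Z *m (1%:M - D) = (1%:M - D) *m Z ^t* by rewrite ZC ZE -XE mulmxA.
have [N NE] : exists N, N = Z - Z ^t* by exists (Z - Z ^t*).
have NC : N ^t* = - N by rewrite NE ctB trmxCK opprB.
have comm : N *m (1%:M - D) + (1%:M - D) *m N = (Z + Z ^t*) *m D - D *m (Z + Z ^t*).
  move: e; rewrite NE !mulmxBr !mulmxBl !mulmxDr !mulmxDl !mul1mx !mulmx1.
  move: (Z) (Z ^t*) (Z *m D) (Z ^t* *m D) (D *m Z) (D *m Z ^t*) => A6 A5 A1 A2 A3 A4 e.
  have -> : A6 = A5 - A4 + A1 by rewrite -e subrK.
  by apply/matrixP => i j; rewrite !mxE; ring.
have NN : N = (p - p^*) *: E1 + (q - q^*) *: E2.
  by rewrite NE ZE ctD !ctZ h1 h2 !scalerBl opprD addrACA.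
have MM : Z + Z ^t* = (p + p^*) *: E1 + (q + q^*) *: E2.
  by rewrite ZE ctD !ctZ h1 h2 !scalerDl addrACA.
have bracket : (Z + Z ^t*) *m D - D *m (Z + Z ^t*)
    = ((p + p^*) * d2 - (q + q^*) * d1) *: (E1 *m E2 - E2 *m E1).
  rewrite MM DE; move: (p + p^*) (q + q^*) => m1 m2.
  rewrite !mulmxDl !mulmxDr -!scalemxAl -!scalemxAr.
  move: (E1 *m E1) (E1 *m E2) (E2 *m E1) (E2 *m E2) => A1 A2 A3 A4.
  by apply/matrixP => i j; rewrite !mxE; ring.
have trN : \tr (N ^t* *m (E1 *m E2 - E2 *m E1)) = 0.
  have t1 : \tr (E1 *m (E1 *m E2 - E2 *m E1)) = 0.
    by rewrite mulmxBr raddfB /= [X in _ - X]mxtrace_mulC -!mulmxA [X in _ - X]mxtrace_mulC -mulmxA subrr.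
  have t2 : \tr (E2 *m (E1 *m E2 - E2 *m E1)) = 0.
    by rewrite mulmxBr raddfB /= mxtrace_mulC -!mulmxA mxtrace_mulC -mulmxA subrr.
  rewrite NC NN mulNmx mulmxDl -!scalemxAl raddfN /= mxtraceD !mxtraceZ t1 t2.
  by rewrite !mulr0 addr0 oppr0.
(* Since 1 - D = K K^*, pairing [comm] with N gives |N K|^2 + |K^* N|^2 = 0. *)
have nz : nn (N *m K) + nn (K ^t* *m N) = 0.
  have := congr1 (ip N) comm; rewrite bracket ipDr -KK.
  rewrite mulmxA -ip_mulr -[K *m K ^t* *m N]mulmxA -[X in _ + ip N (X *m _)]trmxCK -ip_mull.
  by rewrite /nn => ->; rewrite ip.unlock -scalemxAr mxtraceZ trN mulr0 raddf0.
have N0 : N = 0.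
  have := nn_ge0 (N *m K); have := nn_ge0 (K ^t* *m N) => g1 g2.
  have /eqP : nn (N *m K) = 0 by move: (nn _) (nn _) nz g1 g2 => x y; lra.
  by rewrite nn_eq0 => /eqP z; rewrite -[N](mulmxK hK) z mul0mx.
have [p0 q0] := pair_free (etrans (esym NN) N0).
move/eqP: p0; move/eqP: q0; rewrite !subr_eq0 => /eqP pr /eqP qr.
(* Now p and q are real, and the vanishing bracket is 2 (p d2 - q d1) times the nonzero
   commutator. *)
move: comm; rewrite N0 mul0mx mulmx0 addr0 bracket -pr -qr => /esym/eqP.
rewrite scaler_eq0 [X in _ || X]subr_eq0 (negbTE nc) orbF -!mulr2n !mulrnAl.
by rewrite -mulrnBl mulrn_eq0 /= subr_eq0 => /eqP.
Qed.
End Pair.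

End Endgame.

(** * The case where the row pencil dominates *)

Section RowCase.
Variables (R : realType) (C : complexOver R) (s : nat) (C1 C2 : 'M[C]_s).
Local Notation k := (s + ((s + s) + s))%N.
Local Notation Lam := (Lam C1 C2).
Local Notation Lb := (Lb C1 C2).
Local Notation rmx := (rmx C1 C2).
Local Notation N1 := (N1 C1 C2).
Local Notation N2 := (N2 C1 C2).
Local Notation r1 := (row_mx C1 (0 : 'M[C]_s)).
Local Notation r2 := (row_mx (0 : 'M[C]_s) C2).
Local Notation c1 := (col_mx (0 : 'M[C]_s) C1).
Local Notation c2 := (col_mx C2 (0 : 'M[C]_s)).
Local Notation E1 := (C1 *m C1 ^t*).
Local Notation E2 := (C2 *m C2 ^t*).

Lemma rmx_gram (x y : C * C) : rmx x *m (rmx y) ^t* =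
  (x.1 * (y.1)^*) *: E1 + (x.2 * (y.2)^*) *: E2.
Proof.
rewrite /rmx ct_row mul_row_col !ctZ -!scalemxAl -!scalemxAr !scalerA.
by [].
Qed.

Hypotheses (s0 : (0 < s)%N) (hC1 : C1 \in unitmx) (hC2 : C2 \in unitmx).
Hypothesis irrE : irreducible_pair E1 E2.

(** Write b = al u + be v and D = r(b) r(b)^*. The identity for K and W at (al, be), multiplied by 1
    - D, no longer contains W: al (1 - D) K E1 K^* and be (1 - D) K E2 K^* become combinations of E1
    and E2 with coefficients from b, u and v. For b <> 0, E1 and E2 do not commute; each position of
    b then contradicts this or the independence of u and v, or puts a zero on the diagonal. *)
Lemma endgame (b u v : C * C) (K : 'M[C]_s) (W : 'M[C]_(s + s)) :
  u.1 * v.2 - v.1 * u.2 != 0 ->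
  K \in unitmx -> K *m K ^t* = 1%:M - rmx b *m (rmx b) ^t* ->
  (1%:M - (rmx b) ^t* *m rmx b) *m W = 1%:M ->
  (forall h h', K *m (rmx h *m (rmx h') ^t*) *m K ^t* =
        rmx (h.1 * u.1 + h.2 * v.1, h.1 * u.2 + h.2 * v.2) *m W *m
        (rmx (h'.1 * u.1 + h'.2 * v.1, h'.1 * u.2 + h'.2 * v.2)) ^t*) ->
  (b != 0 -> C1 *m C2 + C2 *m C1 = 0) ->
  [/\ b != 0 -> (1 < s)%N, b != 0 -> u.1 = 0 \/ v.2 = 0 &
      b = 0 -> (1 < s)%N -> u.1 * v.1 = 0 /\ u.2 * v.2 = 0].
Proof.
move=> uv hK KK WE KD anti.
have E1C : E1 ^t* = E1 by rewrite ctM trmxCK.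
have E2C : E2 ^t* = E2 by rewrite ctM trmxCK.
(* For s = 1 the anticommuting C1 and C2 also commute, so that 2 C1 C2 = 0. *)
have b0s : b != 0 -> (1 < s)%N.
  move=> /anti a; rewrite ltn_neqAle s0 andbT eq_sym; apply/eqP => s1.
  have cc (A B : 'M[C]_s) : A *m B = B *m A.
    move: A B; rewrite s1 => A B.
    by rewrite [A]mx11_scalar scalar_mxC.
  have /eqP : C1 *m C2 + C1 *m C2 = 0 by rewrite [X in _ + X]cc.
  rewrite -mulr2n -scaler_nat scaler_eq0 pnatr_eq0 /= => /eqP z.
  have := unitmx_mul C1 C2; rewrite z hC1 hC2 -(ltn_predK s0) unitr0 //.
have nc : (1 < s)%N -> E1 *m E2 != E2 *m E1 by move=> s1; apply: noncommuting.
split => //; last first.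
  move=> b0 s1; have rb : rmx b = 0.
    by rewrite b0 /rmx /= !scale0r row_mx0.
  rewrite rb mulmx0 subr0 mul1mx in WE.
  have := KD (1, 0) (0, 1); rewrite !rmx_gram /= WE mulmx1 rmx_gram /=.
  rewrite !(mul0r, mulr0, mul1r, add0r, addr0, rmorph0, scale0r, mulmx0, mul0mx).
  move=> /esym/(pair_free (nc s1))[] /eqP + /eqP.
  rewrite !mulf_eq0 !fmorph_eq0 -!mulf_eq0 => /eqP -> /eqP -> //.
move=> b0; have {}nc := nc (b0s b0).
have irrn (A B : 'M[C]_s) a : A = a%:M -> A *m B = B *m A by move=> ->; rewrite scalar_mxC.
pose d := u.1 * v.2 - v.1 * u.2.
have [al alE] : exists al, al = (b.1 * v.2 - v.1 * b.2) / d by eexists.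
have [be beE] : exists be, be = (u.1 * b.2 - u.2 * b.1) / d by eexists.
have bE1 : b.1 = al * u.1 + be * v.1 by rewrite alE beE /d; field; exact: uv.
have bE2 : b.2 = al * u.2 + be * v.2 by rewrite alE beE /d; field; exact: uv.
have rW : (1%:M - rmx b *m (rmx b) ^t*) *m (rmx b *m W) = rmx b.
  have e : (1%:M - rmx b *m (rmx b) ^t*) *m rmx b = rmx b *m (1%:M - (rmx b) ^t* *m rmx b).
    by rewrite mulmxBl mulmxBr mul1mx mulmx1 mulmxA.
  by rewrite mulmxA e -mulmxA WE mulmx1.
have G h' : (1%:M - rmx b *m (rmx b) ^t*) *m (K *m (rmx (al, be) *m (rmx h') ^t*) *m K ^t*)
    = rmx b *m (rmx (h'.1 * u.1 + h'.2 * v.1, h'.1 * u.2 + h'.2 * v.2)) ^t*.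
  by rewrite KD /= -bE1 -bE2 -surjective_pairing [LHS]mulmxA rW.
rewrite rmx_gram in KK.
have XC (A : 'M[C]_s) : A ^t* = A -> (K *m A *m K ^t*) ^t* = K *m A *m K ^t*.
  by move=> h; rewrite !ctM trmxCK h mulmxA.
have G1 : al *: ((1%:M - (b.1 * b.1^* *: E1 + b.2 * b.2^* *: E2)) *m (K *m E1 *m K ^t*))
    = b.1 * u.1^* *: E1 + b.2 * u.2^* *: E2.
  have := G (1, 0); rewrite !rmx_gram /= conjC0 conjC1.
  rewrite !(mul0r, mulr0, mul1r, mulr1, add0r, addr0, scale0r) => <-.
  by rewrite -(scalemxAr al K) -scalemxAl -scalemxAr.
have G2 : be *: ((1%:M - (b.1 * b.1^* *: E1 + b.2 * b.2^* *: E2)) *m (K *m E2 *m K ^t*))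
    = b.1 * v.1^* *: E1 + b.2 * v.2^* *: E2.
  have := G (0, 1); rewrite !rmx_gram /= conjC0 conjC1.
  rewrite !(mul0r, mulr0, mul1r, mulr1, add0r, addr0, scale0r) => <-.
  by rewrite -(scalemxAr be K) -scalemxAl -scalemxAr.
have sqE (x : C) : x != 0 -> exists2 t : R, 0 < t & x * x^* = rcF t.
  move=> x0; exists (absF x ^+ 2); first by rewrite exprn_gt0 // absF_gt0.
  rewrite absF_sqr; apply: rcF_real; by rewrite rmorphM /= conjCK mulrC.
have bn : b.1 = 0 -> b.2 = 0 -> False.
  by move=> z1 z2; move: b0; rewrite [b]surjective_pairing z1 z2 eqxx.
(* Here D and the right-hand side of G1 involve E1 alone, and [herm_similar_scalar] makes E1
   scalar. *)
have scal1 : b.2 = 0 -> u.2 = 0 -> al != 0 -> False.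
  move=> b20 u20 al0; have b1n : b.1 != 0 by apply/eqP => /bn; apply.
  have [t t0 tE] := sqE _ b1n.
  have DE : b.1 * b.1^* *: E1 + b.2 * b.2^* *: E2 = rcF t *: E1.
    by rewrite tE b20 mul0r scale0r addr0.
  rewrite DE in KK G1.
  have [|a aE] := herm_similar_scalar (kap := b.1 * u.1^* / al) s0 hC1 hK t0 KK erefl.
    apply: (scalerI al0); rewrite G1 u20 rmorph0 mulr0 scale0r addr0 scalerA.
    by rewrite mulrCA divff // mulr1.
  by move: nc; rewrite (irrn _ _ _ aE) eqxx.
have scal2 : b.1 = 0 -> v.1 = 0 -> be != 0 -> False.
  move=> b10 v10 be0; have b2n : b.2 != 0 by apply/eqP => /(bn b10).
  have [t t0 tE] := sqE _ b2n.
  have DE : b.1 * b.1^* *: E1 + b.2 * b.2^* *: E2 = rcF t *: E2.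
    by rewrite tE b10 mul0r scale0r add0r.
  rewrite DE in KK G2.
  have [|a aE] := herm_similar_scalar (kap := b.2 * v.2^* / be) s0 hC2 hK t0 KK erefl.
    apply: (scalerI be0); rewrite G2 v10 rmorph0 mulr0 scale0r add0r scalerA.
    by rewrite mulrCA divff // mulr1.
  by move: nc; rewrite -(irrn _ _ _ aE) eqxx.
have zero (x y : C) : x * y^* = 0 -> x = 0 \/ y = 0.
  by move/eqP; rewrite mulf_eq0 fmorph_eq0 => /orP[]/eqP; [left|right].
have [al0|aln] := eqVneq al 0.
  move: G1; rewrite al0 scale0r => /esym/(pair_free nc)[/zero[b10|->] /zero[b20|u20]];
    try by left.
    by case: bn.
  have [be0|ben] := eqVneq be 0; first by case: bn => //; rewrite bE2 al0 be0 !mul0r addr0.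
  case: (scal2 b10) => //; move: bE1; rewrite b10 al0 mul0r add0r => /esym/eqP.
  by rewrite mulf_eq0 (negbTE ben) /= => /eqP.
have [be0|ben] := eqVneq be 0.
  move: G2; rewrite be0 scale0r => /esym/(pair_free nc)[/zero[b10|v10] /zero[b20|v20]];
    try by right.
    by case: bn.
  case: (scal1 b20) => //; move: bE2; rewrite b20 be0 mul0r addr0 => /esym/eqP.
  by rewrite mulf_eq0 (negbTE aln) /= => /eqP.
have rC (x : C) : (x * x^*)^* = x * x^* by rewrite rmorphM /= conjCK mulrC.
have par (A : 'M[C]_s) g p q : A ^t* = A -> g != 0 ->
    g *: ((1%:M - (b.1 * b.1^* *: E1 + b.2 * b.2^* *: E2)) *m (K *m A *m K ^t*))
      = p *: E1 + q *: E2 -> p * (b.2 * b.2^*) = q * (b.1 * b.1^*).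
  move=> AC gn e.
  have := @hermitian_coefficients _ _ _ _ _ E1C E2C nc K (K *m A *m K ^t*)
    (b.1 * b.1^*) (b.2 * b.2^*) (p / g) (q / g) (rC _) (rC _) hK KK (XC _ AC).
  have -> : p / g *: E1 + q / g *: E2 = g^-1 *: (p *: E1 + q *: E2).
    by rewrite scalerDr !scalerA ![g^-1 * _]mulrC.
  rewrite -e scalerA mulVf // scale1r => /(_ erefl).
  by rewrite mulrAC [RHS]mulrAC => /(mulIf (invr_neq0 gn)).
have e1 := par _ _ _ _ E1C aln G1; have e2 := par _ _ _ _ E2C ben G2.
(* The right-hand sides of G1 and G2 are linearly independent: up to the nonzero factors al and be
   they are the images of E1 and E2 under an invertible map. *)
have comb x y : x *: (b.1 * u.1^* *: E1 + b.2 * u.2^* *: E2)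
    + y *: (b.1 * v.1^* *: E1 + b.2 * v.2^* *: E2) = 0 -> x = 0 /\ y = 0.
  have hKt : K ^t* \in unitmx by rewrite map_unitmx unitmx_tr.
  rewrite -G1 -G2 -KK.
  have -> : x *: (al *: (K *m K ^t* *m (K *m E1 *m K ^t*)))
      + y *: (be *: (K *m K ^t* *m (K *m E2 *m K ^t*)))
      = K *m K ^t* *m (K *m (x * al *: E1 + y * be *: E2) *m K ^t*).
    rewrite (mulmxDr K) !mulmxDl mulmxDr !scalerA.
    by rewrite -!(scalemxAr _ K) -!scalemxAl -!scalemxAr.
  move=> e; have : x * al *: E1 + y * be *: E2 = 0.
    have := congr1 (fun M => invmx K *m (invmx (K *m K ^t*) *m M) *m invmx (K ^t*)) e.
    by rewrite /= mulKmx ?unitmx_mul ?hK ?hKt // -(mulmxA K) mulKmx // mulmxK // !mulmx0 mul0mx.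
  move=> /(pair_free nc)[/eqP + /eqP]; rewrite !mulf_eq0 (negbTE aln) (negbTE ben) !orbF.
  by move=> /eqP -> /eqP ->.
(* If a coordinate of b vanishes, both right-hand sides are multiples of one E_j; the coefficients
   of the relation between them vanish, and one of these is a diagonal entry. *)
have [b10|b1n] := eqVneq b.1 0.
  right; have [] := comb v.2^* (- u.2^*).
    rewrite b10 !mul0r !scale0r !add0r !scalerA -scalerDl (_ : _ + _ = 0) ?scale0r //; ring.
  by move=> /eqP; rewrite fmorph_eq0 => /eqP.
have [b20|b2n] := eqVneq b.2 0.
  left; have [] := comb v.1^* (- u.1^*).
    rewrite b20 !mul0r !scale0r !addr0 !scalerA -scalerDl (_ : _ + _ = 0) ?scale0r //; ring.
  by move=> _ /eqP; rewrite oppr_eq0 fmorph_eq0 => /eqP.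
(* Otherwise u and v are both proportional to b, against their independence. *)
have f (x : C * C) : b.1 * x.1^* * (b.2 * b.2^*) = b.2 * x.2^* * (b.1 * b.1^*) ->
    x.1 * b.2 = x.2 * b.1.
  move=> e; apply: (can_inj conjCK); rewrite !rmorphM /=.
  apply: (mulfI b1n); apply: (mulfI b2n).
  have -> : b.2 * (b.1 * (x.1^* * b.2^*)) = b.1 * x.1^* * (b.2 * b.2^*) by ring.
  by rewrite e; ring.
case/eqP: uv; apply: (mulfI b1n); apply: (mulfI b2n); rewrite !mulr0.
have -> : b.2 * (b.1 * (u.1 * v.2 - v.1 * u.2))
    = b.1 * ((u.1 * b.2) * v.2 - (v.1 * b.2) * u.2) by ring.
rewrite (f u e1) (f v e2); ring.
Qed.
End RowCase.

(** * The full pencil, and the exchange of rows and columns *)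

Section Conclusion.
Variables (R : realType) (C : complexOver R).

Section Row.
Variables (s : nat) (C1 C2 : 'M[C]_s).
Local Notation Lam := (Lam C1 C2).
Local Notation Lb := (Lb C1 C2).
Local Notation N1 := (N1 C1 C2).
Local Notation N2 := (N2 C1 C2).
Local Notation r1 := (row_mx C1 (0 : 'M[C]_s)).
Local Notation r2 := (row_mx (0 : 'M[C]_s) C2).
Local Notation c1 := (col_mx (0 : 'M[C]_s) C1).
Local Notation c2 := (col_mx C2 (0 : 'M[C]_s)).
Hypotheses (s0 : (0 < s)%N) (hC1 : C1 \in unitmx) (hC2 : C2 \in unitmx).

Lemma row_case (b u v : C * C) c X Y :
  irreducible_pair (C1 *m C1 ^t*) (C2 *m C2 ^t*) ->
  pd (Lb b) -> u.1 * v.2 - v.1 * u.2 != 0 ->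
  same_ball (Lb b) N1 N2 (Lam u) (Lam v) ->
  bounded_by r1 r2 r1 r2 c -> attains r1 r2 r1 r2 c X Y -> 0 < nn X + nn Y ->
  bounded_by c1 c2 c1 c2 c ->
  [/\ b != 0 -> (1 < s)%N, b != 0 -> u.1 = 0 \/ v.2 = 0 &
      b = 0 -> (1 < s)%N -> u.1 * v.1 = 0 /\ u.2 * v.2 = 0].
Proof.
move=> irr pL uv sb hr ar XY hc.
have u0 : u != 0 by apply: contraNneq uv => ->; rewrite mul0r mulr0 subrr.
have v0 : v != 0 by apply: contraNneq uv => ->; rewrite mul0r mulr0 subrr.
have [V [S [hV hS [e1 e2] [e3 e4]]]] :=
  summand_relations s0 hC1 hC2 irr (Lb_adj C1 C2 b) pL sb hr ar XY hc.
have [K [W [[hK KK] WE KD anti]]] := core_relations hC1 hC2 pL u0 v0 uv hV hS e1 e2 e3 e4.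
exact: endgame uv hK KK WE KD anti.
Qed.
End Row.

Lemma bform_swap m n p q (A1 A2 : 'M[C]_(m, n)) (B1 B2 : 'M[C]_(p, q)) X Y :
  bform A1 A2 B1 B2 X Y = bform (A2 ^t*) (A1 ^t*) (B2 ^t*) (B1 ^t*) Y X.
Proof.
have e (A : 'M[C]_(m, n)) (B : 'M[C]_(p, q)) :
    ip X (A *m Y *m B ^t*) = ip Y (A ^t* *m X *m (B ^t*) ^t*).
  by rewrite trmxCK -ip_mulr ipC ip_mull mulmxA.
by rewrite /bform !e addrC.
Qed.

Lemma same_ball_adj k (J L A1 A2 M1 M2 : 'M[C]_k) : J ^t* = J -> J *m J = 1%:M ->
  same_ball L A1 A2 M1 M2 ->
  same_ball (J *m L *m J) (J *m A2 ^t* *m J) (J *m A1 ^t* *m J)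
    (J *m M2 ^t* *m J) (J *m M1 ^t* *m J).
Proof.
move=> JC JJ sb p q B1 B2.
have JK n (Y : 'M[C]_(k, n)) : J *m (J *m Y) = Y by rewrite mulmxA JJ mul1mx.
have J0 n (Y : 'M[C]_(k, n)) : (J *m Y == 0) = (Y == 0).
  by apply/eqP/eqP => [e|->]; rewrite ?mulmx0 // -[Y]JK e mulmx0.
have nJ n (Y : 'M[C]_(k, n)) : nn (J *m Y) = nn Y by rewrite /nn ip_mull JC JK.
have LJ n (Y : 'M[C]_(k, n)) : ip Y (J *m L *m J *m Y) = ip (J *m Y) (L *m (J *m Y)).
  by rewrite ip_mull JC !mulmxA.
have fJ (D1 D2 : 'M[C]_k) Y Z : bform (J *m D2 ^t* *m J) (J *m D1 ^t* *m J) B1 B2 Y Z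
    = bform D1 D2 (B2 ^t*) (B1 ^t*) (J *m Z) (J *m Y).
  by rewrite [RHS]bform_swap !trmxCK /bform !ip_mull JC !mulmxA.
have [h1 h2] := sb _ _ (B2 ^t*) (B1 ^t*); split => h Y Z YZ.
  rewrite !LJ fJ [ip (J *m Y) _ + _]addrC; apply: h1; last by rewrite !J0 orbC.
  move=> Y' Z' YZ'; have := h (J *m Z') (J *m Y'); rewrite !J0 orbC YZ' => /(_ isT).
  by rewrite !nJ fJ !JK addrC [nn Z' + _]addrC addrC.
rewrite fJ -(nJ _ Y) -(nJ _ Z) [nn _ + _]addrC; apply: h2; last by rewrite !J0 orbC.
move=> Y' Z' YZ'; have := h (J *m Z') (J *m Y'); rewrite !J0 orbC YZ' => /(_ isT).
by rewrite !LJ fJ !JK addrC [ip Z' _ + _]addrC addrC.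
Qed.

Section Reverse.
Variable s : nat.
Local Notation k := (s + ((s + s) + s))%N.

Definition rev_mx : 'M[C]_k :=
  block_mx 0 (row_mx 0 1%:M) (col_mx 0 1%:M) (block_mx 1%:M 0 0 0).

Lemma rev_col n (Y0 : 'M[C]_(s, n)) (Y1 : 'M[C]_(s + s, n)) (Y2 : 'M[C]_(s, n)) :
  rev_mx *m col_mx Y0 (col_mx Y1 Y2) = col_mx Y2 (col_mx Y1 Y0).
Proof.
rewrite mul_block_col mul0mx add0r mul_row_col mul0mx add0r mul1mx.
rewrite mul_col_mx mul0mx mul1mx mul_block_col !mul0mx mul1mx !addr0 add_col_mx.
by rewrite add0r addr0.
Qed.

Lemma rev_adj : rev_mx ^t* = rev_mx.
Proof. by rewrite /rev_mx !ct_block ct_row ct_col !ct0 !ct1. Qed.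

Lemma mulmx_ext (A B : 'M[C]_k) :
  (forall n (Y0 : 'M[C]_(s, n)) (Y1 : 'M[C]_(s + s, n)) (Y2 : 'M[C]_(s, n)),
    A *m col_mx Y0 (col_mx Y1 Y2) = B *m col_mx Y0 (col_mx Y1 Y2)) -> A = B.
Proof.
by move=> h; rewrite -[A]mulmx1 -[B]mulmx1 -[1%:M]vsubmxK -[dsubmx 1%:M]vsubmxK h.
Qed.

Lemma rev_rev : rev_mx *m rev_mx = 1%:M.
Proof. by apply: mulmx_ext => n Y0 Y1 Y2; rewrite -mulmxA !rev_col mul1mx. Qed.

(** The adjoint of the column c(h) is a row whose first entry comes from C2; hence the exchange of
    C1 with C2 and of the coordinates of h. *)
Lemma rev_Lam (C1 C2 : 'M[C]_s) h :
  rev_mx *m (Lam C1 C2 h) ^t* *m rev_mx = Lam (C2 ^t*) (C1 ^t*) (h.2^*, h.1^*).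
Proof.
apply: mulmx_ext => n Y0 Y1 Y2; rewrite -!mulmxA rev_col Lam_adj_col rev_col Lam_col.
by rewrite /rmx /cmx /= ct_col ct_row !ctZ.
Qed.

Lemma rev_Lb (C1 C2 : 'M[C]_s) b :
  rev_mx *m Lb C1 C2 b *m rev_mx = Lb (C2 ^t*) (C1 ^t*) (b.2^*, b.1^*).
Proof.
rewrite /Lb !mulmxDr !mulmxDl mulmx1 rev_rev rev_Lam -rev_Lam !ctM trmxCK rev_adj.
by rewrite addrAC !mulmxA.
Qed.
End Reverse.

(* The larger of the norms of the row and column pencils decides which of the two is the
   summand; taking adjoints and reversing the blocks exchanges their roles. *)
Lemma pencil_rigidity s (C1 C2 : 'M[C]_s) (b u v : C * C) :
  (0 < s)%N -> C1 \in unitmx -> C2 \in unitmx ->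
  irreducible_pair (C1 *m C1 ^t*) (C2 *m C2 ^t*) ->
  irreducible_pair (C2 ^t* *m C2) (C1 ^t* *m C1) ->
  pd (Lb C1 C2 b) -> u.1 * v.2 - v.1 * u.2 != 0 ->
  same_ball (Lb C1 C2 b) (N1 C1 C2) (N2 C1 C2) (Lam C1 C2 u) (Lam C1 C2 v) ->
  [/\ b != 0 -> (1 < s)%N, b != 0 -> u.1 = 0 \/ v.2 = 0 &
      b = 0 -> (1 < s)%N -> u.1 * v.1 = 0 /\ u.2 * v.2 = 0].
Proof.
move=> s0 hC1 hC2 irE irF pL uv sb.
have ss0 : (0 < s + s)%N by rewrite addn_gt0 s0.
have [cr [hr [X [Y [XY ar]]]]] :=
  optimal_bound (row_mx C1 0) (row_mx 0 C2) (row_mx C1 0) (row_mx 0 C2) s0 s0.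
have [cc [hc [X' [Y' [XY' ac]]]]] :=
  optimal_bound (col_mx 0 C1) (col_mx C2 0) (col_mx 0 C1) (col_mx C2 0) ss0 ss0.
have [le|/ltW le] := leP cc cr.
  by apply: (row_case s0 hC1 hC2 irE pL uv sb hr ar XY); apply: bounded_by_le hc.
have ctu (A : 'M[C]_s) : A \in unitmx -> A ^t* \in unitmx.
  by rewrite map_unitmx unitmx_tr.
have swap c m n (A1 A2 : 'M[C]_(m, n)) : bounded_by A1 A2 A1 A2 c ->
    bounded_by (A2 ^t*) (A1 ^t*) (A2 ^t*) (A1 ^t*) c.
  by move=> h Z Z'; rewrite bform_swap !trmxCK addrC; apply: h.
(* Exchanging the two coordinates also exchanges the two basis directions, so u and v trade
   places. *)
have := @row_case s (C2 ^t*) (C1 ^t*) s0 (ctu _ hC2) (ctu _ hC1)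
  (b.2^*, b.1^*) (v.2^*, v.1^*) (u.2^*, u.1^*) cc Y' X'.
rewrite !trmxCK /= => row'.
have E : row_mx (C2 ^t*) 0 = (col_mx C2 0 : 'M[C]_(s + s, s)) ^t* by rewrite ct_col ct0.
have E' : row_mx 0 (C1 ^t*) = (col_mx 0 C1 : 'M[C]_(s + s, s)) ^t* by rewrite ct_col ct0.
have E1 : col_mx 0 (C2 ^t*) = (row_mx 0 C2 : 'M[C]_(s, s + s)) ^t* by rewrite ct_row ct0.
have E2 : col_mx (C1 ^t*) 0 = (row_mx C1 0 : 'M[C]_(s, s + s)) ^t* by rewrite ct_row ct0.
have NE h g : (h.2^*, h.1^*) = g -> Lam (C2 ^t*) (C1 ^t*) g
    = rev_mx s *m (Lam C1 C2 h) ^t* *m rev_mx s by move=> <-; rewrite rev_Lam.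
have [] := row' irF.
- move=> y y0; rewrite -rev_Lb -(mulmxA _ _ y) -(mulmxA _ _ (_ *m y)).
  have r0 : rev_mx s *m y != 0.
    by apply: contraNneq y0 => e; rewrite -[y]mul1mx -rev_rev -mulmxA e mulmx0.
  by have := pL _ r0; rewrite ip_mull rev_adj !mulmxA.
- have -> : v.2^* * u.1^* - u.2^* * v.1^* = (u.1 * v.2 - v.1 * u.2)^*.
    by rewrite rmorphB !rmorphM /=; ring.
  by rewrite fmorph_eq0.
- rewrite -rev_Lb -!rev_Lam /N1 /N2.
  rewrite (NE (0, 1)) ?(NE (1, 0)) /= ?conjC0 ?conjC1 //.
  by apply: same_ball_adj; [exact: rev_adj|exact: rev_rev|].
- by rewrite E E'; apply: swap.
- by rewrite E E' /attains -bform_swap addrC.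
- by rewrite addrC.
- by rewrite E1 E2; apply: swap; apply: bounded_by_le hr.
have bE : ((b.2^*, b.1^*) == 0) = (b == 0).
  by rewrite [b]surjective_pairing /= -!pair_eqE /pair_eq /= !fmorph_eq0 andbC.
rewrite bE => h1 h2 h3; split=> //.
  by move=> /h2[]/eqP; rewrite fmorph_eq0 => /eqP; [right|left].
move=> /eqP; rewrite -bE => /eqP /h3 h /h[].
rewrite -!rmorphM /= => /eqP + /eqP; rewrite !fmorph_eq0 => /eqP e1 /eqP e2.
by rewrite mulrC e2 mulrC e1.
Qed.
End Conclusion.

(** * Commutants *)

Section Irreducible.
Variable R : realType.
Local Notation C := (cplx R).

Lemma closure_mx n (S : set 'M[C]_n) (A : 'M[C]_n) : closure S A ->
  forall e : R, 0 < e -> exists2 A', S A' & forall i j, cabs ((A - A') i j) < e.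
Proof.
move=> cl e e0; have e0' : 0 < rc e by rewrite /rc ltcR.
have [A' [SA' h]] := cl _ (nbhsx_ballx A (rc e) e0').
exists A' => // i j; have := h; rewrite /ball /= /mx_ball => -[_] /(_ i j).
by rewrite /ball /= norm_cabs !mxE /rc ltcR.
Qed.

(** The adjoint condition makes the set stable under adjoints, as a C*-subalgebra must be. *)
Lemma commutant_closed n (B : 'M[C]_n) :
  closed [set A : 'M[C]_n | A *m B = B *m A /\ A ^t* *m B = B *m A ^t*].
Proof.
move=> A /closure_mx cl.
have small (i l : 'I_n) : exists2 K : R, 0 <= K & forall (Z : 'M[C]_n) (e : R), 0 < e ->
    (forall i j, cabs (Z i j) < e) -> cabs ((Z *m B - B *m Z) i l) <= e * K.
  exists (\sum_j cabs (B j l) + \sum_j cabs (B i j)).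
    by rewrite addr_ge0 // sumr_ge0 // => j _; apply: cabs_ge0.
  move=> Z e e0 h.
  have -> : (Z *m B - B *m Z) i l = \sum_j Z i j * B j l - \sum_j B i j * Z j l.
    by rewrite !mxE.
  apply: le_trans (cabsD _ _) _; rewrite cabsN mulrDr !mulr_sumr.
  apply: lerD; apply: le_trans (cabs_sum _ _ _) _; apply: ler_sum => j _.
    by rewrite cabsM ler_wpM2r ?cabs_ge0 // ltW.
  by rewrite cabsM mulrC ler_wpM2r ?cabs_ge0 // ltW.
have zero (Z : 'M[C]_n) :
    (forall e : R, 0 < e -> exists2 Z', Z' *m B = B *m Z' & forall i j, cabs ((Z - Z') i j) < e) ->
    Z *m B = B *m Z.
  move=> h; apply/eqP; rewrite -subr_eq0; apply/eqP/matrixP => i l.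
  have [K K0 hK] := small i l; rewrite [RHS]mxE; apply/eqP; rewrite -cabs_eq0.
  rewrite eq_le cabs_ge0 andbT; apply: (@le0_small _ _ K 1) => // t t0 _.
  have [Z' e hZ'] := h t t0.
  have -> : Z *m B - B *m Z = (Z - Z') *m B - B *m (Z - Z').
    by rewrite mulmxBl mulmxBr e opprB addrA subrK.
  by rewrite mulrC; apply: hK.
split; apply: zero => e /cl [A' [h1 h2] hA']; first by exists A'.
exists (A' ^t*) => // i j; have := hA' j i.
by rewrite !mxE -cabs_conj rmorphB.
Qed.

(** The matrices that commute with B together with their adjoints form a C*-subalgebra containing
    the generators, hence everything; and a matrix commuting with all matrix units is scalar. *)
Lemma irreducible_of_generated n (E1 E2 : 'M[C]_n) : (0 < n)%N ->
  E1 ^t* = E1 -> E2 ^t* = E2 ->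
  cstar_generated [set E1; E2] = [set: 'M[C]_n] -> irreducible_pair E1 E2.
Proof.
move=> n0 h1 h2 gen B BC B1 B2.
have comm (A : 'M[C]_n) : A *m B = B *m A.
  have : cstar_generated [set E1; E2] A by rewrite gen.
  move=> /(_ [set A : 'M[C]_n | A *m B = B *m A /\ A ^t* *m B = B *m A ^t*]).
  case=> //; split; last first.
    by move=> E [] -> /=; rewrite ?h1 ?h2 ?B1 ?B2.
  split=> /=.
  - by rewrite (@ct0 _ (cplx_over R)) mul0mx mulmx0.
  - by move=> X Y [x1 x2] [y1 y2]; rewrite !(@ctD _ (cplx_over R)) !mulmxDl !mulmxDr x1 x2 y1 y2.
  - by move=> a X [x1 x2]; rewrite !(@ctZ _ (cplx_over R)) -!scalemxAl -!scalemxAr x1 x2.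
  - move=> X Y [x1 x2] [y1 y2]; rewrite !(@ctM _ (cplx_over R)) -!mulmxA x2 y1.
    by rewrite !mulmxA x1 y2.
  split; last exact: commutant_closed.
  by move=> X [x1 x2]; rewrite !trmxCK.
exists (B (Ordinal n0) (Ordinal n0)); apply/matrixP => j l.
have := comm (delta_mx (Ordinal n0) j) => /matrixP/(_ (Ordinal n0) l).
rewrite !mxE (bigD1 j) //= big1 ?addr0 => [|i ij]; last first.
  by rewrite !mxE (negbTE ij) andbF mul0r.
rewrite (bigD1 (Ordinal n0)) //= big1 ?addr0 => [|i ij]; last first.
  by rewrite !mxE (negbTE ij) mulr0.
rewrite !mxE !eqxx mul1r => ->; rewrite eq_sym.
by case: (j == l); rewrite ?mulr1 ?mulr0.
Qed.
End Irreducible.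

(** * Free analytic functions *)

Section LineDerivative.
Variable R : realType.
Local Notation C := (cplx R).
Local Notation cabs := (@cabs R).
Local Notation rc := (@rc R).

Lemma mulmx_bound m n p q (A : 'M[C]_(m, n)) (B : 'M[C]_(p, q)) : exists2 K : R, 0 <= K &
  forall (M : 'M[C]_(n, p)) (e : R), (forall i j, cabs (M i j) <= e) ->
    forall i j, cabs ((A *m M *m B) i j) <= K * e.
Proof.
exists (\sum_i \sum_j \sum_k \sum_l cabs (A i k) * cabs (B l j)).
  by do 4!apply: sumr_ge0 => ? _; rewrite mulr_ge0 ?cabs_ge0.
move=> M e hM i j.
(* If M has no entry the sign of e is unknown, but then both the product and the constant are 0. *)
have [k0 _|k0] := pickP (fun _ : 'I_n => true); last first.
  have z : (A *m M *m B) i j = 0.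
    rewrite mxE big1 // => l _; rewrite mxE big1 ?mul0r // => k; by have := k0 k.
  rewrite z cabs0 big1 ?mul0r // => i' _; rewrite big1 // => j' _.
  by rewrite big1 // => k; have := k0 k.
have [l0 _|l0] := pickP (fun _ : 'I_p => true); last first.
  have z : (A *m M *m B) i j = 0.
    rewrite mxE big1 // => l; by have := l0 l.
  rewrite z cabs0 big1 ?mul0r // => i' _; rewrite big1 // => j' _.
  by rewrite big1 // => k _; rewrite big1 // => l; have := l0 l.
have e0 : 0 <= e by apply: le_trans (cabs_ge0 (M k0 l0)) (hM _ _).
have -> : (A *m M *m B) i j = \sum_k \sum_l A i k * M k l * B l j.
  rewrite mxE exchange_big /=; apply: eq_bigr => l _.
  by rewrite mxE mulr_suml.
apply: le_trans (_ : (\sum_k \sum_l cabs (A i k) * cabs (B l j)) * e <= _); last first.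
  rewrite ler_wpM2r // (bigD1 i) //= (bigD1 j) //= -addrA lerDl addr_ge0 //.
    by do 3!apply: sumr_ge0 => ? _; rewrite mulr_ge0 ?cabs_ge0.
  by do 4!apply: sumr_ge0 => ? _; rewrite mulr_ge0 ?cabs_ge0.
rewrite mulr_suml; apply: le_trans (cabs_sum _ _ _) _; apply: ler_sum => k _.
rewrite mulr_suml; apply: le_trans (cabs_sum _ _ _) _; apply: ler_sum => l _.
by rewrite !cabsM mulrAC ler_wpM2l ?mulr_ge0 ?cabs_ge0.
Qed.

Definition along n (X H : mxpair R n) (w : C) : mxpair R n := X + (w *: H.1, w *: H.2).

(** A directional derivative with quadratic remainder, which also records that nearby points of the
    line lie in D. It is transported by direct sums and unitary conjugations through mere evaluation
    of f. *)
Definition lder n (D : set (mxpair R n)) (f : mxpair R n -> 'M[C]_n) X H (A : 'M[C]_n) :=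
  exists K r : R, 0 < r /\ forall w, cabs w < r -> D (along X H w) /\
    forall i j, cabs ((f (along X H w) - f X - w *: A) i j) <= K * cabs w ^+ 2.

Lemma lder_unique n (D : set (mxpair R n)) f X H A B :
  lder D f X H A -> lder D f X H B -> A = B.
Proof.
move=> [K [r [r0 hA]]] [L [t [t0 hB]]]; apply/matrixP => i j; apply/eqP.
rewrite -subr_eq0 -cabs_eq0 eq_le cabs_ge0 andbT.
apply: (@le0_small _ _ (K + L) (Num.min r t)); first by rewrite lt_min r0.
move=> x x0; rewrite lt_min => /andP[xr xt].
have cx : cabs (rc x) = x by rewrite cabs_rc gtr0_norm.
have [|_ /(_ i j) h1] := hA (rc x); rewrite ?cx //.
have [|_ /(_ i j) h2] := hB (rc x); rewrite ?cx //.
rewrite -(ler_pM2l x0).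
have -> : x * cabs (A i j - B i j) = cabs (rc x * (A i j - B i j)).
  by rewrite cabsM cx.
move: h1 h2; rewrite !mxE cx; set F := f _ i j; set F0 := f _ i j => h1 h2.
have -> : rc x * (A i j - B i j) = (F - F0 - rc x * B i j) - (F - F0 - rc x * A i j).
  by ring.
apply: le_trans (cabsD _ _) _; rewrite cabsN; nra.
Qed.

Lemma nrm_scale n (H : mxpair R n) (w : C) : nrm (w *: H.1, w *: H.2) = cabs w * nrm H.
Proof.
rewrite /nrm mulr_sumr; apply: eq_bigr => i _; rewrite mulr_sumr; apply: eq_bigr => j _.
by rewrite !mxE !cabsM mulrDr.
Qed.

Lemma derivative_lder n (D : set (mxpair R n)) f X (G : mxpair R n -> 'M[C]_n) (t K : R) :
  (forall (z : C) H, G (z *: H.1, z *: H.2) = z *: G H) -> 0 < t ->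
  (forall H, nrm H <= t -> D (X + H)) ->
  (forall H, nrm H <= t -> forall i j, cabs ((f (X + H) - f X - G H) i j) <= K * nrm H ^+ 2) ->
  forall H, lder D f X H (G H).
Proof.
move=> GZ t0 Dt hK H; exists (K * nrm H ^+ 2), (t / (nrm H + 1)).
have n0 := nrm_ge0 H; have n1 : 0 < nrm H + 1 by lra.
split=> [|w]; first by rewrite divr_gt0.
rewrite ltr_pdivlMr // => wt; have w0 := cabs_ge0 w.
have le : nrm (w *: H.1, w *: H.2) <= t by rewrite nrm_scale; nra.
split; first exact: Dt.
by move=> i j; have := hK _ le i j; rewrite GZ nrm_scale exprMn mulrA [K * _ * _]mulrAC.
Qed.

Lemma analytic_lder n (D : set (mxpair R n)) f X : analytic_on D f -> D X ->
  exists G : mxpair R n -> 'M[C]_n,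
  [/\ forall H H', G (H + H') = G H + G H',
      forall (z : C) H, G (z *: H.1, z *: H.2) = z *: G H & forall H, lder D f X H (G H)].
Proof.
move=> hf DX; have [G [GD GZ [t t0 [Dt [K K0 hK]]]]] := analytic_derivative hf DX.
by exists G; split=> //; apply: derivative_lder GZ t0 Dt hK.
Qed.

(** By uniqueness, a formula found one direction at a time inherits the remainder bound that
    analyticity gives uniformly. *)
Lemma lder_uniform n (D : set (mxpair R n)) f X (A : mxpair R n -> 'M[C]_n) :
  analytic_on D f -> D X -> (forall H, lder D f X H (A H)) ->
  exists K t : R, [/\ 0 < t, 0 <= K & forall H, nrm H <= t -> D (X + H) /\
    forall i j, cabs ((f (X + H) - f X - A H) i j) <= K * nrm H ^+ 2].
Proof.
move=> hf DX hA; have [G [GD GZ [t t0 [Dt [K K0 hK]]]]] := analytic_derivative hf DX.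
have GA H : G H = A H by apply: lder_unique (derivative_lder GZ t0 Dt hK H) (hA H).
exists K, t; split=> // H Ht; split; first exact: Dt.
by rewrite -GA; apply: hK.
Qed.

Lemma lder_dsum n m (D : set (mxpair R n)) (D' : set (mxpair R m))
    (D2 : set (mxpair R (n + m))) f f' f2 X X' H H' A A' :
  (forall Y Y', D Y -> D' Y' -> D2 (dsum_pair Y Y')) ->
  (forall Y Y', D Y -> D' Y' -> f2 (dsum_pair Y Y') = dsum_mx (f Y) (f' Y')) ->
  D X -> D' X' ->
  lder D f X H A -> lder D' f' X' H' A' ->
  lder D2 f2 (dsum_pair X X') (dsum_pair H H') (dsum_mx A A').
Proof.
move=> hD hf DX DX' [K [r [r0 hA]]] [L [t [t0 hB]]].
exists (`|K| + `|L|), (Num.min r t); rewrite lt_min r0 t0; split=> // w.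
rewrite lt_min => /andP[wr wt]; have [D1 h1] := hA w wr; have [D1' h2] := hB w wt.
have sE : along (dsum_pair X X') (dsum_pair H H') w = dsum_pair (along X H w) (along X' H' w).
  rewrite /along /dsum_pair /dsum_mx /= !scale_block_mx !scaler0.
  by rewrite /GRing.add /= /add_pair /= !add_block_mx !addr0.
rewrite sE; split; first exact: hD.
rewrite !hf // /dsum_mx scale_block_mx !scaler0 !opp_block_mx !add_block_mx !oppr0 !addr0.
move=> i j; have k0 : 0 <= (`|K| + `|L|) * cabs w ^+ 2.
  by rewrite mulr_ge0 ?addr_ge0 ?exprn_ge0 ?cabs_ge0.
have bK : K * cabs w ^+ 2 <= (`|K| + `|L|) * cabs w ^+ 2.
  by rewrite ler_wpM2r ?exprn_ge0 ?cabs_ge0 //; have := ler_norm K; have := normr_ge0 L; lra.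
have bL : L * cabs w ^+ 2 <= (`|K| + `|L|) * cabs w ^+ 2.
  by rewrite ler_wpM2r ?exprn_ge0 ?cabs_ge0 //; have := ler_norm L; have := normr_ge0 K; lra.
case: (split_ordP i) => i' ->; case: (split_ordP j) => j' ->.
- by rewrite block_mxEul; apply: le_trans (h1 i' j') bK.
- by rewrite block_mxEur mxE cabs0.
- by rewrite block_mxEdl mxE cabs0.
- by rewrite block_mxEdr; apply: le_trans (h2 i' j') bL.
Qed.

Lemma lder_unitary n (D : set (mxpair R n)) f X H A U :
  (forall Y, D Y -> D (uconj_pair U Y)) ->
  (forall Y, D Y -> f (uconj_pair U Y) = uconj_mx U (f Y)) ->
  D X -> lder D f X H A ->
  lder D f (uconj_pair U X) (uconj_pair U H) (uconj_mx U A).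
Proof.
move=> hD hf DX [K [r [r0 hA]]].
have [B B0 hB] := mulmx_bound (U ^t*) U.
exists (B * K), r; split=> // w wr; have [D1 h1] := hA w wr.
have sE : along (uconj_pair U X) (uconj_pair U H) w = uconj_pair U (along X H w).
  have e (A1 A2 : 'M[C]_n) : U ^t* *m A1 *m U + w *: (U ^t* *m A2 *m U)
      = U ^t* *m (A1 + w *: A2) *m U.
    by rewrite mulmxDr mulmxDl -scalemxAr -scalemxAl.
  exact: (congr2 pair (e _ _) (e _ _)).
rewrite sE; split; first exact: hD.
rewrite !hf // => i j; rewrite -mulrA.
have -> : uconj_mx U (f (along X H w)) - uconj_mx U (f X) - w *: uconj_mx U A
    = U ^t* *m (f (along X H w) - f X - w *: A) *m U.
  by rewrite /uconj_mx !mulmxBr !mulmxBl -scalemxAr -scalemxAl.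
by apply: hB.
Qed.
End LineDerivative.

Lemma hermitian_parts (C : numClosedFieldType) n (A : 'M[C]_n) : exists A1 A2 : 'M[C]_n,
  [/\ A1 ^t* = A1, A2 ^t* = A2 & A = A1 + 'i *: A2].
Proof.
have h2 : (2^-1 : C)^* = 2^-1 by rewrite fmorphV rmorph_nat.
have two : (2 : C) != 0 by rewrite pnatr_eq0.
exists (2^-1 *: (A + A ^t*)), ((2^-1 * 'i) *: (A ^t* - A)); split; apply/matrixP => i j.
- by rewrite !mxE !(rmorphM, rmorphD) /= h2 conjCK addrC.
- rewrite !mxE !(rmorphM, rmorphB) /= h2 conjCi conjCK; ring.
rewrite !mxE mulrA [in 'i * _]mulrCA -expr2 sqrCi.
by move: (A i j) (_^*) => x y; field.
Qed.

(** * Derivative of a free function at a scalar point *)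

Section FreeDerivative.
Variables (R : realType) (P : forall n, set (mxpair R n)).
Local Notation C := (cplx R).
Local Notation rc := (@rc R).
Arguments P {n}.
Hypothesis P_dsum : forall n m (X : mxpair R n) (Y : mxpair R m),
  P X -> P Y -> P (dsum_pair X Y).
Hypothesis P_unitary : forall n (X : mxpair R n) U,
  U \is unitarymx -> P X -> P (uconj_pair U X).

Definition slot n (i : bool) (A : 'M[C]_n) : mxpair R n := if i then (A, 0) else (0, A).

Lemma slotD n i (A B : 'M[C]_n) : slot i (A + B) = slot i A + slot i B.
Proof. by case: i; rewrite /slot /GRing.add /= /add_pair /= addr0. Qed.
Lemma slotZ n i (z : C) (A : 'M[C]_n) :
  slot i (z *: A) = (z *: (slot i A).1, z *: (slot i A).2).
Proof. by case: i; rewrite /slot /= scaler0. Qed.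

Lemma sc_dsum n m (b : C * C) : sc (n + m) b = dsum_pair (sc n b) (sc m b).
Proof. by rewrite /sc /dsum_pair /dsum_mx /= -!scalar_mx_block. Qed.

Lemma slot_dsum n m i (A : 'M[C]_n) (B : 'M[C]_m) :
  slot i (dsum_mx A B) = dsum_pair (slot i A) (slot i B).
Proof. by case: i; rewrite /slot /dsum_pair /dsum_mx /= block_mx0. Qed.

Lemma uconj_scalar n (U : 'M[C]_n) (a : C) : U \is unitarymx -> uconj_mx U a%:M = a%:M.
Proof.
move=> /unitarymxP hU; have UU : U ^t* *m U = 1%:M by apply: mulmx1C.
by rewrite /uconj_mx mul_mx_scalar -scalemxAl UU scalemx1.
Qed.

Lemma uconj_sc n (U : 'M[C]_n) b : U \is unitarymx -> uconj_pair U (sc n b) = sc n b.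
Proof. by move=> hU; rewrite /uconj_pair /sc /= !uconj_scalar. Qed.

Lemma uconj_slot n (U : 'M[C]_n) i A : uconj_pair U (slot i A) = slot i (uconj_mx U A).
Proof. by case: i; rewrite /uconj_pair /slot /uconj_mx /= mulmx0 mul0mx. Qed.

Variable f : forall n, mxpair R n -> 'M[C]_n.
Arguments f {n}.
Hypothesis hf : free_analytic_fun (@P) (@f).
Variable b : C * C.
Hypothesis Pb : forall n, (0 < n)%N -> P (sc n b).

Lemma free_at_scalar : exists be : C, forall n, (0 < n)%N -> f (sc n b) = be%:M.
Proof.
have [_ fd _] := hf.
exists (f (sc 1 b) 0 0) => n; elim: n => [//|[|n] IH _].
  by rewrite [LHS]mx11_scalar.
have := fd 1%N n.+1 _ _ isT isT (Pb (n := 1) isT) (Pb (n := n.+1) isT); rewrite -sc_dsum => ->.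
by rewrite IH // /dsum_mx {1}[f (sc 1 b)]mx11_scalar -scalar_mx_block.
Qed.

(* On diagonal directions the derivative is computed through direct sums, on hermitian ones by
   diagonalization, and then on all of them by complex linearity. *)
Lemma free_derivative : exists al : bool -> C, forall n, (0 < n)%N ->
  forall H, lder (@P n) (@f n) (sc n b) H (al true *: H.1 + al false *: H.2).
Proof.
have [fa fd fu] := hf.
have [G1 [_ G1Z hG1]] := analytic_lder (fa 1%N isT) (Pb (n := 1) isT).
pose al i := G1 (slot i 1%:M) 0 0; exists al.
have diag n i (d : 'rV[C]_n) : (0 < n)%N ->
    lder (@P n) (@f n) (sc n b) (slot i (diag_mx d)) (al i *: diag_mx d).
  elim: n d => [//|n IH] d _.
  have d1 (e : 'rV[C]_1) : lder (@P 1) (@f 1) (sc 1 b) (slot i (diag_mx e)) (al i *: diag_mx e).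
    have -> : diag_mx e = e 0 0 *: 1%:M.
      by apply/matrixP => j k; rewrite !ord1 !mxE mulr1.
    have -> : al i *: (e 0 0 *: 1%:M) = G1 (slot i (e 0 0 *: 1%:M)).
      rewrite slotZ G1Z [G1 _]mx11_scalar -/(al i) scalerA mulrC -scalerA scalemx1.
      by [].
    exact: hG1.
  case: n IH d => [|n] IH d; first exact: d1.
  have := @lder_dsum _ _ _ _ _ (@P (1 + n.+1)) (@f 1) (@f n.+1) (@f (1 + n.+1)) _ _ _ _ _ _
    (@P_dsum 1 n.+1) (fun Y Y' => fd 1%N n.+1 Y Y' isT isT) (Pb (n := 1) isT)
    (Pb (n := n.+1) isT) (d1 (@lsubmx _ 1 1 n.+1 d)) (IH (@rsubmx _ 1 1 n.+1 d) isT).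
  rewrite -sc_dsum -slot_dsum.
  have -> : dsum_mx (al i *: diag_mx (@lsubmx _ 1 1 n.+1 d))
      (al i *: diag_mx (@rsubmx _ 1 1 n.+1 d)) = al i *: diag_mx d.
    have e := scale_block_mx (al i) (diag_mx (@lsubmx _ 1 1 n.+1 d)) 0 0
      (diag_mx (@rsubmx _ 1 1 n.+1 d)).
    by rewrite !scaler0 -diag_mx_row hsubmxK in e; rewrite /dsum_mx -e.
  by rewrite /dsum_mx -diag_mx_row hsubmxK.
have herm n i (H : 'M[C]_n) : (0 < n)%N -> H ^t* = H ->
    lder (@P n) (@f n) (sc n b) (slot i H) (al i *: H).
  move=> n0 /(@herm_spectral R (cplx_over R)) [U [d [hU ->]]].
  set D := diag_mx _.
  have uZ : uconj_mx U (al i *: D) = al i *: (U ^t* *m D *m U).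
    by rewrite /uconj_mx -scalemxAr -scalemxAl.
  have := lder_unitary (fun Y => P_unitary hU) (fun Y hY => fu n Y U n0 hY hU) (Pb n0)
    (diag n i (\row_j rc (d j)) n0).
  by rewrite (uconj_sc b hU) (uconj_slot U i D) uZ.
move=> n n0 H; have [G [GD GZ hG]] := analytic_lder (fa n n0) (Pb n0).
have Gh i (A : 'M[C]_n) : A ^t* = A -> G (slot i A) = al i *: A.
  by move=> hA; apply: lder_unique (hG _) (herm n i A n0 hA).
have Gs i (A : 'M[C]_n) : G (slot i A) = al i *: A.
  have [A1 [A2 [c1 c2 AE]]] := hermitian_parts A.
  have -> : slot i A = slot i A1 + ('i *: (slot i A2).1, 'i *: (slot i A2).2).
    by rewrite -slotZ -slotD -AE.
  by rewrite GD GZ (Gh i A1 c1) (Gh i A2 c2) scalerA mulrC -scalerA -scalerDr -AE.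
have -> : al true *: H.1 + al false *: H.2 = G H.
  rewrite -!Gs -GD; congr G; rewrite /slot /GRing.add /= /add_pair /= addr0 add0r.
  by case: H.
exact: hG.
Qed.
End FreeDerivative.

Section UpperScale.
Variables (R : realType) (C : complexOver R) (s : nat) (C1 C2 : 'M[C]_s).

Definition phase p q (u : C) : 'M[C]_(p + q) := block_mx 1%:M 0 0 u%:M.

Lemma phase_unitary p q u : absF u = 1 -> phase p q u \is unitarymx.
Proof.
move=> u1; apply/unitarymxP.
rewrite /phase ct_block !ct0 ct1 tr_scalar_mx map_scalar_mx mulmx_block.
rewrite !(mul0mx, mulmx0, addr0, add0r, mulmx1) -scalar_mxM absF1_conj //.
by rewrite -scalar_mx_block.
Qed.

Lemma phase_conj p q u (A : 'M[C]_p) (B : 'M[C]_(p, q)) D (E : 'M[C]_q) : absF u = 1 ->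
  (phase p q u) ^t* *m block_mx A B D E *m phase p q u = block_mx A (u *: B) (u^* *: D) E.
Proof.
move=> u1; rewrite /phase ct_block !ct0 ct1 tr_scalar_mx map_scalar_mx !mulmx_block.
rewrite !(mul0mx, mulmx0, addr0, add0r, mul1mx, mulmx1).
rewrite !mul_mx_scalar !mul_scalar_mx scalerA absF1_conj // scale1r.
by [].
Qed.

(** Here b stays fixed, unlike in [pencil_pos_scale]. Conjugation by diag(1, u) handles |u| = 1, and
    a convex combination of two opposite rotations the rest. *)
Lemma pencil_pos_upper_scale p q (b : C * C) (h : 'M[C]_(p, q) * 'M[C]_(p, q)) (z : C) :
  absF z <= 1 -> pencil_pos C1 C2 (upper b h) -> pencil_pos C1 C2 (upper b (z *: h.1, z *: h.2)).
Proof.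
move=> z1 Ph.
have rot u : absF u = 1 -> pencil_pos C1 C2 (upper b (u *: h.1, u *: h.2)).
  move=> u1; have := pencil_pos_unitary (phase_unitary p q u1) Ph.
  by rewrite /upper /= !phase_conj // !scaler0.
have [v v1 vE] : exists2 v : C, absF v = 1 & z = rcF (absF z) * v.
  have [w w1 wE] := rotate_to_absF z; exists w^*.
    by apply/eqP; rewrite -sqrp_eq1 ?absF_ge0 // absF_sqr conjCK mulrC -absF_sqr w1 expr1n.
  by rewrite -wE mulrAC absF1_conj // mul1r.
(* Chosen so that t v - (1 - t) v = |z| v. *)
pose t := (1 + absF z) / 2.
have t0 : 0 <= t by rewrite /t; have := absF_ge0 z; lra.
have t1 : t <= 1 by rewrite /t; lra.
have nv : absF (- v) = 1 by rewrite absFN.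
have := pencil_pos_convex t0 t1 (rot v v1) (rot (- v) nv).
congr (pencil_pos _ _ _); rewrite /upper /GRing.add /= /add_pair /= !scale_block_mx !scaler0.
have e (A : 'M[C]_(p, q)) : rcF t *: (v *: A) + rcF (1 - t) *: (- v *: A) = z *: A.
  rewrite scaleNr scalerN -scalerBl -rmorphB scalerA [in RHS]vE; congr (rcF _ * _ *: _).
  by rewrite /t; lra.
have f m (a : C) : rcF t *: a%:M + rcF (1 - t) *: a%:M = a%:M :> 'M[C]_m.
  by rewrite -scalerDl -rmorphD subrKC rmorph1 scale1r.
by rewrite !add_block_mx !e !f !addr0.
Qed.
End UpperScale.

(** * Free functions on upper triangular matrices *)

Section Triangular.
Variable R : realType.
Local Notation C := (cplx R).
Local Notation cabs := (@cabs R).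

(** The quotient (g - z a) / z equals c - a on the circle and 0 at the origin, while a jet constant
    on the circle is constant on the disc. *)
Lemma homogeneous_linear (g : C -> C) c a : (forall z, cabs z <= 1 -> jet g z) ->
  (forall z, cabs z = 1 -> g z = z * c) -> bigOat0 (fun z => g z - z * a) 2 -> c = a.
Proof.
move=> jg hc O2; pose G z := g z - z * a.
have jG z : cabs z <= 1 -> jet G z.
  by move=> z1; apply: jetB; [exact: jg|apply: jetM; [exact: jet_id|exact: jet_cst]].
have jG0 : jet G 0 by apply: jG; rewrite cabs0.
have G0 : G 0 = 0 by apply: bigOat0_eq0 jG0 O2.
have [h jh hE] := jet_div jG0 G0.
have hV z : z != 0 -> h z = G z * z^-1 by have [_] := hE z.
have h0 : h 0 = 0 by apply: (bigOat0_eq0 jh); apply: (bigOat0_div hV O2).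
have jhz z : cabs z <= 1 -> jet h z.
  have [->//|z0 z1] := eqVneq z 0.
  apply: (@near_jet _ (fun z => G z * z^-1) _ z (cabs z)); first by rewrite cabs_gt0.
    move=> w wz; rewrite hV //; apply: contraTneq wz => e.
    have -> : w = - z by apply/eqP; rewrite -addr_eq0 addrC e.
    by rewrite cabsN ltxx.
  by apply: jetM; [exact: jG|exact: jetV].
have := @circle_const _ h (c - a) jhz.
have circ z : cabs z = 1 -> h z = c - a.
  move=> z1; have z0 : z != 0 by rewrite -cabs_eq0 z1 oner_eq0.
  by rewrite hV // /G hc // -mulrBr mulrAC divff // mul1r.
move=> /(_ circ 0); rewrite cabs0 h0 => /(_ ler01)/esym/eqP.
by rewrite subr_eq0 => /eqP.
Qed.

Variable P : forall n, set (mxpair R n).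
Arguments P {n}.
Hypothesis P_dsum : forall n m (X : mxpair R n) (Y : mxpair R m),
  P X -> P Y -> P (dsum_pair X Y).
Hypothesis P_unitary : forall n (X : mxpair R n) U,
  U \is unitarymx -> P X -> P (uconj_pair U X).
Hypothesis P_upper_scale : forall p q b (h : 'M[C]_(p, q) * 'M[C]_(p, q)) z,
  cabs z <= 1 -> P (upper b h) -> P (upper b (z *: h.1, z *: h.2)).

Variable f : forall n, mxpair R n -> 'M[C]_n.
Arguments f {n}.
Hypothesis hf : free_analytic_fun (@P) (@f).
Variable b : C * C.
Hypothesis Pb : forall n, (0 < n)%N -> P (sc n b).

(* Rotating h amounts to a conjugation by diag(1, u), so the blocks of f (upper b (z h)) are
   homogeneous on the unit circle in z. *)
Lemma free_upper : exists (be : C) (al : bool -> C),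
  [/\ forall n, (0 < n)%N -> f (sc n b) = be%:M,
      forall n, (0 < n)%N -> forall H,
        lder (@P n) (@f n) (sc n b) H (al true *: H.1 + al false *: H.2) &
      forall p q (h : 'M[C]_(p, q) * 'M[C]_(p, q)), (0 < p)%N -> (0 < q)%N ->
        P (upper b h) ->
        f (upper b h) = block_mx be%:M (al true *: h.1 + al false *: h.2) 0 be%:M].
Proof.
have [fa _ fu] := hf.
have [be hbe] := free_at_scalar hf Pb.
have [al hal] := free_derivative P_dsum P_unitary hf Pb.
exists be, al; split=> // p q h p0 q0 Ph.
have n0 : (0 < p + q)%N by rewrite addn_gt0 p0.
pose X z : mxpair R (p + q) := upper b (z *: h.1, z *: h.2).
have PX z : cabs z <= 1 -> P (X z) by move=> z1; apply: P_upper_scale.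
have X1 : X 1 = upper b h by rewrite /X !scale1r -surjective_pairing.
have X0 : X 0 = sc (p + q) b by rewrite /X !scale0r /upper /sc /= -!scalar_mx_block.
have jX z : jetp X z.
  have e (a : C) (A : 'M[C]_(p, q)) : jetm (fun z => block_mx a%:M (z *: A) 0 a%:M) z.
    move=> i j; case: (split_ordP i) => i' ->; case: (split_ordP j) => j' ->.
    - by apply: eq_jet (jet_cst (a%:M i' j') z) => w; rewrite block_mxEul.
    - apply: eq_jet (jetM (jet_id z) (jet_cst (A i' j') z)) => w.
      by rewrite block_mxEur mxE.
    - by apply: eq_jet (jet_cst 0 z) => w; rewrite block_mxEdl mxE.
    - by apply: eq_jet (jet_cst (a%:M i' j') z) => w; rewrite block_mxEdr.
  by split; apply: e.
have jf z i j : cabs z <= 1 -> jet (fun z => f (X z) i j) z.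
  by move=> z1; apply: (analytic_jet (fa _ n0) (jX z) (PX z z1)).
have rotX u : cabs u = 1 -> f (X u) = uconj_mx (phase p q (u : cplx_over R)) (f (X 1)).
  move=> u1; rewrite -fu //; [|by rewrite X1|exact: phase_unitary].
  congr f; rewrite /X /uconj_pair /uconj_mx /upper /=.
  by rewrite !(@phase_conj R (cplx_over R)) // !scale1r !scaler0.
have [A [B [D [E fX1]]]] : exists (A : 'M[C]_p) (B : 'M[C]_(p, q)) (D : 'M[C]_(q, p))
    (E : 'M[C]_q), f (X 1) = block_mx A B D E.
  exists (ulsubmx (f (X 1))), (ursubmx (f (X 1))), (dlsubmx (f (X 1))), (drsubmx (f (X 1))).
  by rewrite submxK.
have rot u : cabs u = 1 -> f (X u) = block_mx A (u *: B) (u^* *: D) E.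
  by move=> u1; rewrite rotX // fX1 /uconj_mx (@phase_conj R (cplx_over R)).
have fX0 : f (X 0) = block_mx be%:M 0 0 be%:M by rewrite X0 hbe // -scalar_mx_block.
have c0 : cabs (0 : C) <= 1 by rewrite cabs0.
rewrite -X1 fX1; congr block_mx; apply/matrixP => i j.
- have := @circle_const _ (fun z => f (X z) (lshift q i) (lshift q j)) (A i j) _ _ 0 c0.
  rewrite fX0 block_mxEul => e; rewrite -e //; first by move=> z z1; apply: jf.
  by move=> z z1; rewrite rot // block_mxEul.
- apply: (@homogeneous_linear (fun z => f (X z) (lshift q i) (rshift p j))).
  + by move=> z z1; apply: jf.
  + by move=> z z1; rewrite rot // block_mxEur mxE.
  have [K [r [r0 hK]]] := hal _ n0 (block_mx 0 h.1 0 0, block_mx 0 h.2 0 0).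
  exists K, r; split=> // w _ wr; have [_ /(_ (lshift q i) (rshift p j))] := hK w wr.
  have -> : along (sc (p + q) b) (block_mx 0 h.1 0 0, block_mx 0 h.2 0 0) w = X w.
    rewrite /along /X /sc /upper /GRing.add /= /add_pair /= !scale_block_mx !scaler0.
    by rewrite !(scalar_mx_block p q) !add_block_mx !addr0 !add0r.
  have ent (Y Z Z1 Z2 : 'M[C]_(p + q)) a1 a2 i' j' : (Y - Z - w *: (a1 *: Z1 + a2 *: Z2)) i' j'
      = Y i' j' - Z i' j' - w * (a1 * Z1 i' j' + a2 * Z2 i' j').
    by rewrite !mxE.
  have -> : (al true *: h.1 + al false *: h.2) i j = al true * h.1 i j + al false * h.2 i j.
    by rewrite !mxE.
  by rewrite -X0 fX0 ent !block_mxEur [(0 : 'M[C]_(p, q)) i j]mxE subr0.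
(* On the circle the lower left block is u^-1 D; multiplied by z it is the constant D there, and 0
   at the origin. *)
- have := @circle_const _ (fun z => z * f (X z) (rshift p i) (lshift q j)) (D i j) _ _ 0 c0.
  rewrite mul0r => e; rewrite [RHS]mxE -e //.
    by move=> z z1; apply: jetM; [exact: jet_id|apply: jf].
  move=> z z1; rewrite rot // block_mxEdl mxE mulrA.
  by rewrite (@absF1_conj R (cplx_over R)) // mul1r.
- have := @circle_const _ (fun z => f (X z) (rshift p i) (rshift p j)) (E i j) _ _ 0 c0.
  rewrite fX0 block_mxEdr => -> //; first by move=> z z1; apply: jf.
  by move=> z z1; rewrite rot // block_mxEdr.
Qed.
End Triangular.

(** * Automorphisms *)

Section LinearAction.
Variables (R : realType) (C : complexOver R).

Definition lin (l : 'M[C]_2) p q (h : 'M[C]_(p, q) * 'M[C]_(p, q)) :=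
  (l 0 0 *: h.1 + l 0 1 *: h.2, l 1 0 *: h.1 + l 1 1 *: h.2).

Lemma mulmx2 (l m : 'M[C]_2) i j : (l *m m) i j = l i 0 * m 0 j + l i 1 * m 1 j.
Proof. by rewrite mxE big_ord_recl big_ord1; congr (_ + l _ _ * m _ _); apply: val_inj. Qed.

Lemma lin_mul (l m : 'M[C]_2) p q (h : 'M[C]_(p, q) * 'M[C]_(p, q)) :
  lin l (lin m h) = lin (l *m m) h.
Proof.
rewrite /lin /= !mulmx2 !scalerDr !scalerA !scalerDl.
by congr pair; rewrite addrACA.
Qed.

Lemma lin1 p q (h : 'M[C]_(p, q) * 'M[C]_(p, q)) : lin 1%:M h = h.
Proof. by rewrite /lin !mxE /= !scale1r !scale0r addr0 add0r -surjective_pairing. Qed.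

Lemma linZ (l : 'M[C]_2) p q (z : C) (h : 'M[C]_(p, q) * 'M[C]_(p, q)) :
  lin l (z *: h.1, z *: h.2) = (z *: (lin l h).1, z *: (lin l h).2).
Proof. by rewrite /lin /= !scalerDr !scalerA !(mulrC z). Qed.

Lemma lin_scale (l : 'M[C]_2) p q (z : C) (h : 'M[C]_(p, q) * 'M[C]_(p, q)) :
  lin (z *: l) h = (z *: (lin l h).1, z *: (lin l h).2).
Proof. by rewrite /lin /= !scalerDr !scalerA !mxE. Qed.

Variables (s : nat) (C1 C2 : 'M[C]_s).

Lemma Lb0 : Lb C1 C2 0 = 1%:M.
Proof. by rewrite /Lb LamE /= !scale0r addr0 (@ct0 R C) !addr0. Qed.

(** Taking for h the entrywise conjugates of B1 and B2 turns both conditions on upper triangular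
    matrices into pairings with B. The two directions are the columns of l. *)
Lemma same_ball_of_upper b (l : 'M[C]_2) : pd (Lb C1 C2 b) ->
  (forall p q (h : 'M[C]_(p, q) * 'M[C]_(p, q)), (0 < p)%N -> (0 < q)%N ->
     pencil_pos C1 C2 (upper 0 h) <-> pencil_pos C1 C2 (upper b (lin l h))) ->
  same_ball (Lb C1 C2 b) (N1 C1 C2) (N2 C1 C2) (Lam C1 C2 (l 0 0, l 1 0))
    (Lam C1 C2 (l 0 1, l 1 1)).
Proof.
move=> pL hP p q B1 B2.
have YZ0 m n (Y : 'M[C]_(_, m)) (Z : 'M[C]_(_, n)) : (Y != 0) || (Z != 0) -> 0 < nn Y + nn Z.
  have [->|Y0] /= := eqVneq Y 0; first by rewrite nn0 add0r nn_gt0.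
  by move=> _; rewrite ltr_pwDl ?nn_gt0 ?nn_ge0.
have LYZ m n (Y : 'M[C]_(_, m)) (Z : 'M[C]_(_, n)) : (Y != 0) || (Z != 0) ->
    0 < ip Y (Lb C1 C2 b *m Y) + ip Z (Lb C1 C2 b *m Z).
  have ge r (X : 'M[C]_(_, r)) : 0 <= ip X (Lb C1 C2 b *m X).
    by have [->|X0] := eqVneq X 0; [rewrite ip0l|apply/ltW/pd_mx].
  have [->|Y0] /= := eqVneq Y 0; first by move=> Z0; rewrite ip0l add0r pd_mx.
  by move=> _; rewrite ltr_pwDl ?pd_mx.
(* The hypothesis covers nonempty blocks only; for an empty one the pairings vanish and both forms
   are positive. *)
have [p0|p0] := posnP p.
  have b0 A1 A2 Y Z : bform A1 A2 B1 B2 Y Z = 0.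
    move: B1 B2 Y Z; rewrite p0 => B1' B2' Y Z.
    by rewrite /bform (thinmx0 Y) !ip0l addr0.
  by split=> _ Y Z YZ; rewrite b0 mulr0 addr0; [apply: LYZ|apply: YZ0].
have [q0|q0] := posnP q.
  have b0 A1 A2 Y Z : bform A1 A2 B1 B2 Y Z = 0.
    move: B1 B2 Y Z; rewrite q0 => B1' B2' Y Z.
    by rewrite /bform (thinmx0 Z) !mulmx0 !mul0mx !ip0r addr0.
  by split=> _ Y Z YZ; rewrite b0 mulr0 addr0; [apply: LYZ|apply: YZ0].
pose h : 'M[C]_(p, q) * 'M[C]_(p, q) := ((B1 ^t*)^T, (B2 ^t*)^T).
have := hP p q h p0 q0; rewrite !pencil_pos_upper Lb0.
have eM (Y : 'M[C]_(_, p)) (Z : 'M[C]_(_, q)) :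
   ip Y (N1 C1 C2 *m Z *m (lin l h).1^T) + ip Y (N2 C1 C2 *m Z *m (lin l h).2^T)
   = bform (Lam C1 C2 (l 0 0, l 1 0)) (Lam C1 C2 (l 0 1, l 1 1)) B1 B2 Y Z.
  have tD (A B : 'M[C]_(q, p)) (x y : C) : (x *: A^T + y *: B^T)^T = x *: A + y *: B.
    by apply/matrixP => i j; rewrite !mxE.
  rewrite /bform !LamE /lin /h /= !tD !mulmxDr !mulmxDl -!scalemxAr -!scalemxAl !ipDr.
  by rewrite addrACA.
have eN (Y : 'M[C]_(_, p)) (Z : 'M[C]_(_, q)) :
   ip Y (N1 C1 C2 *m Z *m h.1^T) + ip Y (N2 C1 C2 *m Z *m h.2^T)
   = bform (N1 C1 C2) (N2 C1 C2) B1 B2 Y Z.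
  by rewrite /bform /h /= !trmxK.
case=> H1 H2; split=> H Y Z YZ.
  rewrite -eM; apply: H1 => // Y' Z' YZ'; rewrite eN !mul1mx; exact: H.
have := H2 _ Y Z YZ; rewrite eN !mul1mx; apply => Y' Z' YZ'.
by rewrite eM; apply: H.
Qed.
End LinearAction.

(** * Derivatives of free maps at scalar points *)

Section Tangent.
Variables (R : realType) (P : forall n, set (mxpair R n)).
Local Notation C := (cplx R).
Local Notation cabs := (@cabs R).
Local Notation rc := (@rc R).
Arguments P {n}.
Hypothesis P_dsum : forall n m (X : mxpair R n) (Y : mxpair R m),
  P X -> P Y -> P (dsum_pair X Y).
Hypothesis P_unitary : forall n (X : mxpair R n) U,
  U \is unitarymx -> P X -> P (uconj_pair U X).
Hypothesis P_upper_scale : forall p q b (h : 'M[C]_(p, q) * 'M[C]_(p, q)) z,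
  cabs z <= 1 -> P (upper b h) -> P (upper b (z *: h.1, z *: h.2)).
Hypothesis P_sc : forall n b, (0 < n)%N -> P (sc 1 b) -> P (sc n b).

Implicit Types phi psi : forall n, mxpair R n -> mxpair R n.

(** The derivative at b acts on matrix directions through one 2 x 2 matrix, the same for all
    sizes. *)
Definition tangent phi (b b' : C * C) (l : 'M[C]_2) :=
  [/\ forall n, (0 < n)%N -> phi n (sc n b) = sc n b',
      forall n, (0 < n)%N -> forall H,
        lder (@P n) (fun X => (phi n X).1) (sc n b) H (lin l H).1 /\
        lder (@P n) (fun X => (phi n X).2) (sc n b) H (lin l H).2 &
      forall p q (h : 'M[C]_(p, q) * 'M[C]_(p, q)), (0 < p)%N -> (0 < q)%N ->
        P (upper b h) -> phi (p + q)%N (upper b h) = upper b' (lin l h)].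

Lemma sc_inj n (b b' : C * C) : (0 < n)%N -> sc n b = sc n b' -> b = b'.
Proof.
move=> n0 [/matrixP/(_ (Ordinal n0) (Ordinal n0)) + /matrixP/(_ (Ordinal n0) (Ordinal n0))].
by rewrite !mxE !eqxx !mulr1n; case: b b' => ? ? [? ?] /= -> ->.
Qed.

Lemma upper_inj p q b b' (h h' : 'M[C]_(p, q) * 'M[C]_(p, q)) : upper b h = upper b' h' -> h = h'.
Proof.
by case=> /eq_block_mx[_ + _ _] /eq_block_mx[_ + _ _]; case: h h' => ? ? [? ?] /= -> ->.
Qed.

Lemma tangent_exists phi b : free_analytic_map (@P) phi -> P (sc 1 b) ->
  exists b' l, P (sc 1 b') /\ tangent phi b b' l.
Proof.
move=> [f1 f2 fP] Pb1.
have Pb n (n0 : (0 < n)%N) := P_sc n0 Pb1.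
have [be1 [al1 [s1 d1 u1]]] := free_upper P_dsum P_unitary P_upper_scale f1 Pb.
have [be2 [al2 [s2 d2 u2]]] := free_upper P_dsum P_unitary P_upper_scale f2 Pb.
pose l : 'M[C]_2 := \matrix_(i, j) (if i == 0 then al1 else al2) (j == 0).
have sE n : (0 < n)%N -> phi n (sc n b) = sc n (be1, be2).
  by move=> n0; rewrite [LHS]surjective_pairing s1 // s2.
have lE p q (h : 'M[C]_(p, q) * 'M[C]_(p, q)) :
    lin l h = (al1 true *: h.1 + al1 false *: h.2, al2 true *: h.1 + al2 false *: h.2).
  by rewrite /lin !mxE.
exists (be1, be2), l; split; first by rewrite -sE //; apply: fP.
split=> // [n n0 H|p q h p0 q0 Ph]; first by rewrite lE; split; [exact: d1|exact: d2].
by rewrite lE [LHS]surjective_pairing; congr pair; [exact: u1|exact: u2].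
Qed.

(** Small nonzero corners in either coordinate stay in the domain, by the domain clause of [lder];
    such points test a 2 x 2 matrix on a basis. *)
Lemma upper_nbhd phi b b' l i : tangent phi b b' l ->
  exists2 e : R, 0 < e & P (upper b (if i then ((rc e)%:M : 'M[C]_1, 0) else (0, (rc e)%:M))).
Proof.
case=> _ /(_ 2%N isT) h _.
pose B : 'M[C]_(1 + 1) := block_mx 0 1%:M 0 0.
have [[K [r [r0 hr]]] _] := h (slot i B).
exists (r / 2); first by rewrite divr_gt0.
have wr : cabs (rc (r / 2)) < r by rewrite cabs_rc gtr0_norm; lra.
have [+ _] := hr _ wr; congr P.
have e (a : C) : a%:M = block_mx a%:M 0 0 a%:M :> 'M[C]_(1 + 1) by rewrite -scalar_mx_block.
have eB (a w : C) : a%:M + w *: B = block_mx a%:M w%:M 0 a%:M.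
  by rewrite e /B scale_block_mx !scaler0 add_block_mx !addr0 add0r scalemx1.
have e0 (a w : C) : a%:M + w *: 0 = block_mx a%:M 0 0 a%:M :> 'M[C]_(1 + 1).
  by rewrite scaler0 addr0 e.
by case: i {hr}; apply/esym; congr pair; rewrite /= ?eB ?e0.
Qed.

(** A chain rule without differentiation: the composite is evaluated at two upper triangular points
    whose corners span C^2. *)
Lemma tangent_comp phi psi b b' b'' l l' : free_analytic_map (@P) phi ->
  (forall n (X : mxpair R n), (0 < n)%N -> P X -> psi n (phi n X) = X) ->
  P (sc 1 b) -> tangent phi b b' l -> tangent psi b' b'' l' -> b'' = b /\ l' *m l = 1%:M.
Proof.
move=> [_ _ fP] inv Pb t1 t2.
have [s1 _ u1] := t1; have [s2 _ u2] := t2.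
split; first by apply: (@sc_inj 1) => //; rewrite -s2 // -s1 // inv.
have key (h : 'M[C]_1 * 'M[C]_1) : P (upper b h) -> lin (l' *m l) h = h.
  move=> Ph; have Ph' := fP (1 + 1)%N _ isT Ph; have := inv (1 + 1)%N _ isT Ph.
  by move: Ph'; rewrite u1 // => Ph'; rewrite u2 // lin_mul => /upper_inj.
have [e e0 Pe] := upper_nbhd true t1; have [f f0 Pf] := upper_nbhd false t1.
have nz (x : R) : 0 < x -> rc x != 0 by move=> x0; rewrite -cabs_eq0 cabs_rc normr_eq0 gt_eqF.
move: key; move: (l' *m l) => m key; apply/matrixP => i j.
have ent (h : 'M[C]_1 * 'M[C]_1) : lin m h = h ->
    m 0 0 * h.1 0 0 + m 0 1 * h.2 0 0 = h.1 0 0 /\ m 1 0 * h.1 0 0 + m 1 1 * h.2 0 0 = h.2 0 0.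
  by case: h => h1 h2 [/matrixP/(_ 0 0) + /matrixP/(_ 0 0)]; rewrite !mxE.
have [] := ent _ (key _ Pe); have [] := ent _ (key _ Pf).
rewrite /= !mxE !mulr1n !mulr0 !addr0 !add0r => m01 m11 m00 m10.
have c1 (x y : C) : y != 0 -> x * y = y -> x = 1.
  by move=> y0 e1; apply: (mulIf y0); rewrite mul1r.
have c0 (x y : C) : y != 0 -> x * y = 0 -> x = 0.
  by move=> y0 e1; apply: (mulIf y0); rewrite mul0r.
have ord2 (x : 'I_2) : x = 0 \/ x = 1.
  by case: x => -[|[|]] // lt; [left|right]; apply: val_inj.
have ne := nz _ e0; have nf := nz _ f0.
by have [->|->] := ord2 i; have [->|->] := ord2 j; rewrite /=;
  [apply: c1 m00|apply: c0 m01|apply: c0 m10|apply: c1 m11].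
Qed.
End Tangent.

(** * The origin is fixed *)

Section FixedOrigin.
Variables (R : realType) (P : forall n, set (mxpair R n)).
Local Notation C := (cplx R).
Local Notation cabs := (@cabs R).
Local Notation rc := (@rc R).
Arguments P {n}.
Hypothesis P_dsum : forall n m (X : mxpair R n) (Y : mxpair R m),
  P X -> P Y -> P (dsum_pair X Y).
Hypothesis P_unitary : forall n (X : mxpair R n) U,
  U \is unitarymx -> P X -> P (uconj_pair U X).
Hypothesis P_upper_scale : forall p q b (h : 'M[C]_(p, q) * 'M[C]_(p, q)) z,
  cabs z <= 1 -> P (upper b h) -> P (upper b (z *: h.1, z *: h.2)).
Hypothesis P_sc : forall n b, (0 < n)%N -> P (sc 1 b) -> P (sc n b).
Hypothesis P_scale : forall n (X : mxpair R n) z, cabs z <= 1 -> P X ->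
  @P n (z *: X.1, z *: X.2).
Hypothesis P_origin : P (sc 1 (0 : C * C)).
Hypothesis P_rigid : forall (b : C * C) (l : 'M[C]_2), P (sc 1 b) -> l \in unitmx ->
  (forall p q (h : 'M[C]_(p, q) * 'M[C]_(p, q)), (0 < p)%N -> (0 < q)%N ->
     P (upper 0 h) <-> P (upper b (lin l h))) ->
  b != 0 -> l 0 0 = 0 \/ l 1 1 = 0.

Lemma near_one (d : R) : 0 < d -> exists u : C, [/\ cabs u = 1, u != 1 & cabs (u - 1) < d].
Proof.
move=> d0; pose t := d / 4; have t0 : 0 < t by rewrite divr_gt0.
(* u = conj(z) / z is unimodular and, since |z| >= 1, at distance at most |conj(z) - z| = 2 t < d
   from 1. *)
pose z : C := 1 - 'i * rc t.
have zc : z^* = 1 + 'i * rc t.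
  by rewrite /z rmorphB rmorphM rmorph1 /= conjCi conj_rc mulNr opprK.
have rei : re ('i : C) = 0 by [].
have ci : cabs ('i : C) = 1 by rewrite /cabs /= expr0n /= add0r expr1n sqrtr1.
have cz : 1 <= cabs z.
  apply: le_trans (re_le_cabs z); rewrite /z reB mulrC re_rcM rei mulr0 subr0.
  by have := re_rc (1 : R); rewrite rmorph1 => ->.
have z0 : z != 0 by rewrite -cabs_gt0; apply: lt_le_trans cz.
have dif : z^* - z = rc (2 * t) * 'i.
  have e2 : rc (2 * t) = rc t + rc t by rewrite -rmorphD -mulr2n mulr_natl.
  by rewrite zc /z e2; ring.
have cd : cabs (z^* - z) = 2 * t.
  by rewrite dif cabsM ci mulr1 cabs_rc gtr0_norm // mulr_gt0.
exists (z^* / z); split.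
- by rewrite cabsM cabsV cabs_conj divff // gt_eqF // (lt_le_trans _ cz).
- apply/eqP => e; have : cabs (z^* - z) = 0.
    by rewrite -[z^*](divfK z0) e mul1r subrr cabs0.
  by rewrite cd => /eqP; rewrite mulf_eq0 pnatr_eq0 /= gt_eqF.
have -> : z^* / z - 1 = (z^* - z) / z by rewrite mulrBl divff.
rewrite cabsM cabsV cd ltr_pdivrMr ?(lt_le_trans _ cz) //.
rewrite /t; nra.
Qed.

(* F i is the i-th diagonal entry of the derivative of X |-> phi (u psi(X)) at the origin. *)
Lemma along_circle (phi : forall n, mxpair R n -> mxpair R n) (a : C * C) (l0 m : 'M[C]_2)
    (b0 : C * C) : free_analytic_map (@P) phi -> tangent (@P) phi a b0 l0 ->
  exists F : 'I_2 -> C -> C, (forall i, jet (F i) 1) /\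
    forall u b' l, cabs u = 1 -> tangent (@P) phi (u * a.1, u * a.2) b' l ->
      forall i, F i u = (u *: (l *m m)) i i.
Proof.
move=> [f1 f2 fP] ta.
have [e e0 Pe] := upper_nbhd true ta; have [f f0 Pf] := upper_nbhd false ta.
have nz (x : R) : 0 < x -> rc x != 0 by move=> x0; rewrite -cabs_eq0 cabs_rc normr_eq0 gt_eqF.
have ne := nz _ e0; have nf := nz _ f0.
move: Pe Pf; set he := (_, _); set hf := (_, _) => /= Pe Pf.
pose X h (u : C) : mxpair R (1 + 1) := (u *: (upper a h).1, u *: (upper a h).2).
have XE h u : X h u = upper (u * a.1, u * a.2) (u *: h.1, u *: h.2).
  by rewrite /X /upper /= !scale_block_mx !scaler0 !scale_scalar_mx.
have jX h u : jetp (X h) u.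
  have j (A : 'M[C]_(1 + 1)) : jetm (fun z => z *: A) u.
    move=> i k; apply: eq_jet (jetM (jet_id u) (jet_cst (A i k) u)) => w.
    by rewrite mxE.
  by split; apply: j.
have c1 : cabs (1 : C) <= 1 by rewrite cabs1.
have PX h u : cabs u <= 1 -> P (upper a h) -> P (X h u) by move=> u1; apply: P_scale.
have [a1 _ _] := f1; have [a2 _ _] := f2.
(* The corner of phi at u times an upper triangular point over a: it is visibly a jet in u, while l
   is only given for each u separately. *)
pose E h (i : 'I_2) u := if i == 0 then (phi _ (X h u)).1 (lshift 1 0) (rshift 1 0)
  else (phi _ (X h u)).2 (lshift 1 0) (rshift 1 0) : C.
have jE h i : P (upper a h) -> jet (E h i) 1.
  move=> Ph; rewrite /E; case: (i == 0).
    exact: (analytic_jet (a1 2 isT) (jX h 1) (PX _ _ c1 Ph)).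
  exact: (analytic_jet (a2 2 isT) (jX h 1) (PX _ _ c1 Ph)).
exists (fun i u => E he i u * ((rc e)^-1 * m 0 i) + E hf i u * ((rc f)^-1 * m 1 i)).
split=> [i|u b' l u1 tu i].
  by apply: jetD; (apply: jetM; [exact: jE|exact: jet_cst]).
have u1' : cabs u <= 1 by rewrite u1.
have [_ _ tu3] := tu.
have Ev h : P (upper a h) -> E h i u = u * (l i 0 * h.1 0 0 + l i 1 * h.2 0 0).
  move=> Ph; have := tu3 1%N 1%N (u *: h.1, u *: h.2) isT isT.
  rewrite -XE => /(_ (PX _ _ u1' Ph)) pE; rewrite /E pE /upper /lin /=.
  have ent (x y : C) : (x *: (u *: h.1) + y *: (u *: h.2)) 0 0 = u * (x * h.1 0 0 + y * h.2 0 0).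
    by rewrite !mxE; ring.
  case: i => -[|[|]] // lt /=; rewrite block_mxEur ent.
    by congr (_ * (l _ _ * _ + l _ _ * _)); apply: val_inj.
  by congr (_ * (l _ _ * _ + l _ _ * _)); apply: val_inj.
have -> : (u *: (l *m m)) i i = u * (l i 0 * m 0 i + l i 1 * m 1 i).
  by rewrite mxE (@mulmx2 R (cplx_over R)).
have x1 (x : C) : (x%:M : 'M[C]_1) 0 0 = x by rewrite mxE mulr1n.
have x0 : (0 : 'M[C]_1) 0 0 = 0 by rewrite mxE.
rewrite (Ev _ Pe) (Ev _ Pf) /he /hf /= !x1 !x0.
by move: (rc e) (rc f) ne nf => x y ne nf; field; rewrite ne nf.
Qed.

(* If a = psi(0) <> 0, then X |-> phi (u psi(X)) moves the origin for all u <> 1 on the unit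
   circle, so that its derivative there has a zero on the diagonal; but it tends to 1. *)
Lemma fixed_origin (phi psi : forall n, mxpair R n -> mxpair R n) :
  free_analytic_map (@P) phi -> free_analytic_map (@P) psi ->
  (forall n (X : mxpair R n), (0 < n)%N -> P X -> psi n (phi n X) = X) ->
  (forall n (X : mxpair R n), (0 < n)%N -> P X -> phi n (psi n X) = X) ->
  exists l, tangent (@P) phi 0 0 l.
Proof.
move=> hphi hpsi psiphi phipsi.
have ex := tangent_exists P_dsum P_unitary P_upper_scale P_sc.
have [_ _ phiP] := hphi; have [_ _ psiP] := hpsi.
have [a [m [Pa ta]]] := ex _ _ hpsi P_origin.
have [b0 [la [Pb0 tb]]] := ex _ _ hphi Pa.
have [b00 lam] := tangent_comp hpsi phipsi P_origin ta tb.
rewrite b00 in tb => {b0 Pb0 b00}.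
have [a0|an] := eqVneq a 0; first by exists la; rewrite a0 in tb.
exfalso.
have [F [jF FE]] := along_circle m hphi tb.
have F1 i : F i 1 = 1.
  have t1 : tangent (@P) phi (1 * a.1, 1 * a.2) 0 la by rewrite !mul1r -surjective_pairing.
  by rewrite (FE 1 _ _ (cabs1 _) t1) lam scale1r mxE eqxx.
have Pua u : cabs u <= 1 -> P (sc 1 (u * a.1, u * a.2)).
  move=> u1; have := P_scale u1 Pa; congr P.
  by rewrite /sc /= !scale_scalar_mx.
have F0 u : cabs u = 1 -> u != 1 -> F 0 u * F 1 u = 0.
  move=> u1 un; have u1' : cabs u <= 1 by rewrite u1.
  have [bu [lu [Pbu tu]]] := ex _ _ hphi (Pua u u1').
  have [au [mu [_ tmu]]] := ex _ _ hpsi Pbu.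
  have [auE mlu] := tangent_comp hphi psiphi (Pua u u1') tu tmu.
  rewrite auE in tmu.
  rewrite !(FE u _ _ u1 tu).
  have [s1 _ v1] := ta; have [s2 _ v2] := tb; have [s3 _ v3] := tu; have [s4 _ v4] := tmu.
  (* If phi(u a) were 0, then u a = psi(0) = a, although u <> 1 and a <> 0. *)
  have bun : bu != 0.
    apply/eqP => bu0; have := psiphi 1%N _ isT (Pua u u1').
    rewrite s3 // bu0 s1 // => /(sc_inj (n := 1) isT) aE.
    move: an; rewrite -subr_eq0 in un.
    have e (x : C) : x = u * x -> x = 0.
      move=> xe; apply: (mulfI un); rewrite mulr0 mulrBl mul1r -xe subrr //.
    have := e _ (congr1 fst aE); have := e _ (congr1 snd aE).
    by case: (a) => x y /= -> ->; rewrite eqxx.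
  have uu : u * u^* = 1 by apply: (@absF1_conj R (cplx_over R)).
  have uc1 : cabs (u^*) <= 1 by rewrite cabs_conj.
  (* The matrix u lu m is the derivative at 0 of X |-> phi(u psi(X)), and mu is the inverse of
     lu. *)
  have mu_l : mu *m (u *: (lu *m m)) = u *: m by rewrite -scalemxAr mulmxA mlu mul1mx.
  have lunit : u *: (lu *m m) \in unitmx.
    have u0 : u != 0 by rewrite -cabs_eq0 u1 oner_eq0.
    rewrite unitmxZ ?unitfE // unitmx_mul.
    by have [_ ->] := mulmx1_unit mlu; have [_ ->] := mulmx1_unit lam.
  have upZ p q (b : C * C) (h : 'M[C]_(p, q) * 'M[C]_(p, q)) (z : C) :
      cabs z <= 1 -> P (upper b h) -> P (upper (z * b.1, z * b.2) (z *: h.1, z *: h.2)).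
    move=> z1 Ph; have := P_scale z1 Ph; congr P.
    by rewrite /upper /= !scale_block_mx !scaler0 !scale_scalar_mx.
  case: (P_rigid Pbu lunit _ bun) => [p q h p0 q0|->|->]; last 2 first.
  - by rewrite mul0r.
  - by rewrite mulr0.
  have n0 : (0 < p + q)%N by rewrite addn_gt0 p0.
  split=> Ph.
    have h1 := psiP _ _ n0 Ph; rewrite v1 // in h1.
    have h2 := upZ _ _ _ _ _ u1' h1.
    have h3 := phiP _ _ n0 h2; rewrite (v3 _ _ _ p0 q0 h2) in h3.
    by move: h3; rewrite -lin_scale lin_mul -scalemxAr.
  have h1 := psiP _ _ n0 Ph; rewrite v4 // lin_mul mu_l in h1.
  have h2 := upZ _ _ _ _ _ uc1 h1.
  have h3 : P (upper a (lin m h)).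
    move: h2; rewrite lin_scale; move: (lin m h) => [x y] /=.
    by rewrite !scalerA !mulrA [u^* * u]mulrC uu !mul1r !scale1r -surjective_pairing.
  by have := phiP _ _ n0 h3; rewrite v2 // lin_mul lam lin1.
(* The product of the two diagonal entries is 1 at u = 1 and 0 at all other u on the circle, against
   its Lipschitz bound. *)
have [K [r [r0 K0 hK]]] := jet_lipschitz (jetM (jF 0) (jF 1)).
have d0 : 0 < Num.min r (K + 1)^-1 by rewrite lt_min r0 invr_gt0; lra.
have [u [u1 un]] := near_one d0; rewrite lt_min => /andP[ur].
have K1 : 0 < K + 1 by lra.
rewrite -[(K + 1)^-1]mul1r ltr_pdivlMr // => uK.
have uE : 1 + (u - 1) = u by ring.
have := hK _ ur; rewrite uE F0 // !F1 mulr1 sub0r cabsN cabs1.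
have := cabs_ge0 (u - 1); nra.
Qed.
End FixedOrigin.

(** * Cartan's uniqueness theorem *)

Section Cartan.
Variable R : realType.
Local Notation C := (cplx R).
Local Notation cabs := (@cabs R).
Local Notation rc := (@rc R).

Lemma nat_bounded (x B : R) : (forall m : nat, m%:R * x <= B) -> x <= 0.
Proof.
move=> h; rewrite leNgt; apply/negP => x0.
have := archi_boundP (normr_ge0 (B / x)); set m := Num.bound _ => hm.
have := h m; rewrite leNgt => /negP; apply.
rewrite -ltr_pdivrMr //; apply: le_lt_trans hm; exact: ler_norm.
Qed.

Lemma bernoulli (x : R) (m : nat) : 0 <= x -> 1 + m%:R * x <= (1 + x) ^+ m.
Proof.
move=> x0; elim: m => [|m IH]; first by rewrite mul0r addr0 expr0.
rewrite exprS; apply: le_trans (_ : (1 + x) * (1 + m%:R * x) <= _).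
  rewrite -natr1; have : 0 <= m%:R * x * x by rewrite !mulr_ge0 // ler0n.
  by move: (m%:R) => y; nra.
by rewrite ler_wpM2l //; lra.
Qed.

Lemma geometric_bounded (x B q : R) : 0 <= q -> q < 1 -> 0 <= B ->
  (forall k, x <= B * q ^+ k) -> x <= 0.
Proof.
move=> q0 q1 B0 h; have [qz|qn] := eqVneq q 0.
  by have := h 1%N; rewrite qz expr1 mulr0.
have qp : 0 < q by rewrite lt_neqAle eq_sym qn.
rewrite leNgt; apply/negP => x0.
pose d := q^-1 - 1; have d0 : 0 < d by rewrite subr_gt0 invf_gt1.
have : x * d <= 0.
  apply: (@nat_bounded _ B) => m; have := h m; have := bernoulli m (ltW d0).
  have -> : 1 + d = q^-1 by rewrite /d; ring.
  rewrite exprVn => b1 b2.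
  have qm : 0 < q ^+ m by rewrite exprn_gt0.
  have : x * (1 + m%:R * d) <= B.
    apply: le_trans (_ : x * (q ^+ m)^-1 <= _); first by rewrite ler_wpM2l // ltW.
    by rewrite ler_pdivrMr.
  by rewrite mulrDr mulr1 => b3; rewrite mulrCA; lra.
by rewrite leNgt mulr_gt0.
Qed.

Lemma bigOat0D (g h : C -> C) k : bigOat0 g k -> bigOat0 h k -> bigOat0 (fun z => g z + h z) k.
Proof.
move=> [K [r [r0 hg]]] [L [t [t0 hh]]]; exists (K + L), (Num.min r t).
rewrite lt_min r0 t0; split=> // w wn; rewrite lt_min => /andP[wr wt].
rewrite mulrDl; apply: le_trans (cabsD _ _) _.
by apply: lerD; [apply: hg|apply: hh].
Qed.

Lemma bigOat0Z (g : C -> C) c k : bigOat0 g k -> bigOat0 (fun z => c * g z) k.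
Proof.
move=> [K [r [r0 hg]]]; exists (cabs c * K), r; split=> // w wn wr.
by rewrite cabsM -mulrA ler_wpM2l ?cabs_ge0 // hg.
Qed.

Lemma bigOat0S (g : C -> C) k : bigOat0 g k.+1 -> bigOat0 g k.
Proof.
move=> [K [r [r0 hg]]]; exists `|K|, (Num.min r 1); rewrite lt_min r0 ltr01; split=> // w wn.
rewrite lt_min => /andP[wr w1]; apply: le_trans (hg w wn wr) _.
rewrite exprS mulrA ler_wpM2r ?exprn_ge0 ?cabs_ge0 //.
have := cabs_ge0 w; have := ler_norm K; have := normr_ge0 K; nra.
Qed.

Lemma bigOat0_ext (g h : C -> C) k : (forall z, g z = h z) -> bigOat0 g k -> bigOat0 h k.
Proof. by move=> e [K [r [r0 hg]]]; exists K, r; split=> // w wn wr; rewrite -e; apply: hg. Qed.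

Variable n : nat.
Implicit Types X Y H : mxpair R n.
Variables (D : set (mxpair R n)) (g : mxpair R n -> mxpair R n) (r0 M : R).
Local Notation scale z X := ((z *: X.1, z *: X.2) : mxpair R n).
Hypotheses (r00 : 0 < r0) (M0 : 0 <= M).
Hypothesis D_scale : forall X z, cabs z <= 1 -> D X -> D (scale z X).
Hypothesis D_ball : forall X, nrm X <= r0 -> D X.
Hypothesis D_bounded : forall X, D X -> forall i j, cabs (X.1 i j) <= M /\ cabs (X.2 i j) <= M.
Hypothesis g_D : forall X, D X -> D (g X).
Hypothesis g_jet : forall (c : C -> mxpair R n) z0,
  jetp c z0 -> D (c z0) -> jetp (fun z => g (c z)) z0.

Definition entry (c : bool) X i j : C := if c then X.1 i j else X.2 i j.
Definition displacement m c i j X : C := entry c (iter m g X) i j - entry c X i j.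

Hypothesis g_tangent : forall X, D X -> forall c i j,
  bigOat0 (fun z => displacement 1 c i j (scale z X)) 2.

Let D_iter m X : D X -> D (iter m g X).
Proof. by move=> DX; elim: m => //= m; apply: g_D. Qed.

Lemma displacement_jet m c i j (h : C -> mxpair R n) z0 :
  jetp h z0 -> D (h z0) -> jet (fun z => displacement m c i j (h z)) z0.
Proof.
move=> jh Dh; have jm : jetp (fun z => iter m g (h z)) z0.
  by elim: m => [|m IH] //=; apply: g_jet => //; apply: D_iter.
have ent (k : C -> mxpair R n) : jetp k z0 -> jet (fun z => entry c (k z) i j) z0.
  by case=> j1 j2; rewrite /entry; case: c; [exact: j1|exact: j2].
by apply: jetB; apply: ent.
Qed.

Lemma displacement_bound m c i j X : D X -> cabs (displacement m c i j X) <= 2 * M.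
Proof.
move=> DX; have e Y : D Y -> cabs (entry c Y i j) <= M.
  by move=> DY; have [] := D_bounded DY i j; rewrite /entry; case: c.
have := e _ DX; have := e _ (D_iter m DX) => h1 h2.
by apply: le_trans (cabsD _ _) _; rewrite cabsN; lra.
Qed.

Lemma jetp_affine X Y z0 : jetp (fun z => Y + scale z X) z0.
Proof.
have j (A B : 'M[C]_n) : jetm (fun z => B + z *: A) z0.
  move=> i k; apply: eq_jet (jetD (jet_cst (B i k) z0) (jetM (jet_id z0) (jet_cst (A i k) z0))) => w.
  by rewrite !mxE.
by split; apply: j.
Qed.

Lemma jetp_scale X z0 : jetp (fun z => scale z X) z0.
Proof.
have j (A : 'M[C]_n) : jetm (fun z => z *: A) z0.
  move=> i k; apply: eq_jet (jetM (jet_id z0) (jet_cst (A i k) z0)) => w.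
  by rewrite !mxE.
by split; apply: j.
Qed.

Lemma displacement_schwarz m c i j k X : D X ->
  bigOat0 (fun z => displacement m c i j (scale z X)) k ->
  forall z, cabs z <= 1 -> cabs (displacement m c i j (scale z X)) <= 2 * M * cabs z ^+ k.
Proof.
move=> DX O z z1.
apply: (@schwarz _ (fun z => displacement m c i j (scale z X)) (2 * M) k) => // w w1.
  by apply: displacement_jet; [exact: jetp_scale|exact: D_scale].
by apply: displacement_bound; apply: D_scale; rewrite ?w1.
Qed.

Lemma nrmD X Y : nrm (X + Y) <= nrm X + nrm Y.
Proof.
rewrite /nrm -big_split; apply: ler_sum => i _ /=; rewrite -big_split.
apply: ler_sum => j _ /=; rewrite !mxE.
have := cabsD (X.1 i j) (Y.1 i j); have := cabsD (X.2 i j) (Y.2 i j); lra.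
Qed.

Lemma nrm_eq0 X : nrm X = 0 -> X = 0.
Proof.
move=> X0; have e i j := entry_le_nrm X i j; rewrite X0 in e.
rewrite [X]surjective_pairing; congr pair; apply/matrixP => i j; rewrite mxE;
  have [h1 h2] := e i j; apply/eqP; rewrite -cabs_eq0 eq_le cabs_ge0 andbT //.
Qed.

Section Step.
Variable k : nat.
Hypothesis k2 : (2 <= k)%N.
Hypothesis claim : forall X, D X -> forall c i j,
  bigOat0 (fun z => displacement 1 c i j (scale z X)) k.
Let Ck := 2 * M / r0 ^+ k.

(** The Schwarz lemma on the complex line through Y, rescaled to the sphere of radius r0. *)
Lemma displacement_power c i j Y : nrm Y <= r0 -> cabs (displacement 1 c i j Y) <= Ck * nrm Y ^+ k.
Proof.
move=> Yr; have [Y0|Yn] := eqVneq (nrm Y) 0.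
  have YE : Y = scale 0 Y by rewrite (nrm_eq0 Y0) /= !scaler0.
  have DY : D Y by apply: D_ball; rewrite Y0 ltW.
  rewrite YE; apply: le_trans (displacement_schwarz DY (claim DY c i j) _) _.
    by rewrite cabs0.
  have kz : (k == 0)%N = false by case: (k) k2.
  by rewrite -YE Y0 cabs0 expr0n kz !mulr0.
have Yp : 0 < nrm Y by rewrite lt_neqAle eq_sym Yn nrm_ge0.
pose t := r0 / nrm Y; have t0 : 0 < t by rewrite divr_gt0.
pose X : mxpair R n := scale (rc t) Y.
have XN : nrm X = r0 by rewrite nrm_scale cabs_rc gtr0_norm // divfK.
have DX : D X by apply: D_ball; rewrite XN.
have tn : rc t != 0 by rewrite -cabs_eq0 cabs_rc normr_eq0 gt_eqF.
have YE : Y = scale (rc t^-1) X.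
  by rewrite /X /= !scalerA -rmorphM mulVf ?gt_eqF // rmorph1 !scale1r -surjective_pairing.
have ct : cabs (rc t^-1) = nrm Y / r0 by rewrite cabs_rc gtr0_norm ?invr_gt0 // invf_div.
rewrite {1}YE; apply: le_trans (displacement_schwarz DX (claim DX c i j) _) _.
  by rewrite ct ler_pdivrMr // mul1r.
by rewrite ct expr_div_n /Ck mulrA mulrAC.
Qed.

(** The Schwarz lemma replaces a Cauchy estimate of the derivative: with H rescaled to norm p, the
    difference along the complex line from Y in that direction vanishes at the start. *)
Lemma displacement_lipschitz c i j Y H (p : R) : 0 < p -> 2 * p <= r0 ->
  nrm Y <= p -> nrm H <= p ->
  cabs (displacement 1 c i j (Y + H) - displacement 1 c i j Y)
    <= 2 * Ck * (2 * p) ^+ k * (nrm H / p).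
Proof.
move=> p0 pr Yp Hp.
have [H0|Hn] := eqVneq (nrm H) 0.
  by rewrite (nrm_eq0 H0) addr0 subrr cabs0 -(nrm_eq0 H0) H0 mul0r mulr0.
have Hpos : 0 < nrm H by rewrite lt_neqAle eq_sym Hn nrm_ge0.
pose t := p / nrm H; have t0 : 0 < t by rewrite divr_gt0.
pose H' : mxpair R n := scale (rc t) H.
have HN : nrm H' = p by rewrite nrm_scale cabs_rc gtr0_norm // divfK.
have HE : H = scale (rc t^-1) H'.
  by rewrite /H' /= !scalerA -rmorphM mulVf ?gt_eqF // rmorph1 !scale1r -surjective_pairing.
have ct : cabs (rc t^-1) = nrm H / p by rewrite cabs_rc gtr0_norm ?invr_gt0 // invf_div.
have small w : cabs w <= 1 -> nrm (Y + scale w H') <= 2 * p.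
  move=> w1; apply: le_trans (nrmD _ _) _; rewrite nrm_scale HN.
  have := cabs_ge0 w; nra.
have Dw w : cabs w <= 1 -> D (Y + scale w H').
  by move=> w1; apply: D_ball; apply: le_trans (small w w1) pr.
have C0 : 0 <= Ck by rewrite divr_ge0 ?mulr_ge0 ?exprn_ge0 // ltW.
pose F w := displacement 1 c i j (Y + scale w H') - displacement 1 c i j Y.
have jF w : cabs w <= 1 -> jet F w.
  move=> w1; apply: jetB; last exact: jet_cst.
  by apply: displacement_jet; [exact: jetp_affine|exact: Dw].
have bF w : cabs w = 1 -> cabs (F w) <= 2 * Ck * (2 * p) ^+ k.
  move=> w1; apply: le_trans (cabsD _ _) _; rewrite cabsN -mulrA mulr_natl mulr2n.
  have w1' : cabs w <= 1 by rewrite w1.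
  apply: lerD; apply: le_trans (displacement_power _ _ _ _) _.
  - exact: le_trans (small w w1') pr.
  - by rewrite ler_wpM2l // lerXn2r ?nnegrE ?nrm_ge0 ?small // mulr_ge0 // ltW.
  - by apply: le_trans Yp _; lra.
  - rewrite ler_wpM2l // lerXn2r ?nnegrE ?nrm_ge0 //; first by rewrite mulr_ge0 // ltW.
    by apply: le_trans Yp _; lra.
have c01 : cabs (0 : C) <= 1 by rewrite cabs0.
have OF : bigOat0 F 1.
  have [K [r [rp K0 hK]]] := jet_lipschitz (jF 0 (c01)).
  exists K, r; split=> // w _ wr; have := hK w wr; rewrite add0r expr1.
  by rewrite /F /= !scale0r addr0 subrr subr0.
have := schwarz jF bF OF (z := rc t^-1); rewrite ct ler_pdivrMr // mul1r => /(_ Hp).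
by rewrite /F -HE expr1.
Qed.

(* Cartan's argument: the leading term of g^m - id is m times that of g - id, while g^m - id
   is bounded independently of m. *)
Lemma iterate_displacement m X c i j : D X ->
  bigOat0 (fun z => displacement m c i j (scale z X)
    - m%:R * displacement 1 c i j (scale z X)) k.+1.
Proof.
move=> DX; elim: m c i j => [|m IH] c i j.
  exists 0, 1; split=> // w _ _.
  by rewrite /displacement /= subrr mul0r subrr cabs0 mul0r.
have Om c' i' j' : bigOat0 (fun z => displacement m c' i' j' (scale z X)) k.
  apply: (bigOat0_ext _ (bigOat0D (bigOat0S (IH c' i' j')) (bigOat0Z m%:R (claim DX c' i' j')))).
  by move=> z /=; rewrite subrK.
pose A := (2 * n ^ 2)%:R * (2 * M); have A0 : 0 <= A by rewrite !mulr_ge0.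
pose Hz z := iter m g (scale z X) - scale z X.
have HN z : cabs z <= 1 -> nrm (Hz z) <= A * cabs z ^+ k.
  move=> z1; rewrite /A -mulrA; apply: nrm_le => i' j'; split.
    have := displacement_schwarz DX (Om true i' j') z1.
    by rewrite /displacement /entry /Hz !mxE.
  have := displacement_schwarz DX (Om false i' j') z1.
  by rewrite /displacement /entry /Hz !mxE.
(* With p = B |w|, both w X and the displacement [Hz w] have norm at most p. *)
pose B := nrm X + A + 1.
have B0 : 0 < B by rewrite /B; have := nrm_ge0 X; lra.
have C0 : 0 <= Ck by rewrite divr_ge0 ?mulr_ge0 ?exprn_ge0 // ltW.
have Oh : bigOat0 (fun z => displacement 1 c i j (scale z X + Hz z)
    - displacement 1 c i j (scale z X)) k.+1.
  exists (2 * Ck * (2 * B) ^+ k * (A / B)), (Num.min 1 (r0 / (2 * B))).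
  split; first by rewrite lt_min ltr01 divr_gt0 // mulr_gt0.
  move=> w wn; rewrite lt_min ltr_pdivlMr ?mulr_gt0 // => /andP[/ltW w1 /ltW wr].
  have w0 : 0 < cabs w by rewrite cabs_gt0.
  pose q := cabs w; rewrite -/q in w1 wr w0 *.
  have wk : q ^+ k <= q.
    by case: (k) k2 => // k' _; rewrite exprS ger_pMr // exprn_ile1 // ltW.
  have h1 : nrm (Hz w) <= A * q ^+ k by apply: HN.
  (* Here k >= 2 enters: 2 k is at least k + 2. *)
  have q2k : q ^+ k * q ^+ k <= q ^+ k.+1 * q.
    case: (k) k2 => // -[//|k' _].
    by rewrite -exprD -exprSr ler_wiXn2l ?(ltW w0) // !addSn !ltnS leq_addl.
  apply: le_trans (displacement_lipschitz (p := B * q) _ _ _ _ _ _ _) _.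
  - by rewrite mulr_gt0.
  - by rewrite mulrA mulrC.
  - rewrite nrm_scale -/q mulrC ler_wpM2r ?ltW // /B; lra.
  - apply: le_trans h1 _; apply: (@le_trans _ _ (A * q)); first by rewrite ler_wpM2l.
    rewrite ler_wpM2r ?ltW // /B; have := nrm_ge0 X; lra.
  have h2 : q ^+ k * (nrm (Hz w) / (B * q)) <= A / B * q ^+ k.+1.
    rewrite mulrA ler_pdivrMr ?mulr_gt0 //.
    have -> : A / B * q ^+ k.+1 * (B * q) = A * (q ^+ k.+1 * q).
      by field; rewrite gt_eqF.
    apply: (@le_trans _ _ (q ^+ k * (A * q ^+ k))).
      by rewrite ler_wpM2l // exprn_ge0 // ltW.
    by rewrite mulrCA ler_wpM2l.
  rewrite (mulrA 2 B) (exprMn _ (2 * B)) -[leRHS]mulrA [_ * (_ ^+ k * _)]mulrA -[leLHS]mulrA.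
  rewrite ler_wpM2l //.
  have P0 : 0 <= (2 * B) ^+ k by rewrite exprn_ge0 // mulr_ge0 // ltW.
  by apply: mulr_ge0 => //; apply: mulr_ge0.
apply: bigOat0_ext (bigOat0D Oh (IH c i j)) => z.
have YE : scale z X + Hz z = iter m g (scale z X) by rewrite /Hz addrC subrK.
rewrite YE /displacement /= -[in RHS]natr1; ring.
Qed.

(** If a is the coefficient of order k of g - id, that of the m-th iterate minus id is m a, and it
    is bounded by 2 M for every m; so a = 0. *)
Lemma claim_next X c i j : D X -> bigOat0 (fun z => displacement 1 c i j (scale z X)) k.+1.
Proof.
move=> DX; have c01 : cabs (0 : C) <= 1 by rewrite cabs0.
have j0 : jet (fun z => displacement 1 c i j (scale z X)) 0.
  by apply: displacement_jet; [exact: jetp_scale|exact: D_scale].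
have [a [K [r [rp hK]]]] := bigOat0_coef j0 (claim DX c i j).
suff a0 : a = 0.
  by exists K, r; split=> // w _ wr; have := hK w wr; rewrite a0 mul0r subr0.
apply/eqP; rewrite -cabs_eq0 eq_le cabs_ge0 andbT; apply: (@nat_bounded _ (2 * M)) => m.
rewrite -subr_le0.
have [L [t [tp hL]]] := iterate_displacement m c i j DX.
have Om : bigOat0 (fun z => displacement m c i j (scale z X)) k.
  apply: (bigOat0_ext _ (bigOat0D (bigOat0S (iterate_displacement m c i j DX))
    (bigOat0Z m%:R (claim DX c i j)))).
  by move=> z /=; rewrite subrK.
apply: (@le0_small _ _ (L + m%:R * K) (Num.min 1 (Num.min r t))).
  by rewrite !lt_min ltr01 rp.
move=> x x0; rewrite !lt_min => /and3P[x1 xr xt].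
have cx : cabs (rc x) = x by rewrite cabs_rc gtr0_norm.
have xn : rc x != 0 by rewrite -cabs_eq0 cx gt_eqF.
have h1 := hK (rc x); have h2 := hL (rc x) xn.
have h3 := displacement_schwarz DX Om (z := rc x).
rewrite cx in h1 h2 h3; move: (h1 xr) (h2 xt) (h3 (ltW x1)) => {h1 h2 h3}.
set d1 := displacement 1 _ _ _ _; set dm := displacement m _ _ _ _ => h1 h2 h3.
have xk : 0 < x ^+ k by rewrite exprn_gt0.
have e : m%:R * (a * rc x ^+ k) = dm - (dm - m%:R * d1) - m%:R * (d1 - a * rc x ^+ k) by ring.
have cm : cabs (m%:R : C) = m%:R.
  by rewrite -(rmorph_nat rc) cabs_rc ger0_norm.
have := cabsD (dm - (dm - m%:R * d1)) (- (m%:R * (d1 - a * rc x ^+ k))).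
rewrite -e cabsN !cabsM cm cabsX cx => h4.
have h5 : cabs (dm - (dm - m%:R * d1)) <= 2 * M * x ^+ k + L * x ^+ k.+1.
  by apply: le_trans (cabsD _ _) _; rewrite cabsN lerD.
have h6 : m%:R * cabs (d1 - a * rc x ^+ k) <= m%:R * (K * x ^+ k.+1) by rewrite ler_wpM2l.
rewrite -(ler_pM2r xk); rewrite exprS in h5 h6; lra.
Qed.
End Step.

Lemma cartan X : D X -> g X = X.
Proof.
have claim k : forall X, D X -> forall c i j,
    bigOat0 (fun z => displacement 1 c i j (scale z X)) k.+2.
  elim: k => [|k IH] Y DY c i j; first exact: g_tangent.
  exact: (@claim_next k.+2).
(* The bounds 2 M |z|^k for all k force 0 inside the disc; the value wanted is at z = 1 and follows
   by continuity. *)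
move=> DX; have zero c i j (z : C) : cabs z < 1 -> displacement 1 c i j (scale z X) = 0.
  move=> z1; apply/eqP; rewrite -cabs_eq0 eq_le cabs_ge0 andbT.
  apply: (geometric_bounded (cabs_ge0 z) z1 (B := 2 * M)); first by rewrite mulr_ge0.
  have h k := displacement_schwarz DX (claim k X DX c i j) (ltW z1).
  move=> k; apply: le_trans (h k) _; rewrite ler_wpM2l ?mulr_ge0 //.
  by rewrite ler_wiXn2l ?cabs_ge0 ?ltW // -addn2 leq_addr.
have all0 c i j : displacement 1 c i j X = 0.
  have j1 : jet (fun z => displacement 1 c i j (scale z X)) 1.
    apply: displacement_jet; first exact: jetp_scale.
    by apply: D_scale; rewrite ?cabs1.
  have [K [r [rp K0 hK]]] := jet_lipschitz j1.
  apply/eqP; rewrite -cabs_eq0 eq_le cabs_ge0 andbT.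
  apply: (@le0_small _ _ K (Num.min r 1)); first by rewrite lt_min rp ltr01.
  move=> t t0; rewrite lt_min => /andP[tr t1].
  have ct : cabs (- rc t) = t by rewrite cabsN cabs_rc gtr0_norm.
  have c1 : cabs (1 - rc t) < 1.
    have -> : 1 - rc t = rc (1 - t) by rewrite rmorphB rmorph1.
    rewrite cabs_rc ger0_norm; lra.
  have := hK (- rc t); rewrite ct => /(_ tr).
  by rewrite (zero _ _ _ _ c1) !scale1r -surjective_pairing sub0r cabsN.
rewrite [LHS]surjective_pairing [RHS]surjective_pairing; congr pair; apply/matrixP => i j.
  by have /eqP := all0 true i j; rewrite subr_eq0 => /eqP.
by have /eqP := all0 false i j; rewrite subr_eq0 => /eqP.
Qed.
End Cartan.

(** * Automorphisms fixing the origin are linear *)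

Section Linearity.
Variables (R : realType) (P : forall n, set (mxpair R n)).
Local Notation C := (cplx R).
Local Notation cabs := (@cabs R).
Local Notation rc := (@rc R).
Arguments P {n}.
Local Notation scale z X := (z *: X.1, z *: X.2).
Implicit Types phi psi : forall n, mxpair R n -> mxpair R n.

Lemma sc0 n : sc n (0 : C * C) = 0 :> mxpair R n.
Proof. by rewrite /sc /= raddf0. Qed.

Lemma nrm_lin n (l : 'M[C]_2) : exists2 K : R, 0 <= K &
  forall (X : mxpair R n), nrm (lin l X) <= K * nrm X.
Proof.
pose N := \sum_i \sum_j cabs (l i j).
have N0 : 0 <= N by apply: sumr_ge0 => i _; apply: sumr_ge0 => j _; apply: cabs_ge0.
have lN i j : cabs (l i j) <= N.
  rewrite /N (bigD1 i) //= (bigD1 j) //= -addrA lerDl addr_ge0 //.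
    by apply: sumr_ge0 => k _; apply: cabs_ge0.
  by apply: sumr_ge0 => i' _; apply: sumr_ge0 => k _; apply: cabs_ge0.
exists ((2 * n ^ 2)%:R * (2 * N)) => [|X]; first by rewrite !mulr_ge0.
rewrite -mulrA; apply: nrm_le => i j; have [h1 h2] := entry_le_nrm X i j.
have e (a b : C) : cabs a <= N -> cabs b <= N ->
    cabs (a * X.1 i j + b * X.2 i j) <= 2 * N * nrm X.
  move=> ha hb; apply: le_trans (cabsD _ _) _; rewrite !cabsM -mulrA mulr_natl mulr2n.
  by apply: lerD; apply: ler_pM; rewrite ?cabs_ge0.
by rewrite /lin /= !mxE; split; apply: e.
Qed.

Lemma tangent_at_origin phi l n : free_analytic_map (@P) phi -> P (sc n (0 : C * C)) ->
  (0 < n)%N -> tangent (@P) phi 0 0 l -> exists K t : R, [/\ 0 < t, 0 <= K &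
    forall H : mxpair R n, nrm H <= t -> nrm (phi n H - lin l H) <= K * nrm H ^+ 2].
Proof.
move=> [[a1 _ _] [a2 _ _] _] P0 n0 [s0 d _].
have [K1 [t1 [t10 K10 h1]]] := lder_uniform (a1 n n0) P0 (fun H => (d n n0 H).1).
have [K2 [t2 [t20 K20 h2]]] := lder_uniform (a2 n n0) P0 (fun H => (d n n0 H).2).
exists ((2 * n ^ 2)%:R * (K1 + K2)), (Num.min t1 t2); split.
- by rewrite lt_min t10.
- by rewrite mulr_ge0 // addr_ge0.
move=> H; rewrite le_min => /andP[H1 H2].
have [_ e1] := h1 H H1; have [_ e2] := h2 H H2.
rewrite s0 // sc0 add0r subr0 in e1; rewrite s0 // sc0 add0r subr0 in e2.
have q0 : 0 <= nrm H ^+ 2 by rewrite exprn_ge0 ?nrm_ge0.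
rewrite -mulrA; apply: nrm_le => i j; rewrite mulrDl; split.
  by apply: le_trans (e1 i j) _; rewrite lerDl mulr_ge0.
by apply: le_trans (e2 i j) _; rewrite lerDr mulr_ge0.
Qed.

(** The derivatives of X |-> phi(u X) and X |-> psi(u^* X) at 0 cancel, so the composite agrees with
    the identity to first order, as Cartan's theorem requires. *)
Lemma rotation_chain phi psi l l' n (X : mxpair R n) (u : C) :
  free_analytic_map (@P) phi -> free_analytic_map (@P) psi ->
  P (sc n (0 : C * C)) -> (0 < n)%N -> tangent (@P) phi 0 0 l -> tangent (@P) psi 0 0 l' ->
  l' *m l = 1%:M -> cabs u = 1 ->
  exists K r : R, 0 < r /\ forall w, cabs w < r ->
    let Y := phi n (scale u (scale w X)) in
    nrm (psi n (scale u^* Y) - scale w X) <= K * cabs w ^+ 2.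
Proof.
move=> hphi hpsi P0 n0 t1 t2 ll u1.
have [K1 [r1 [r10 K10 h1]]] := tangent_at_origin hphi P0 n0 t1.
have [K2 [r2 [r20 K20 h2]]] := tangent_at_origin hpsi P0 n0 t2.
have [L L0 hL] := nrm_lin n l; have [L' L0' hL'] := nrm_lin n l'.
pose x := nrm X; have x0 : 0 <= x by apply: nrm_ge0.
pose B := L * x + K1 * x ^+ 2; have B0 : 0 <= B by rewrite addr_ge0 ?mulr_ge0 ?exprn_ge0.
exists (K2 * B ^+ 2 + L' * (K1 * x ^+ 2)), (Num.min 1 (Num.min (r1 / (x + 1)) (r2 / (B + 1)))).
have x1 : 0 < x + 1 by lra.
have B1 : 0 < B + 1 by lra.
split; first by rewrite !lt_min ltr01 !divr_gt0.
move=> w; rewrite !lt_min !ltr_pdivlMr // => /and3P[w1 wr1 wr2]; cbv zeta.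
have w0 := cabs_ge0 w; set q := cabs w in w0 w1 wr1 wr2 *.
pose H := scale u (scale w X) : mxpair R n; rewrite -/H.
have HN : nrm H = q * x by rewrite /H nrm_scale nrm_scale u1 mul1r.
have Hr : nrm H <= r1 by rewrite HN; nra.
have hV := h1 H Hr; rewrite HN in hV.
pose V := phi n H - lin l H; rewrite -/V in hV.
have uu : u^* * u = 1 by rewrite mulrC; apply: (@absF1_conj R (cplx_over R)).
have Hu : scale u^* H = scale w X.
  have e (A : 'M[C]_n) : u^* *: (u *: A) = A by rewrite scalerA uu scale1r.
  by rewrite /H /= !e.
pose Z := scale u^* (phi n H) : mxpair R n; rewrite -/Z.
have addE (Y Y' : mxpair R n) (z : C) : scale z (Y + Y') = scale z Y + scale z Y' :> mxpair R n.
  by rewrite /= !scalerDr.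
have ZE : Z = lin l (scale w X) + scale u^* V.
  have e : phi n H = lin l H + V by rewrite /V addrC subrK.
  by rewrite /Z e addE -linZ Hu.
have uc : cabs u^* = 1 by rewrite cabs_conj.
have linD (Y Y' : mxpair R n) : lin l' (Y + Y') = lin l' Y + lin l' Y'.
  rewrite /lin /= !scalerDr; congr pair; exact: addrACA.
have ZN : nrm Z <= B * q.
  rewrite ZE; apply: le_trans (nrmD _ _) _; rewrite nrm_scale uc mul1r.
  have := hL (scale w X); rewrite nrm_scale -/q -/x => hl.
  have : K1 * (q * x) ^+ 2 <= K1 * x ^+ 2 * q.
    rewrite exprMn mulrCA mulrC; apply: ler_wpM2l; first by rewrite mulr_ge0 ?exprn_ge0.
    by rewrite expr2; nra.
  rewrite /B mulrDl; move: hV hl; rewrite -[L * x * q]mulrA [x * q]mulrC; lra.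
have Zr : nrm Z <= r2 by apply: le_trans ZN _; nra.
have lZ : lin l' Z = scale w X + scale u^* (lin l' V).
  by rewrite ZE linD lin_mul ll lin1 linZ.
have -> : psi n Z - scale w X = (psi n Z - lin l' Z) + scale u^* (lin l' V).
  by rewrite lZ opprD addrA subrK.
apply: le_trans (nrmD _ _) _; rewrite nrm_scale uc mul1r mulrDl; apply: lerD.
  apply: le_trans (h2 Z Zr) _; rewrite -mulrA ler_wpM2l // -exprMn.
  by rewrite lerXn2r ?nnegrE ?nrm_ge0 // mulr_ge0.
apply: le_trans (hL' V) _; rewrite -mulrA ler_wpM2l //; apply: le_trans hV _.
by rewrite exprMn -mulrA [_ * q ^+ 2]mulrC.
Qed.

(** Cartan's theorem for X |-> psi(u^* phi(u X)) gives phi(u X) = u phi(X) for |u| = 1; by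
    [homogeneous_linear] a map homogeneous on the circle equals its derivative. *)
Lemma automorphism_linear phi psi l l' n (r0 M : R) :
  free_analytic_map (@P) phi -> free_analytic_map (@P) psi -> (0 < n)%N ->
  (forall X : mxpair R n, P X -> psi n (phi n X) = X) ->
  (forall X : mxpair R n, P X -> phi n (psi n X) = X) ->
  tangent (@P) phi 0 0 l -> tangent (@P) psi 0 0 l' -> l' *m l = 1%:M ->
  (forall (X : mxpair R n) z, cabs z <= 1 -> P X -> @P n (scale z X)) ->
  0 < r0 -> 0 <= M -> (forall X : mxpair R n, nrm X <= r0 -> P X) ->
  (forall X : mxpair R n, P X -> forall i j, cabs (X.1 i j) <= M /\ cabs (X.2 i j) <= M) ->
  forall X : mxpair R n, P X -> phi n X = lin l X.
Proof.
move=> hphi hpsi n0 psiphi phipsi t1 t2 ll Psc r00 M0 Pball Pbd X PX.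
have [[a1 _ _] [a2 _ _] phiP] := hphi; have [[b1 _ _] [b2 _ _] psiP] := hpsi.
have P0 : P (sc n (0 : C * C)).
  rewrite sc0; apply: Pball; have -> : nrm (0 : mxpair R n) = 0; last exact: ltW.
  by rewrite /nrm big1 // => i _; rewrite big1 // => j _; rewrite !mxE cabs0 addr0.
have rot u : cabs u = 1 -> phi n (scale u X) = scale u (phi n X).
  move=> u1; have u1' : cabs u <= 1 by rewrite u1.
  have uc : cabs u^* <= 1 by rewrite cabs_conj.
  have uu : u * u^* = 1 by apply: (@absF1_conj R (cplx_over R)).
  pose g Y := psi n (scale u^* (phi n (scale u Y))).
  have jsc (c : C -> mxpair R n) z0 v : jetp c z0 -> jetp (fun z => scale v (c z)) z0.
    case=> j1 j2; split=> i j.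
      by apply: eq_jet (jetZ v (j1 i j)) => w; rewrite mxE.
    by apply: eq_jet (jetZ v (j2 i j)) => w; rewrite mxE.
  have gX : g X = X.
    apply: (@cartan R n (@P n) g r0 M r00 M0 (fun Y z => @Psc Y z) Pball Pbd) => //.
    - by move=> Y PY; exact: psiP _ _ n0 (Psc _ _ uc (phiP n _ n0 (Psc _ _ u1' PY))).
    - move=> c z0 jc Pc; have j1 := jsc c z0 u jc.
      have P1 : P (scale u (c z0)) := Psc _ _ u1' Pc.
      have j2 : jetp (fun z => phi n (scale u (c z))) z0.
        by split; [apply: (analytic_jet (a1 n n0) j1 P1)|apply: (analytic_jet (a2 n n0) j1 P1)].
      have P2 := Psc _ _ uc (phiP n _ n0 P1).
      have j3 := jsc _ _ u^* j2.
      by split; [apply: (analytic_jet (b1 n n0) j3 P2)|apply: (analytic_jet (b2 n n0) j3 P2)].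
    move=> Y PY c i j.
    have [K [r [rp hK]]] := rotation_chain Y hphi hpsi P0 n0 t1 t2 ll u1.
    exists K, r; split=> // w _ wr; apply: le_trans (hK w wr).
    have [e1 e2] := entry_le_nrm (g (scale w Y) - scale w Y) i j.
    have f1 (Z Z' : mxpair R n) : (Z - Z').1 i j = Z.1 i j - Z'.1 i j by rewrite !mxE.
    have f2 (Z Z' : mxpair R n) : (Z - Z').2 i j = Z.2 i j - Z'.2 i j by rewrite !mxE.
    by rewrite f1 in e1; rewrite f2 in e2; case: c; [exact: e1|exact: e2].
  have h := phipsi _ (Psc _ _ uc (phiP n _ n0 (Psc _ _ u1' PX))).
  rewrite -/(g X) gX in h; rewrite h /= !scalerA uu !scale1r -surjective_pairing //.
have [s0 dl _] := t1.
have jX z : cabs z <= 1 -> jetm (fun z => (phi n (scale z X)).1) z /\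
    jetm (fun z => (phi n (scale z X)).2) z.
  move=> z1; have Pz := Psc _ _ z1 PX; have j := jetp_scale X z.
  by split; [apply: (analytic_jet (a1 n n0) j Pz)|apply: (analytic_jet (a2 n n0) j Pz)].
have aE w : along (sc n (0 : C * C)) X w = scale w X by rewrite /along sc0 add0r.
rewrite [LHS]surjective_pairing [RHS]surjective_pairing.
have [d1 d2] := dl n n0 X.
congr pair; apply/matrixP => i j.
- apply: (@homogeneous_linear _ (fun z => (phi n (scale z X)).1 i j)).
  + by move=> z z1; have [h _] := jX z z1; apply: h.
  + by move=> z z1; rewrite rot // mxE.
  have [K [r [rp hK]]] := d1; exists K, r; split=> // w _ wr.
  have [_ /(_ i j)] := hK w wr; rewrite aE s0 // sc0 subr0.
  have e (A B : 'M[C]_n) : (A - w *: B) i j = A i j - w * B i j by rewrite !mxE.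
  by rewrite e.
- apply: (@homogeneous_linear _ (fun z => (phi n (scale z X)).2 i j)).
  + by move=> z z1; have [_ h] := jX z z1; apply: h.
  + by move=> z z1; rewrite rot // mxE.
  have [K [r [rp hK]]] := d2; exists K, r; split=> // w _ wr.
  have [_ /(_ i j)] := hK w wr; rewrite aE s0 // sc0 subr0.
  have e (A B : 'M[C]_n) : (A - w *: B) i j = A i j - w * B i j by rewrite !mxE.
  by rewrite e.
Qed.
End Linearity.

(** * Monomial matrices *)

Section LevelOne.
Variables (R : realType) (C : complexOver R).

Lemma absF_conj (x : C) : absF x^* = absF x.
Proof.
by apply/eqP; rewrite -(eqrXn2 (n := 2)) ?absF_ge0 // !absF_sqr conjCK mulrC.
Qed.

Lemma ip_lower m n (A B : 'M[C]_(m, n)) : - (nn A + nn B) <= 2 * ip A B.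
Proof.
have := nn_ge0 (A + B); rewrite /nn ipDl !ipDr (ipC B A); lra.
Qed.

Lemma ip_scale_lower m n (A B : 'M[C]_(m, n)) (z : C) :
  - (absF z * (nn A + nn B)) <= 2 * ip A (z *: B).
Proof.
have [u u1 uE] := rotate_to_absF z.
have zE : z = rcF (absF z) * u^*.
  by rewrite -uE mulrAC absF1_conj // mul1r.
have nB : nn (u^* *: B) = nn B.
  by rewrite nnZ absF_conj u1 expr1n mul1r.
rewrite zE -scalerA ipZr -zE mulrCA -mulrN; apply: ler_wpM2l; first exact: absF_ge0.
by have := ip_lower A (u^* *: B); rewrite nB.
Qed.

Lemma pencil_pos_swap s (C1 C2 : 'M[C]_s) n (X1 X2 : 'M[C]_n) :
  pencil_pos C1 C2 (X1, X2) -> pencil_pos C2 C1 (X2, X1).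
Proof.
move=> h Y; have [Y0 [Y1 [Y2 [Y3 ->]]]] := split4 Y => Yn.
have := h (col_mx Y0 (col_mx (col_mx Y2 Y1) Y3)).
rewrite -!nn_gt0 !nn_col !penE /= in Yn *.
rewrite [nn Y2 + _]addrC => /(_ Yn); lra.
Qed.

Section Axis.
Variables (s : nat) (C1 C2 : 'M[C]_s).

Lemma axis_in (x : C) : (forall v : 'cV[C]_s, nn (C1 *m v) <= nn v) -> absF x < 1 ->
  pencil_pos C1 C2 (sc 1 (x, 0)).
Proof.
move=> h x1 Y; have [Y0 [Y1 [Y2 [Y3 ->]]]] := split4 Y.
rewrite -nn_gt0 penE !nn_col /sc /= !tr_scalar_mx !mul_mx_scalar !scale0r !ip0r !addr0.
have := ip_scale_lower Y0 (C1 *m Y1) x; have := ip_scale_lower Y2 (C1 *m Y3) x.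
have := h Y1; have := h Y3; have := nn_ge0 Y0; have := nn_ge0 Y2; have := absF_ge0 x.
move: (nn (C1 *m _)) (nn (C1 *m _)) (ip _ _) (ip _ _) => n1 n3 i1 i2.
move: (nn Y0) (nn Y1) (nn Y2) (nn Y3) (absF x) x1 => y0 y1 y2 y3 a a1 a0 g2 g0 l3 l1 h2 h1 pos.
have : a * (y2 + n3) <= a * (y2 + y3) by rewrite ler_wpM2l // lerD2l.
have : a * (y0 + n1) <= a * (y0 + y1) by rewrite ler_wpM2l // lerD2l.
have : 0 < (1 - a) * (y0 + (y1 + y2 + y3)) by rewrite mulr_gt0 // subr_gt0.
lra.
Qed.

(** The test vector pairs v with C1 v and aligns the phase of x. Through this inequality |x| > 1
    would force the norm of C1 below 1. *)
Lemma axis_out (x : C) (v : 'cV[C]_s) : pencil_pos C1 C2 (sc 1 (x, 0)) ->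
  (2 * absF x - 1) * nn (C1 *m v) <= nn v.
Proof.
have [->|vn] := eqVneq v 0; first by move=> _; rewrite mulmx0 !nn0 mulr0.
have [u u1 uE] := rotate_to_absF x.
have zE : u^* * rcF (absF x) = x by rewrite -uE mulrA [_ * u]mulrC absF1_conj // mul1r.
have nu : nn (u^* *: (C1 *m v)) = nn (C1 *m v).
  by rewrite nnZ absF_conj u1 expr1n mul1r.
move=> /(_ (col_mx (- (u^* *: (C1 *m v))) (col_mx (col_mx v 0) 0))).
rewrite !col_mx_eq0 (negbTE vn) !andbF => /(_ isT).
rewrite penE !nn_col !nn0 nnN nu /sc /= !tr_scalar_mx !mul_mx_scalar !scale0r !ip0r ip0l !addr0.
have xe : x *: (C1 *m v) = rcF (absF x) *: (u^* *: (C1 *m v)) by rewrite scalerA mulrC zE.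
rewrite ipNl xe ipZr -/(nn _) nu; lra.
Qed.
End Axis.

(* For s = 1 the first level of the spectrahedron is a weighted l1 ball. *)
Lemma gauge (c1 c2 x y : C) :
  pencil_pos (c1%:M : 'M[C]_1) c2%:M (sc 1 (x, y)) <-> absF (c1 * x) + absF (c2 * y) < 1.
Proof.
have E (Y0 Y1 Y2 Y3 : 'M[C]_1) : pen c1%:M c2%:M (sc 1 (x, y)) (col_mx Y0 (col_mx (col_mx Y1 Y2) Y3))
    = ip Y0 ((c1 * x) *: Y1) + ip Y2 ((c1 * x) *: Y3) + ip Y0 ((c2 * y) *: Y2)
      + ip Y1 ((c2 * y) *: Y3).
  by rewrite penE /sc /= !tr_scalar_mx !mul_mx_scalar !mul_scalar_mx !scalerA ![x * _]mulrC ![y * _]mulrC.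
split=> h; last first.
  move=> Y; have [Y0 [Y1 [Y2 [Y3 ->]]]] := split4 Y; rewrite -nn_gt0 E !nn_col.
  move: h; move: (c1 * x) (c2 * y) => a b h.
  have := ip_scale_lower Y0 Y1 a; have := ip_scale_lower Y2 Y3 a.
  have := ip_scale_lower Y0 Y2 b; have := ip_scale_lower Y1 Y3 b.
  move: (ip _ _) (ip _ _) (ip _ _) (ip _ _) => i1 i2 i3 i4 h1 h2 h3 h4 pos.
  have := mulr_gt0 (etrans (subr_gt0 _ _) h) pos; lra.
move: h; move: E; move: (c1 * x) (c2 * y) => a b E h.
have [al al1 aE] := rotate_to_absF (- a); have [be be1 bE] := rotate_to_absF (- b).
(* These phases make all four terms of the form equal to minus a modulus at once. *)
have := h (col_mx 1%:M (col_mx (col_mx al%:M be%:M) (al * be)%:M)).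
have n1 (z : C) : nn (z%:M : 'M[C]_1) = absF z ^+ 2.
  by rewrite nnE !big_ord1 mxE mulr1n.
have i1 (z w v : C) : ip (z%:M : 'M[C]_1) (v *: w%:M) = reF (z^* * (v * w)).
  by rewrite ipE !big_ord1 !mxE !mulr1n.
rewrite -nn_gt0 E !nn_col !n1 !i1 !absFM al1 be1 absF1 !mulr1 expr1n.
have -> : 1^* * (a * al) = - rcF (absF (- a)) :> C by rewrite conjC1 mul1r -aE; ring.
have -> : be^* * (a * (al * be)) = - rcF (absF (- a)) :> C.
  have e : be^* * (a * (al * be)) = (be * be^*) * (a * al) by ring.
  by rewrite e absF1_conj // -aE; ring.
have -> : 1^* * (b * be) = - rcF (absF (- b)) :> C by rewrite conjC1 mul1r -bE; ring.
have -> : al^* * (b * (al * be)) = - rcF (absF (- b)) :> C.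
  have e : al^* * (b * (al * be)) = (al * al^*) * (b * be) by ring.
  by rewrite e absF1_conj // -bE; ring.
rewrite !raddfN /= !reF_rc !absFN => /(_ _); lra.
Qed.

Lemma parallelogram (p q : C) : absF p + absF q <= absF (p + q) ->
  absF p + absF q <= absF (p - q) -> p * q = 0.
Proof.
move=> h1 h2; apply/eqP; rewrite -absF_eq0 absFM; apply/eqP.
have e1 := absF_sqr (p + q); have e2 := absF_sqr (p - q).
have e : absF (p + q) ^+ 2 + absF (p - q) ^+ 2 = 2 * (absF p ^+ 2 + absF q ^+ 2).
  rewrite !absF_sqr -!raddfD mulr_natl mulr2n -raddfD; congr reF.
  by rewrite rmorphB rmorphD /=; ring.
have p0 := absF_ge0 p; have q0 := absF_ge0 q.
have s1 : (absF p + absF q) ^+ 2 <= absF (p + q) ^+ 2.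
  by rewrite lerXn2r ?nnegrE ?absF_ge0 ?addr_ge0.
have s2 : (absF p + absF q) ^+ 2 <= absF (p - q) ^+ 2.
  by rewrite lerXn2r ?nnegrE ?absF_ge0 ?addr_ge0.
have pq := mulr_ge0 p0 q0.
move: (absF (p + q)) (absF (p - q)) (absF p) (absF q) e s1 s2 pq => a b c d.
by rewrite !expr2; nra.
Qed.

Definition lin2 (l : 'M[C]_2) (b : C * C) : C * C :=
  (l 0 0 * b.1 + l 0 1 * b.2, l 1 0 * b.1 + l 1 1 * b.2).

Lemma lin_sc n l b : lin l (sc n b) = sc n (lin2 l b).
Proof. by rewrite /lin /sc /lin2 /= !scale_scalar_mx -!raddfD. Qed.

(** l is an isometry of the norm |c1 x| + |c2 y|. Its values at (1, 0), (0, 1), (1, 1) and (1, -1)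
    leave equality in the triangle inequality in each row, with both signs, and [parallelogram]
    applies. *)
Lemma gauge_monomial (c1 c2 : C) (l : 'M[C]_2) : c1 != 0 -> c2 != 0 ->
  (forall b, pencil_pos (c1%:M : 'M[C]_1) c2%:M (sc 1 b) <->
     pencil_pos (c1%:M : 'M[C]_1) c2%:M (sc 1 (lin2 l b))) ->
  l 0 0 * l 0 1 = 0 /\ l 1 0 * l 1 1 = 0.
Proof.
move=> c1n c2n hP.
have [N NE] : exists N : C * C -> R, forall b, N b = absF (c1 * b.1) + absF (c2 * b.2).
  by eexists.
have NP b : pencil_pos (c1%:M : 'M[C]_1) c2%:M (sc 1 b) <-> N b < 1.
  by rewrite NE [b]surjective_pairing; apply: gauge.
have N0 b : 0 <= N b by rewrite NE addr_ge0 ?absF_ge0.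
have NZ (t : R) b : 0 <= t -> N (rcF t * b.1, rcF t * b.2) = t * N b.
  move=> t0; rewrite !NE /= ![c1 * (rcF t * _)]mulrCA ![c2 * (rcF t * _)]mulrCA.
  by rewrite !(absFM (rcF t)) absF_rc ger0_norm // mulrDr.
have lZ (t : R) b : lin2 l (rcF t * b.1, rcF t * b.2) = (rcF t * (lin2 l b).1, rcF t * (lin2 l b).2).
  by rewrite /lin2 /= !mulrDr; congr pair; congr (_ + _); rewrite mulrCA.
have cmp x y : (forall t : R, 0 < t -> t * x < 1 -> t * y < 1) -> 0 <= x -> 0 <= y -> y <= x.
  move=> h x0 y0; rewrite leNgt; apply/negP => xy.
  have yp : 0 < y by apply: le_lt_trans xy.
  have := h y^-1; rewrite invr_gt0 yp mulVf ?gt_eqF // ltxx => /(_ isT) H.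
  by suff : false by []; apply: H; rewrite mulrC ltr_pdivrMr // mul1r.
have Nl b : N (lin2 l b) = N b.
  apply: le_anti; apply/andP; split; apply: cmp => // t t0 h.
    have tb : N (rcF t * b.1, rcF t * b.2) < 1 by rewrite NZ // ltW.
    by move/NP: tb => /hP /NP; rewrite lZ NZ // ltW.
  have tb : N (rcF t * (lin2 l b).1, rcF t * (lin2 l b).2) < 1 by rewrite NZ // ltW.
  by move: tb; rewrite -lZ => /NP /(hP _).2 /NP; rewrite NZ // ltW.
have k1 : 0 < absF c1 by rewrite absF_gt0.
have k2 : 0 < absF c2 by rewrite absF_gt0.
have := Nl (1, 0); have := Nl (0, 1); have := Nl (1, 1); have := Nl (1, -1).
rewrite !NE /lin2 /= !(mulr0, mulr1, addr0, add0r, mulrN1) !(absFM, absFN, absF0).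
rewrite ?(mulr0, addr0, add0r) => e4 e3 e2 e1.
have t1 := absFD (l 0 0) (l 0 1); have t2 := absFD (l 1 0) (l 1 1).
have t3 := absFD (l 0 0) (- l 0 1); have t4 := absFD (l 1 0) (- l 1 1).
rewrite !absFN in t3 t4.
have m1 := ler_wpM2l (ltW k1) t1; have m2 := ler_wpM2l (ltW k2) t2.
have m3 := ler_wpM2l (ltW k1) t3; have m4 := ler_wpM2l (ltW k2) t4.
split; apply: parallelogram.
- by rewrite -(ler_pM2l k1); lra.
- by rewrite -(ler_pM2l k1); lra.
- by rewrite -(ler_pM2l k2); lra.
- by rewrite -(ler_pM2l k2); lra.
Qed.

(** Up to its boundary, the domain meets each axis in the unit disc. l carries axis j to axis i and
    l' carries it back, so both entries have modulus at most 1, while their product is 1. *)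
Lemma unimodular_entry s (C1 C2 : 'M[C]_s) (l l' : 'M[C]_2) (i j : 'I_2) :
  let ax (k : 'I_2) (x : C) : C * C := if k == 0 then (x, 0) else (0, x) in
  (forall k x, absF x < 1 -> pencil_pos C1 C2 (sc 1 (ax k x))) ->
  (forall k x, pencil_pos C1 C2 (sc 1 (ax k x)) -> absF x <= 1) ->
  (forall b, pencil_pos C1 C2 (sc 1 b) -> pencil_pos C1 C2 (sc 1 (lin2 l b))) ->
  (forall b, pencil_pos C1 C2 (sc 1 b) -> pencil_pos C1 C2 (sc 1 (lin2 l' b))) ->
  l' *m l = 1%:M -> (forall k, k != i -> l k j = 0) -> absF (l i j) = 1.
Proof.
move=> ax ax_in ax_out Pl Pl' ll lij.
have ord2 (x : 'I_2) : x = 0 \/ x = 1.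
  by case: x => -[|[|]] // lt; [left|right]; apply: val_inj.
have axl (m : 'M[C]_2) p q x : (forall k, k != p -> m k q = 0) ->
    lin2 m (ax q x) = ax p (m p q * x).
  move=> h; have [e|e] := ord2 p; have [f|f] := ord2 q; rewrite e f /ax /lin2 /= in h *;
    rewrite !(mulr0, addr0, add0r).
  - by rewrite (h 1) ?mul0r.
  - by rewrite (h 1) ?mul0r.
  - by rewrite (h 0) ?mul0r.
  - by rewrite (h 0) ?mul0r.
have le1 (m : 'M[C]_2) p q : (forall b, pencil_pos C1 C2 (sc 1 b) -> pencil_pos C1 C2 (sc 1 (lin2 m b))) ->
    (forall k, k != p -> m k q = 0) -> absF (m p q) <= 1.
  move=> hm h; rewrite leNgt; apply/negP => m1.
  have m0 : 0 < absF (m p q) by apply: lt_trans m1.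
  (* Between 1 / |m p q| and 1: a point of axis q in the domain that m would carry outside. *)
  pose t := (1 + (absF (m p q))^-1) / 2.
  have iv : (absF (m p q))^-1 < 1 by rewrite invf_lt1.
  have ip0 : 0 < (absF (m p q))^-1 by rewrite invr_gt0.
  have t0 : 0 < t by rewrite divr_gt0 // addr_gt0.
  have ct : absF (rcF t : C) = t by rewrite absF_rc gtr0_norm.
  have t1 : absF (rcF t : C) < 1 by rewrite ct /t; lra.
  have := ax_out p _; move=> /(_ (m p q * rcF t)).
  rewrite -axl // => /(_ (hm _ (ax_in q _ t1))); rewrite absFM ct => h1.
  have : absF (m p q) * (absF (m p q))^-1 < absF (m p q) * t.
    by rewrite ltr_pM2l // /t; lra.
  by rewrite divff ?gt_eqF //; lra.
have ent p q : \sum_k l' p k * l k q = (p == q)%:R.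
  by have /matrixP/(_ p q) := ll; rewrite !mxE.
have one p : l' p i * l i j = (p == j)%:R.
  rewrite -ent (bigD1 i) //= big1 ?addr0 // => k ki; by rewrite lij // mulr0.
have lij0 : l i j != 0.
  by apply/eqP => e; have := one j; rewrite e mulr0 eqxx => /esym/eqP; rewrite oner_eq0.
have l'0 p : p != j -> l' p i = 0.
  by move=> pj; have /eqP := one p; rewrite (negbTE pj) mulf_eq0 (negbTE lij0) orbF => /eqP.
have h1 := le1 l i j Pl lij; have h2 := le1 l' j i Pl' l'0.
have := congr1 absF (one j); rewrite eqxx absFM absF1 => h3.
apply: le_anti; rewrite h1 /= -{1}h3.
by apply: ler_piMl h2; apply: absF_ge0.
Qed.
End LevelOne.

(** * Matrices of operator norm one *)

Section OperatorNorm.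
Variable R : realType.
Local Notation C := (cplx R).
Local Notation cabs := (@cabs R).

Lemma vnorm_nn n (v : 'cV[C]_n) : vnorm v = Num.sqrt (nn v).
Proof.
rewrite /vnorm nnE; congr Num.sqrt; apply: eq_bigr => i _.
by rewrite big_ord1 norm_cabs.
Qed.

Section UnitNorm.
Variables (n : nat) (A : 'M[C]_n).
Hypothesis A1 : opnorm A = 1.
Let S := [set vnorm (A *m v) | v in [set v : 'cV[C]_n | vnorm v <= 1]].

Lemma opnorm1_has_sup : has_sup S.
Proof.
(* The supremum of a set without one is 0 by convention, whereas the norm is 1. *)
apply: contrapT => h; have := A1; rewrite /opnorm sup_out // => /eqP.
by rewrite eq_sym oner_eq0.
Qed.

Lemma nn_scale_rc (t : R) (v : 'cV[C]_n) : nn (rc t *: v) = t ^+ 2 * nn v.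
Proof. by rewrite (@nnZ R (cplx_over R)) (@absF_rc R (cplx_over R)) real_normK ?num_real. Qed.

Lemma opnorm1_contract (v : 'cV[C]_n) : nn (A *m v) <= nn v.
Proof.
have [->|vn] := eqVneq v 0; first by rewrite mulmx0.
have v0 : 0 < nn v by rewrite (@nn_gt0 R (cplx_over R)).
pose t := Num.sqrt (nn v); have t0 : 0 < t by rewrite sqrtr_gt0.
have t2 : t ^+ 2 = nn v by rewrite sqr_sqrtr // ltW.
have wn : nn (rc t^-1 *: v) = 1.
  by rewrite nn_scale_rc -t2 -exprMn mulVf ?gt_eqF // expr1n.
have := sup_upper_bound opnorm1_has_sup; rewrite -/(opnorm A) A1 => ub.
have : vnorm (A *m (rc t^-1 *: v)) <= 1.
  by apply: ub; exists (rc t^-1 *: v) => //=; rewrite vnorm_nn wn sqrtr1.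
rewrite vnorm_nn -scalemxAr nn_scale_rc -(ler_pXn2r (n := 2)) ?nnegrE ?sqrtr_ge0 //.
have g0 := nn_ge0 (A *m v : 'cV[cplx_over R]_n).
rewrite sqr_sqrtr ?mulr_ge0 ?exprn_ge0 ?invr_ge0 ?(ltW t0) // expr1n exprVn t2.
by rewrite mulrC ler_pdivrMr // mul1r.
Qed.

Lemma opnorm1_sharp (k : R) : 0 <= k -> (forall v : 'cV[C]_n, nn (A *m v) <= k * nn v) -> 1 <= k.
Proof.
move=> k0 h; have : opnorm A <= Num.sqrt k.
  apply: ge_sup; first by have [] := opnorm1_has_sup.
  move=> _ [v /= v1 <-]; rewrite vnorm_nn ler_sqrt //; apply: le_trans (h v) _.
  rewrite ler_piMr //; have g0 := nn_ge0 (v : 'cV[cplx_over R]_n).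
  move: v1; rewrite vnorm_nn => v1; rewrite -(sqr_sqrtr g0) -(expr1n R 2).
  by rewrite lerXn2r ?nnegrE ?sqrtr_ge0.
rewrite A1 => k1; rewrite -(sqr_sqrtr k0) -(expr1n R 2).
by rewrite lerXn2r ?nnegrE ?sqrtr_ge0.
Qed.
End UnitNorm.

End OperatorNorm.

Lemma det_mx2 (F : comRingType) (A : 'M[F]_2) : \det A = A 0 0 * A 1 1 - A 0 1 * A 1 0.
Proof.
rewrite (expand_det_row _ 0) big_ord_recl big_ord1 /cofactor /=.
have l1 : lift ord0 ord0 = 1 :> 'I_2 by apply: val_inj.
have l2 : lift 1 0 = 0 :> 'I_2 by apply: val_inj.
rewrite !det_mx11 !mxE.
have -> : lift 0 0 = 1 :> 'I_2 by apply: val_inj.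
have -> : (0 + bump 0 0 = 1)%N by [].
by rewrite l2 addn0 expr0 expr1 mul1r mulN1r mulrN.
Qed.

(** * The spectrahedron as a domain for free maps *)

Section Spectrahedron.
Variables (R : realType) (s : nat) (C1 C2 : 'M[cplx R]_s).
Local Notation C := (cplx R).
Local Notation cabs := (@cabs R).
Local Notation D := (@spectrahedron R s C1 C2).
Local Notation DP := (spectrahedronP C1 C2).

Lemma dom_dsum n m (X : mxpair R n) (Y : mxpair R m) : @D n X -> @D m Y -> @D _ (dsum_pair X Y).
Proof. by move=> /DP hX /DP hY; apply/DP; apply: pencil_pos_dsum. Qed.

Lemma dom_unitary n (X : mxpair R n) U : U \is unitarymx -> @D n X -> @D n (uconj_pair U X).
Proof. by move=> hU /DP hX; apply/DP; apply: pencil_pos_unitary. Qed.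

Lemma dom_upper_scale p q (b : C * C) (h : 'M[C]_(p, q) * 'M[C]_(p, q)) z :
  cabs z <= 1 -> @D _ (upper b h) -> @D _ (upper b (z *: h.1, z *: h.2)).
Proof. by move=> z1 /DP hX; apply/DP; apply: pencil_pos_upper_scale. Qed.

Lemma dom_sc n (b : C * C) : (0 < n)%N -> @D 1 (sc 1 b) -> @D n (sc n b).
Proof. by move=> n0 /DP /pencil_pos_sc h; apply/DP; apply/pencil_pos_sc => //; apply: h. Qed.

Lemma dom_scale n (X : mxpair R n) z : cabs z <= 1 -> @D n X -> @D n (z *: X.1, z *: X.2).
Proof. by move=> z1 /DP hX; apply/DP; apply: pencil_pos_scale. Qed.

Lemma dom_origin n : @D n (sc n (0 : C * C)).
Proof. by apply/DP; rewrite sc0; apply: pencil_pos_0. Qed.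

Hypotheses (s0 : (0 < s)%N) (hC1 : C1 \in unitmx) (hC2 : C2 \in unitmx).
Hypothesis irrE : @irreducible_pair R (cplx_over R) s (C1 *m C1 ^t*) (C2 *m C2 ^t*).
Hypothesis irrF : @irreducible_pair R (cplx_over R) s (C2 ^t* *m C2) (C1 ^t* *m C1).

Lemma dom_rigidity (b : C * C) (l : 'M[C]_2) : @D 1 (sc 1 b) -> l \in unitmx ->
  (forall p q (h : 'M[C]_(p, q) * 'M[C]_(p, q)), (0 < p)%N -> (0 < q)%N ->
     @D _ (upper 0 h) <-> @D _ (upper b (lin l h))) ->
  [/\ b != 0 -> (1 < s)%N, b != 0 -> l 0 0 = 0 \/ l 1 1 = 0 &
      b = 0 -> (1 < s)%N -> l 0 0 * l 0 1 = 0 /\ l 1 0 * l 1 1 = 0].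
Proof.
move=> /DP/pencil_pos_sc pL lu hD.
have sb := same_ball_of_upper (pL isT) (l := l).
have {}sb := sb (fun p q h p0 q0 =>
  iff_trans (iff_sym (DP _)) (iff_trans (hD p q h p0 q0) (DP _))).
apply: (pencil_rigidity s0 hC1 hC2 irrE irrF (pL isT) _ sb) => /=.
by move: lu; rewrite unitmxE det_mx2 unitfE.
Qed.
End Spectrahedron.

Lemma level_one_monomial (R : realType) (C : complexOver R) s (C1 C2 : 'M[C]_s) (l : 'M[C]_2) :
  s = 1%N -> C1 != 0 -> C2 != 0 ->
  (forall b, pencil_pos C1 C2 (sc 1 b) <-> pencil_pos C1 C2 (sc 1 (lin2 l b))) ->
  l 0 0 * l 0 1 = 0 /\ l 1 0 * l 1 1 = 0.
Proof.
move=> s1; move: C1 C2; rewrite s1 => C1 C2.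
rewrite [C1]mx11_scalar [C2]mx11_scalar => C1n C2n; apply: gauge_monomial.
  by apply: contraNneq C1n => ->; rewrite raddf0.
by apply: contraNneq C2n => ->; rewrite raddf0.
Qed.

Lemma axis_le1 (R : realType) (x : cplx R) s (C1 C2 : 'M[cplx R]_s) : opnorm C1 = 1 ->
  @pencil_pos R (cplx_over R) s C1 C2 1 (sc 1 (x, 0)) -> cabs x <= 1.
Proof.
move=> h1 Px; rewrite leNgt; apply/negP => x1.
have k0 : 0 < 2 * cabs x - 1 by lra.
have : 1 <= (2 * cabs x - 1)^-1.
  apply: (opnorm1_sharp h1) => [|v]; first by rewrite invr_ge0 ltW.
  by rewrite mulrC ler_pdivlMr // mulrC; apply: (@axis_out R (cplx_over R)) Px.
by rewrite leNgt invf_lt1 //; lra.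
Qed.

Theorem theorem1p1 (R : realType) (s : nat) (hs : (0 < s)%N)
    (C1 C2 : 'M[cplx R]_s) (hC1 : opnorm C1 = 1) (hC2 : opnorm C2 = 1)
    (C1_inv : C1 \in unitmx) (C2_inv : C2 \in unitmx)
    (gen_left : cstar_generated [set C1 ^t* *m C1; C2 ^t* *m C2] = [set: 'M[cplx R]_s])
    (gen_right : cstar_generated [set C1 *m C1 ^t*; C2 *m C2 ^t*] = [set: 'M[cplx R]_s])
    (phi : forall n, mxpair R n -> mxpair R n)
    (phi_aut : free_automorphism (@spectrahedron R s C1 C2) phi) :
  exists g1 g2 : cplx R, `|g1| = 1 /\ `|g2| = 1 /\
    ((forall n (X : mxpair R n), (0 < n)%N -> spectrahedron C1 C2 X ->
        phi n X = (g1 *: X.1, g2 *: X.2)) \/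
     (forall n (X : mxpair R n), (0 < n)%N -> spectrahedron C1 C2 X ->
        phi n X = (g2 *: X.2, g1 *: X.1))).
Proof.
have [hphi [psi [hpsi inv]]] := phi_aut.
have irrE : @irreducible_pair R (cplx_over R) s (C1 *m C1 ^t*) (C2 *m C2 ^t*).
  by apply: irreducible_of_generated gen_right; rewrite // (@ctM R (cplx_over R)) trmxCK.
have irrF : @irreducible_pair R (cplx_over R) s (C2 ^t* *m C2) (C1 ^t* *m C1).
  move=> B hB e2 e1; apply: (irreducible_of_generated hs _ _ gen_left) => //;
    by rewrite (@ctM R (cplx_over R)) trmxCK.
pose D := @spectrahedron R s C1 C2.
have rigid := dom_rigidity hs C1_inv C2_inv irrE irrF.
have rigid1 b l Pb lu hD b0 := let: And3 _ h _ := rigid b l Pb lu hD in h b0.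
have psiphi n (X : mxpair R n) : (0 < n)%N -> @D n X -> psi n (phi n X) = X.
  by move=> n0 DX; have [] := inv n X n0 DX.
have phipsi n (X : mxpair R n) : (0 < n)%N -> @D n X -> phi n (psi n X) = X.
  by move=> n0 DX; have [] := inv n X n0 DX.
have dsc := @dom_sc R s C1 C2; have dorg := @dom_origin R s C1 C2.
have fo := fixed_origin (@dom_dsum R s C1 C2) (@dom_unitary R s C1 C2)
  (@dom_upper_scale R s C1 C2) dsc (@dom_scale R s C1 C2) (dorg 1) rigid1.
have [l tl] := fo _ _ hphi hpsi psiphi phipsi.
have [l' tl'] := fo _ _ hpsi hphi phipsi psiphi.
have [_ ll] := tangent_comp hphi psiphi (dorg 1) tl tl'.
have ll' : l *m l' = 1%:M by apply: mulmx1C.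
have C1n : C1 != 0.
  by apply/eqP => e; move: C1_inv; rewrite e -(ltn_predK hs) unitr0.
have C2n : C2 != 0.
  by apply/eqP => e; move: C2_inv; rewrite e -(ltn_predK hs) unitr0.
have linear n (X : mxpair R n) : (0 < n)%N -> @D n X -> phi n X = lin l X /\ psi n X = lin l' X.
  move=> n0 DX.
  have [M M0 hM] := @pencil_pos_bounded R (cplx_over R) s C1 C2 n C1n C2n.
  have bd (Y : mxpair R n) : @D n Y -> forall i j, cabs (Y.1 i j) <= M /\ cabs (Y.2 i j) <= M.
    by move=> /spectrahedronP /hM.
  have [[a1 _ _] _ _] := hphi.
  (* Analyticity of phi includes the openness of the domain; t is the radius of a ball about the
     origin. *)
  have [t t0 [ball _]] := taylor (a1 n n0) (dorg n).
  rewrite sc0 in ball.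
  have hb (Y : mxpair R n) : nrm Y <= t -> @D n Y by move=> /ball; rewrite add0r.
  split.
    exact: (automorphism_linear hphi hpsi n0 (fun Y => psiphi n Y n0) (fun Y => phipsi n Y n0)
      tl tl' ll (@dom_scale R s C1 C2 n) t0 M0 hb bd).
  exact: (automorphism_linear hpsi hphi n0 (fun Y => phipsi n Y n0) (fun Y => psiphi n Y n0)
    tl' tl ll' (@dom_scale R s C1 C2 n) t0 M0 hb bd).
have Pl b : pencil_pos C1 C2 (sc 1 b) -> pencil_pos C1 C2 (sc 1 (lin2 l b)).
  move=> /spectrahedronP Db; apply/spectrahedronP.
  have [_ _ phiD] := hphi; have := phiD 1%N _ isT Db.
  by have [-> _] := linear 1%N _ isT Db; rewrite lin_sc.
have Pl' b : pencil_pos C1 C2 (sc 1 b) -> pencil_pos C1 C2 (sc 1 (lin2 l' b)).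
  move=> /spectrahedronP Db; apply/spectrahedronP.
  have [_ _ psiD] := hpsi; have := psiD 1%N _ isT Db.
  by have [_ ->] := linear 1%N _ isT Db; rewrite lin_sc.
have Pll b : pencil_pos C1 C2 (sc 1 b) <-> pencil_pos C1 C2 (sc 1 (lin2 l b)).
  split=> [|/Pl']; first exact: Pl.
  have e : lin2 l' (lin2 l b) = b.
    by apply: (@sc_inj R 1); rewrite // -!lin_sc lin_mul ll lin1.
  by rewrite e.
have lunit : l \in unitmx by have [] := mulmx1_unit ll.
have [m1 m2] : l 0 0 * l 0 1 = 0 /\ l 1 0 * l 1 1 = 0.
  (* For s = 1 the matrices C1 C1^* and C2 C2^* commute, and the weighted l1 ball takes the place of
     [rigid]. *)
  have [s1|s1] := ltnP 1 s; last first.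
    by apply: level_one_monomial Pll => //; apply/eqP; rewrite eqn_leq s1.
  have hD p q (h : 'M[cplx R]_(p, q) * 'M[cplx R]_(p, q)) : (0 < p)%N -> (0 < q)%N ->
      @D _ (upper 0 h) <-> @D _ (upper 0 (lin l h)).
    move=> p0 q0; have n0 : (0 < p + q)%N by rewrite addn_gt0 p0.
    have [_ _ u1] := tl; have [_ _ u2] := tl'.
    have [_ _ phiD] := hphi; have [_ _ psiD] := hpsi.
    split=> Dh; first by have := phiD _ _ n0 Dh; rewrite (u1 _ _ _ p0 q0 Dh).
    by have := psiD _ _ n0 Dh; rewrite (u2 _ _ _ p0 q0 Dh) lin_mul ll lin1.
  by have [_ _ h] := rigid 0 l (dorg 1) lunit hD; apply: h.
have ax_in (k : 'I_2) (x : cplx R) : cabs x < 1 ->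
    pencil_pos C1 C2 (sc 1 (if k == 0 then (x, 0) else (0, x))).
  move=> x1; case: (k == 0).
    by apply: (@axis_in R (cplx_over R)) => // v; apply: opnorm1_contract.
  apply: (@pencil_pos_swap R (cplx_over R)).
  by apply: (@axis_in R (cplx_over R)) => // v; apply: opnorm1_contract.
have ax_out (k : 'I_2) (x : cplx R) :
    pencil_pos C1 C2 (sc 1 (if k == 0 then (x, 0) else (0, x))) -> cabs x <= 1.
  case: (k == 0) => h; first exact: axis_le1 h.
  by apply: (axis_le1 hC2); apply: (@pencil_pos_swap R (cplx_over R)) h.
have uni i j (h : forall k, k != i -> l k j = 0) : `|l i j| = 1.
  have := @unimodular_entry R (cplx_over R) s C1 C2 l l' i j ax_in ax_out Pl Pl' ll h.
  by rewrite norm_cabs => e; rewrite [cabs _]e rmorph1.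
have ord2 (k : 'I_2) : k = 0 \/ k = 1.
  by case: k => -[|[|]] // lt; [left|right]; apply: val_inj.
move: lunit; rewrite unitmxE det_mx2 unitfE => dt.
(* Each row of l has a zero and the determinant is nonzero, so l is diagonal or antidiagonal. *)
have [l00|l00] := eqVneq (l 0 0) 0.
  have l01 : l 0 1 != 0 by apply: contraNneq dt => e; rewrite l00 e !mul0r subrr.
  have l10 : l 1 0 != 0 by apply: contraNneq dt => e; rewrite l00 e mul0r mulr0 subrr.
  have l11 : l 1 1 = 0 by move/eqP: m2; rewrite mulf_eq0 (negbTE l10) => /eqP.
  exists (l 1 0), (l 0 1); split; first by apply: uni => k; have [->|->] := ord2 k.
  split; first by apply: uni => k; have [->|->] := ord2 k.
  right=> n X n0 DX; have [-> _] := linear n X n0 DX.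
  by rewrite /lin l00 l11 !scale0r add0r addr0.
have l01 : l 0 1 = 0 by move/eqP: m1; rewrite mulf_eq0 (negbTE l00) => /eqP.
have l11 : l 1 1 != 0 by apply: contraNneq dt => e; rewrite l01 e mul0r mulr0 subrr.
have l10 : l 1 0 = 0.
  by move/eqP: m2; rewrite mulf_eq0 (negbTE l11) orbF => /eqP.
exists (l 0 0), (l 1 1); split; first by apply: uni => k; have [->|->] := ord2 k.
split; first by apply: uni => k; have [->|->] := ord2 k.
left=> n X n0 DX; have [-> _] := linear n X n0 DX.
by rewrite /lin l01 l10 !scale0r add0r addr0.
Qed.
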